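(* Let $n\ge1$ be an integer. Regard $\Phi_1:\mathbb{T}^1\times\mathbb{P}_1(\tfrac1n)\to\mathbb{P}_1(\tfrac1n)$ as the regular torification of the family $\mathcal{B}(n)$ of binomial distributions on $\{0,1,\dots,n\}$, and $\Phi_n:\mathbb{T}^n\times\mathbb{P}_n(1)\to\mathbb{P}_n(1)$ as the regular torification of the family $\mathcal{P}_{n+1}^\times$ of all strictly positive probability functions on $\{0,1,\dots,n\}$. The Veronese embedding $$m:\mathbb{P}_1(\tfrac1n)\to\mathbb{P}_n(1),\qquad [z_1,z_2]\mapsto\Big[z_1^n,\dots,\tbinom nk^{1/2}z_1^{n-k}z_2^k,\dots,z_2^n\Big]\quad(k=0,1,\dots,n)$$ is a lift of the inclusion map $\mathcal{B}(n)\hookrightarrow\mathcal{P}_{n+1}^\times$. The corresponding Lie group homomorphism $\rho:\mathbb{T}^1\to\mathbb{T}^n$, i.e. the one satisfying $m\circ(\Phi_1)_a=(\Phi_n)_{\rho(a)}\circ m$ for all $a\in\mathbb{T}^1$, is given by $\rho([t])=[nt,\dots,(n-k)t,\dots,t]$ $(k=0,\dots,n-1)$.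
   Context: Dually flat spaces. A linear connection is flat if its torsion and curvature both vanish. If $(M,h)$ is a Riemannian manifold with a linear connection $\nabla$, the dual connection $\nabla^*$ is the unique linear connection with $Xh(Y,Z)=h(\nabla_XY,Z)+h(Y,\nabla^*_XZ)$ for all vector fields $X,Y,Z$. The triple $(M,h,\nabla)$ is a dually flat space if $\nabla$ and $\nabla^*$ are both flat. Kähler structure on $TM$ (Dombrowski). Let $(M,h,\nabla)$ be dually flat, $\pi:TM\to M$ the projection, and $K:TTM\to TM$ the connector of $\nabla$ (the map, linear on each $T_u(TM)$, with $K(Y_*X)=\nabla_XY$ for all vector fields). For $u\in T_pM$ the map $A\mapsto(\pi_*A,KA)$ identifies $T_u(TM)$ with $T_pM\oplus T_pM$; under it set $g_u((v,w),(v',w'))=h_p(v,v')+h_p(w,w')$, $J_u(v,w)=(-w,v)$, $\omega_u((v,w),(v',w'))=h_p(v,w')-h_p(w,v')$. This makes $TM$ a Kähler manifold, and $TM$ always carries this structure. Parallel lattices. Let $(M,h,\nabla)$ be connected, $\dim M=n$. A parallel lattice is a subset $L\subset TM$ of the form $L=\{\sum_i k_iX_i(p)\mid p\in M,\ k_i\in\mathbb{Z}\}$ where $X=(X_1,\dots,X_n)$ are $\nabla$-parallel vector fields forming a basis of $T_pM$ at every $p$; $X$ is called a generator of $L$. $\Gamma(L)$ is the group of maps $TM\to TM$, $u\mapsto u+\sum_ik_iX_i$ ($k\in\mathbb{Z}^n$); it does not depend on the generator, acts freely and properly by holomorphic isometries, and $M_L=TM/\Gamma(L)$ carries the quotient Kähler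 structure, with quotient map $q_L:TM\to M_L$. Put $\mathbb{T}^n=\mathbb{R}^n/\mathbb{Z}^n$; for a generator $X$ let $\Phi_X([t],q_L(u))=q_L(u+\sum_it_iX_i)$, an action of $\mathbb{T}^n$ on $M_L$. Torifications and lifts. Let $N$ be a connected Kähler manifold of real dimension $2n$ with an effective holomorphic isometric action $\Phi:\mathbb{T}^n\times N\to N$; write $\Phi_a=\Phi(a,\cdot)$ and let $N^\circ$ be the set of points where $\Phi$ is free. $N$ (or $\Phi$) is a torification of the connected $n$-dimensional dually flat space $(M,h,\nabla)$ if there is a toric parametrization, i.e. a triple $(L,X,F)$ where $L$ is a parallel lattice generated by $X$ and $F:M_L\to N^\circ$ is a holomorphic isometric diffeomorphism with $F\circ(\Phi_X)_a=\Phi_a\circ F$ for all $a\in\mathbb{T}^n$. A compatible covering map is a map $\tau:TM\to N^\circ$ of the form $\tau=F\circ q_L$ for some toric parametrization $(L,X,F)$. A torification is regular if $N$ is connected, simply connected, complete with real analytic Kähler metric. A smooth map $m:N\to N'$ is a lift of a smooth map $f:M\to M'$ if there are compatible covering maps $\tau:TM\to N^\circ$ and $\tau':TM'\to(N')^\circ$ such that $m\circ\tau=\tau'\circ f_*$. Families of distributions. Both families are dually flat with the Fisher metric $h_F$ (components $\mathbb{E}_{p_\theta}(\partial_i\ln p_\theta\cdot\partial_j\ln p_\theta)$, equal to the Hessian of $\psi$ in the natural parameters $\theta$) and the exponential connection (the flat connection for which the natural parameters are affine coordinates). $\mathcal{B}(n)$: $p(k)=\binom nkq^k(1-q)^{n-k}$,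 $k\in\{0,\dots,n\}$, $q\in(0,1)$, $\theta=\ln\frac q{1-q}$, $\psi=n\ln(1+e^\theta)$. $\mathcal{P}_{n+1}^\times$: all $p>0$ with $\sum p=1$ on a set $\{x_1,\dots,x_{n+1}\}$ of $n+1$ elements (here $x_{i}=i-1$), with natural parameters $\theta\in\mathbb{R}^n$, $p(x_i)=e^{\theta_i-\psi}$ ($i\le n$), $p(x_{n+1})=e^{-\psi}$, $\psi=\ln(1+\sum_{i=1}^ne^{\theta_i})$. $\mathbb{P}_n(c)$ is complex projective space of complex dimension $n$ with the Fubini–Study metric of holomorphic sectional curvature $c>0$, and $\Phi_n([t],[z])=[e^{2i\pi t_1}z_1,\dots,e^{2i\pi t_n}z_n,z_{n+1}]$. These actions are regular torifications of the families as indicated in the claim. *)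

(* Defs.v *)
From HB Require Import structures.
From mathcomp Require Import all_boot all_order all_algebra.
From mathcomp Require Import all_classical all_reals all_analysis.
From mathcomp Require Import complex.

Set Implicit Arguments.
Unset Strict Implicit.
Unset Printing Implicit Defensive.

Import Order.TTheory GRing.Theory Num.Theory.
Import numFieldNormedType.Exports.

Local Open Scope classical_set_scope.
Local Open Scope quotient_scope.
Local Open Scope ring_scope.

Section Smoothness.
Variables (R : realType) (V W : normedModType R).

Fixpoint Ck_on (k : nat) (U : set V) (f : V -> W) : Prop :=
  match k with
  | 0 => forall x, U x -> {for x, continuous f}
  | k'.+1 => (forall x, U x -> differentiable f x) /\
             (forall v, Ck_on k' U (fun x => 'd f x v))
  end.

Definition smooth_on (U : set V) (f : V -> W) : Prop := forall k, Ck_on k U f.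

End Smoothness.

(* A manifold is given by local parametrizations [chart_par a], defined on the
   open sets [chart_dom a] of R^d (as in do Carmo, Riemannian Geometry,
   Chapter 0).  Values of [chart_par a] off [chart_dom a] and elements of
   [carrier] off [mfd_points] are junk: the manifold is the set [mfd_points].
   Tensor fields are families of components in the parametrizations, with
   compatibility conditions imposed where needed.  The manifold axioms are in
   [is_manifold]. *)
Record patches (R : realType) (d : nat) := Patches {
  carrier : Type;
  chart_ix : Type;
  chart_dom : chart_ix -> set 'rV[R]_d;
  chart_par : chart_ix -> 'rV[R]_d -> carrier }.

Section Manifolds.
Variable R : realType.

Definition mfd_points d (M : patches R d) : set (carrier M) :=
  [set p | exists a u, chart_dom a u /\ chart_par a u = p].

(* near u, the map g represents f in the parametrizations a and b *)
Definition locrep d e (M : patches R d) (N : patches R e)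
    (f : carrier M -> carrier N) (a : chart_ix M) (b : chart_ix N)
    (u : 'rV[R]_d) (g : 'rV[R]_d -> 'rV[R]_e) : Prop :=
  exists W : set 'rV[R]_d,
    [/\ open W, W u, smooth_on W g &
        forall w, W w ->
          [/\ chart_dom a w, chart_dom b (g w) &
              chart_par b (g w) = f (chart_par a w)]].

Definition smooth_map d e (M : patches R d) (N : patches R e)
    (f : carrier M -> carrier N) : Prop :=
  forall a u, chart_dom a u -> exists b g, @locrep d e M N f a b u g.

Definition mopen d (M : patches R d) (A : set (carrier M)) : Prop :=
  forall a, open (chart_dom a `&` chart_par a @^-1` A).

Definition is_manifold d (M : patches R d) : Prop :=
  [/\ forall a : chart_ix M,
        open (chart_dom a) /\ set_inj (chart_dom a) (chart_par a),
      forall (a b : chart_ix M) u u', chart_dom a u -> chart_dom b u' ->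
        chart_par a u = chart_par b u' ->
        exists g, @locrep d d M M idfun a b u g,
      forall p q : carrier M, mfd_points p -> mfd_points q -> p <> q ->
        exists A B, [/\ mopen A, mopen B, A p, B q &
                        A `&` B `&` @mfd_points d M = set0] &
      exists2 S : set (chart_ix M), countable S &
        forall p, @mfd_points d M p ->
          exists a u, [/\ S a, chart_dom a u & chart_par a u = p]].

Definition connected_mfd d (M : patches R d) : Prop :=
  (exists p, @mfd_points d M p) /\
  forall A : set (carrier M), mopen A -> mopen (~` A) ->
    @mfd_points d M `<=` A \/ @mfd_points d M `<=` ~` A.

Definition open_sub d (M : patches R d) (A : set (carrier M)) : patches R d :=
  Patches (fun a : chart_ix M => chart_dom a `&` chart_par a @^-1` A)
          (@chart_par R d M).

Definition prod_mfd d e (M : patches R d) (N : patches R e) :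
    patches R (d + e) :=
  Patches
    (fun ab : chart_ix M * chart_ix N =>
       [set x | chart_dom ab.1 (lsubmx x) /\ chart_dom ab.2 (rsubmx x)])
    (fun ab x => (chart_par ab.1 (lsubmx x), chart_par ab.2 (rsubmx x))).

(* covariant 2-tensors, (1,1)-tensors, vector fields: components at the
   parameter u of the parametrization a *)
Definition form2 d (M : patches R d) :=
  chart_ix M -> 'rV[R]_d -> 'rV[R]_d -> 'rV[R]_d -> R.
Definition endo d (M : patches R d) :=
  chart_ix M -> 'rV[R]_d -> 'rV[R]_d -> 'rV[R]_d.
Definition vfield d (M : patches R d) :=
  chart_ix M -> 'rV[R]_d -> 'rV[R]_d.
(* Christoffel symbols: nabla_X Y = dY(X) + G_a(u)(X, Y) *)
Definition christoffel d (M : patches R d) :=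
  chart_ix M -> 'rV[R]_d -> 'rV[R]_d -> 'rV[R]_d -> 'rV[R]_d.

(* f^* h' = h *)
Definition pulls_back d e (M : patches R d) (N : patches R e)
    (f : carrier M -> carrier N) (h : form2 M) (h' : form2 N) : Prop :=
  forall a b u g, @locrep d e M N f a b u g ->
    forall v w, h' b (g u) ('d g u v) ('d g u w) = h a u v w.

(* f_* J = J' f_* *)
Definition intertwines d e (M : patches R d) (N : patches R e)
    (f : carrier M -> carrier N) (J : endo M) (J' : endo N) : Prop :=
  forall a b u g, @locrep d e M N f a b u g ->
    forall v, J' b (g u) ('d g u v) = 'd g u (J a u v).

Definition is_riemannian d (M : patches R d) (h : form2 M) : Prop :=
  [/\ forall a u, chart_dom a u -> forall (c : R) v v' w,
        h a u (c *: v + v') w = c * h a u v w + h a u v' w,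
      forall a u, chart_dom a u -> forall v w, h a u v w = h a u w v,
      forall a u, chart_dom a u -> forall v, v != 0 -> 0 < h a u v v,
      forall a v w, smooth_on (chart_dom a) (fun u => h a u v w) &
      @pulls_back d d M M idfun h h].

Definition is_connection d (M : patches R d) (G : christoffel M) : Prop :=
  [/\ forall a u, chart_dom a u -> forall (c : R) v v' w,
        G a u (c *: v + v') w = c *: G a u v w + G a u v' w,
      forall a u, chart_dom a u -> forall (c : R) v w w',
        G a u v (c *: w + w') = c *: G a u v w + G a u v w',
      forall a v w, smooth_on (chart_dom a) (fun u => G a u v w) &
      forall a b u g, @locrep d d M M idfun a b u g -> forall v w,
        G b (g u) ('d g u v) ('d g u w) =
        'd g u (G a u v w) - 'D_v (fun x => 'd g x w) u].

(* torsion and curvature, evaluated on constant coordinate fields *)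
Definition flat_connection d (M : patches R d) (G : christoffel M) : Prop :=
  forall a u, chart_dom a u ->
    (forall v w, G a u v w - G a u w v = 0) /\
    (forall v w x,
       'D_v (fun y => G a y w x) u - 'D_w (fun y => G a y v x) u
       + G a u v (G a u w x) - G a u w (G a u v x) = 0).

Definition dual_connection d (M : patches R d) (h : form2 M)
    (G G' : christoffel M) : Prop :=
  forall a u, chart_dom a u -> forall x v w,
    'D_x (fun y => h a y v w) u = h a u (G a u x v) w + h a u v (G' a u x w).

Definition is_vfield d (M : patches R d) (X : vfield M) : Prop :=
  (forall a, smooth_on (chart_dom a) (X a)) /\
  forall a b u g, @locrep d d M M idfun a b u g -> X b (g u) = 'd g u (X a u).

Definition parallel_vfield d (M : patches R d) (G : christoffel M)
    (X : vfield M) : Prop :=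
  forall a u, chart_dom a u -> forall v, 'd (X a) u v + G a u v (X a u) = 0.

End Manifolds.

Section TangentBundle.
Variable R : realType.

Definition tcoord d (M : patches R d) : Type :=
  (chart_ix M * 'rV[R]_d * 'rV[R]_d)%type.

(* A tangent vector is the set of all its coordinate expressions (a, u, v):
   parametrization, base point, components. *)
Definition tmap d e (M : patches R d) (N : patches R e)
    (f : carrier M -> carrier N) (A : set (tcoord M)) : set (tcoord N) :=
  [set t' : tcoord N | exists (t : tcoord M) (g : 'rV[R]_d -> 'rV[R]_e),
     [/\ A t, @locrep R d e M N f t.1.1 t'.1.1 t.1.2 g,
         t'.1.2 = g t.1.2 & t'.2 = 'd g (t.1.2) t.2]].

Definition tvec d (M : patches R d) (a : chart_ix M) (u v : 'rV[R]_d) :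
    set (tcoord M) :=
  @tmap d d M M idfun [set (a, u, v)].

Definition tangent_bundle d (M : patches R d) : patches R (d + d) :=
  Patches (fun (a : chart_ix M) x => chart_dom a (lsubmx x))
          (fun a x => tvec a (lsubmx x) (rsubmx x)).

End TangentBundle.

Section DuallyFlatKahler.
Variable R : realType.

Record stat_space (d : nat) := StatSpace {
  stat_base : patches R d;
  stat_metric : form2 stat_base;
  stat_conn : christoffel stat_base }.

Definition dually_flat d (D : stat_space d) : Prop :=
  [/\ is_manifold (stat_base D), is_riemannian (@stat_metric d D),
      is_connection (@stat_conn d D), flat_connection (@stat_conn d D) &
      exists2 G' : christoffel (stat_base D), is_connection G' &
        dual_connection (@stat_metric d D) (@stat_conn d D) G' /\
        flat_connection G'].

Record herm_mfd (d : nat) := Hermitian {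
  herm_space : patches R d;
  herm_g : form2 herm_space;
  herm_J : endo herm_space }.

Definition std_J n (x : 'rV[R]_(n + n)) : 'rV[R]_(n + n) :=
  row_mx (- rsubmx x) (lsubmx x).

(* existence of local holomorphic coordinates phi *)
Definition integrable_J n (M : patches R (n + n)) (J : endo M) : Prop :=
  forall a u, chart_dom a u ->
    exists (W : set 'rV[R]_(n + n)) phi w,
      [/\ open W, W w, phi w = u, smooth_on W phi &
          forall y, W y ->
            [/\ chart_dom a (phi y), injective ('d phi y) &
                forall v, 'd phi y (std_J v) = J a (phi y) ('d phi y v)]].

Definition kahler_form d (N : herm_mfd d) : form2 (herm_space N) :=
  fun a u v w => herm_g a u (herm_J a u v) w.

Definition is_kahler n (N : herm_mfd (n + n)) : Prop :=
  let M := herm_space N in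
  [/\ is_manifold M, is_riemannian (@herm_g _ N) &
  [/\ forall a u, @chart_dom _ _ M a u -> forall (c : R) v v',
        herm_J a u (c *: v + v') = c *: herm_J a u v + herm_J a u v',
      forall a v, smooth_on (@chart_dom _ _ M a) (fun u => herm_J a u v),
      @intertwines R _ _ M M idfun (@herm_J _ N) (@herm_J _ N),
      forall a u, @chart_dom _ _ M a u -> forall v w,
        herm_J a u (herm_J a u v) = - v /\
        herm_g a u (herm_J a u v) (herm_J a u w) = herm_g a u v w &
      integrable_J (@herm_J _ N)] /\
      forall a u, @chart_dom _ _ M a u -> forall v w x,
        'D_v (fun y => @kahler_form _ N a y w x) u
        + 'D_w (fun y => @kahler_form _ N a y x v) u
        + 'D_x (fun y => @kahler_form _ N a y v w) u = 0].

Definition herm_sub d (N : herm_mfd d) (A : set (carrier (herm_space N))) :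
    herm_mfd d :=
  @Hermitian d (open_sub A) (@herm_g d N) (@herm_J d N).

Definition hol_isometric d e (N : herm_mfd d) (N' : herm_mfd e)
    (f : carrier (herm_space N) -> carrier (herm_space N')) : Prop :=
  [/\ @smooth_map R d e (herm_space N) (herm_space N') f,
      @pulls_back R d e (herm_space N) (herm_space N') f
        (@herm_g d N) (@herm_g e N') &
      @intertwines R d e (herm_space N) (herm_space N') f
        (@herm_J d N) (@herm_J e N')].

Definition hol_isometric_diffeo d e (N : herm_mfd d) (N' : herm_mfd e)
    (f : carrier (herm_space N) -> carrier (herm_space N')) : Prop :=
  hol_isometric f /\
  exists2 f' : carrier (herm_space N') -> carrier (herm_space N),
    @smooth_map R e d (herm_space N') (herm_space N) f' &
    (forall p, mfd_points p -> f' (f p) = p) /\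
    (forall q, mfd_points q -> f (f' q) = q).

(* At x = (u, xi), a tangent vector A = (v, b) to TM has pi_* A = v and
   K A = b + G(v, xi), with G the Christoffel symbols; [dom_vec] is the inverse
   of A |-> (pi_* A, K A). *)
Definition dom_hor d (A : 'rV[R]_(d + d)) : 'rV[R]_d := lsubmx A.
Definition dom_K d (D : stat_space d) (a : chart_ix (stat_base D))
    (x A : 'rV[R]_(d + d)) : 'rV[R]_d :=
  rsubmx A + stat_conn a (lsubmx x) (lsubmx A) (rsubmx x).
Definition dom_vec d (D : stat_space d) (a : chart_ix (stat_base D))
    (x : 'rV[R]_(d + d)) (v w : 'rV[R]_d) : 'rV[R]_(d + d) :=
  row_mx v (w - stat_conn a (lsubmx x) v (rsubmx x)).

Definition dombrowski d (D : stat_space d) : herm_mfd (d + d) :=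
  @Hermitian (d + d) (tangent_bundle (stat_base D))
    (fun a x A B =>
       stat_metric a (lsubmx x) (dom_hor A) (dom_hor B) +
       stat_metric a (lsubmx x) (dom_K a x A) (dom_K a x B))
    (fun a x A => dom_vec a x (- dom_K a x A) (dom_hor A)).

End DuallyFlatKahler.

Section Torus.
Variables (R : realType) (n : nat).

Definition int_vec : {pred 'rV[R]_n} := [pred t | t \is a mxOver Num.int].

Fact int_vec_closed : zmod_closed int_vec.
Proof.
split; first by apply/mxOverP => i j; rewrite mxE rpred0.
by move=> a b /mxOverP ha /mxOverP hb; apply/mxOverP => i j;
  rewrite !mxE rpredB.
Qed.
HB.instance Definition _ := GRing.isZmodClosed.Build _ int_vec int_vec_closed.

Definition torus := Quotient.quot (int_vec : zmodClosed _).
HB.instance Definition _ := GRing.Zmodule.on torus.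

Definition torus_class (t : 'rV[R]_n) : torus := \pi_torus t.

Definition torus_mfd : patches R n :=
  Patches
    (fun W : set 'rV[R]_n => [set x | [/\ open W, set_inj W torus_class & W x]])
    (fun _ => torus_class).

End Torus.

Definition lie_hom (R : realType) m n (rho : torus R m -> torus R n) : Prop :=
  {morph rho : a b / a + b} /\
  @smooth_map R m n (torus_mfd R m) (torus_mfd R n) rho.

Section Torification.
Variables (R : realType) (n : nat) (D : stat_space R n).

Let M := stat_base D.
Let TM := tangent_bundle M.

Definition parallel_frame (X : 'I_n -> vfield M) : Prop :=
  [/\ forall i, is_vfield (X i),
      forall i, parallel_vfield (@stat_conn R n D) (X i) &
      forall a u, @chart_dom _ _ M a u -> \matrix_i X i a u \in unitmx].

Definition comb (X : 'I_n -> vfield M) (t : 'rV[R]_n) : vfield M :=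
  fun a u => \sum_i t 0 i *: X i a u.

Definition lattice_of (X : 'I_n -> vfield M) : set (carrier TM) :=
  [set A | exists a u k,
     [/\ chart_dom a u, k \in @int_vec R n & A = tvec a u (comb X k a u)]].

(* u |-> u + sum_i t_i X_i *)
Definition fiber_translate (X : 'I_n -> vfield M) (t : 'rV[R]_n)
    (A : carrier TM) : carrier TM :=
  [set (c.1, c.2 + comb X t c.1.1 c.1.2) | c in A].

(* the projection q_L, for L generated by X: orbits of Gamma(L) *)
Definition quot_proj (X : 'I_n -> vfield M) (A : carrier TM) :
    set (carrier TM) :=
  [set fiber_translate X k A | k in [set k | k \in @int_vec R n]].

(* parametrized by restrictions of those of TM to open sets where q_L is
   injective *)
Definition quot_mfd (X : 'I_n -> vfield M) : patches R (n + n) :=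
  Patches
    (fun aW : chart_ix TM * set 'rV[R]_(n + n) =>
       [set x | [/\ open aW.2, aW.2 `<=` chart_dom aW.1,
                    set_inj aW.2 (fun y => quot_proj X (chart_par aW.1 y)) &
                    aW.2 x]])
    (fun aW x => quot_proj X (chart_par aW.1 x)).

Definition quot_kahler (X : 'I_n -> vfield M) : herm_mfd R (n + n) :=
  @Hermitian R (n + n) (quot_mfd X)
    (fun aW => @herm_g R _ (dombrowski D) aW.1)
    (fun aW => @herm_J R _ (dombrowski D) aW.1).

(* Phi_X([t], q_L(u)) = q_L(u + sum_i t_i X_i) *)
Definition frame_action (X : 'I_n -> vfield M) (a : torus R n)
    (Q : carrier (quot_mfd X)) : carrier (quot_mfd X) :=
  [set B | exists t A, [/\ torus_class t = a, Q A & B = fiber_translate X t A]].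

Variables (N : herm_mfd R (n + n))
          (Phi : torus R n -> carrier (herm_space N) -> carrier (herm_space N)).

Definition free_points : set (carrier (herm_space N)) :=
  [set p | mfd_points p /\ forall a, Phi a p = p -> a = 0].

Definition toric_parametrization (L : set (carrier TM))
    (X : 'I_n -> vfield M)
    (F : set (carrier TM) -> carrier (herm_space N)) : Prop :=
  [/\ parallel_frame X, L = lattice_of X,
      @hol_isometric_diffeo R _ _ (quot_kahler X) (herm_sub free_points) F &
      forall a Q, @mfd_points R _ (quot_mfd X) Q ->
        F (@frame_action X a Q) = Phi a (F Q)].

Definition compatible_covering
    (tau : carrier TM -> carrier (herm_space N)) : Prop :=
  exists L X F, toric_parametrization L X F /\
    forall A, @mfd_points R _ TM A -> tau A = F (quot_proj X A).

Definition torus_action : Prop :=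
  [/\ forall a p, @mfd_points R _ (herm_space N) p -> mfd_points (Phi a p),
      forall p, @mfd_points R _ (herm_space N) p -> Phi 0 p = p,
      forall a b p, @mfd_points R _ (herm_space N) p ->
        Phi (a + b) p = Phi a (Phi b p) &
      @smooth_map R _ _ (prod_mfd (torus_mfd R n) (herm_space N)) (herm_space N)
        (fun ap => Phi ap.1 ap.2)].

Definition effective_action : Prop :=
  forall a, (forall p, @mfd_points R _ (herm_space N) p -> Phi a p = p) ->
    a = 0.

Definition torification : Prop :=
  [/\ dually_flat D /\ connected_mfd M,
      is_kahler N /\ connected_mfd (herm_space N),
      torus_action /\ effective_action,
      forall a, @hol_isometric R _ _ N N (Phi a) &
      exists L X F, toric_parametrization L X F].

End Torification.

Definition is_lift (R : realType) n n'
    (D : stat_space R n) (N : herm_mfd R (n + n))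
    (Phi : torus R n -> carrier (herm_space N) -> carrier (herm_space N))
    (D' : stat_space R n') (N' : herm_mfd R (n' + n'))
    (Phi' : torus R n' -> carrier (herm_space N') -> carrier (herm_space N'))
    (m : carrier (herm_space N) -> carrier (herm_space N'))
    (f : carrier (stat_base D) -> carrier (stat_base D')) : Prop :=
  [/\ @smooth_map R _ _ (herm_space N) (herm_space N') m,
      @smooth_map R _ _ (stat_base D) (stat_base D') f &
      exists tau tau',
        [/\ @compatible_covering R n D N Phi tau,
            @compatible_covering R n' D' N' Phi' tau' &
            forall A, @mfd_points R _ (tangent_bundle (stat_base D)) A ->
              m (tau A) =
              tau' (@tmap R n n' (stat_base D) (stat_base D') f A)]].

Section Families.
Variable R : realType.

(* A family of probability functions on a finite set I, parametrized by
   natural parameters theta in R^d. *)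
Definition family_mfd (I : finType) d (p : 'rV[R]_d -> I -> R) : patches R d :=
  Patches (fun _ : unit => [set: 'rV[R]_d]) (fun _ => p).

(* Fisher metric, and the connection whose affine coordinates are theta *)
Definition exp_family (I : finType) d (p : 'rV[R]_d -> I -> R) :
    stat_space R d :=
  @StatSpace R d (family_mfd p)
    (fun _ theta v w =>
       \sum_(k : I) p theta k * ('D_v (fun x => ln (p x k)) theta
                                 * 'D_w (fun x => ln (p x k)) theta))
    (fun _ _ _ _ => 0).

Definition binomial_pf n (q : R) (k : 'I_n.+1) : R :=
  'C(n, k)%:R * q ^+ k * (1 - q) ^+ (n - k).

(* theta = ln (q / (1 - q)) *)
Definition binomial_par n (theta : 'rV[R]_1) : 'I_n.+1 -> R :=
  binomial_pf (expR (theta 0 0) / (1 + expR (theta 0 0))).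

Definition simplex_par n (theta : 'rV[R]_n) (k : 'I_n.+1) : R :=
  let psi := ln (1 + \sum_i expR (theta 0 i)) in
  if unlift ord_max k is Some i then expR (theta 0 i - psi) else expR (- psi).

Definition binomials n : stat_space R 1 := exp_family (@binomial_par n).
Definition simplex n : stat_space R n := exp_family (@simplex_par n).

End Families.

Section ProjectiveSpace.
Variable R : realType.
Local Notation C := R[i].
Local Open Scope complex_scope.

(* [z]: points of projective space are the sets C^* z, for z != 0 *)
Definition proj_pt n (z : 'rV[C]_n.+1) : set 'rV[C]_n.+1 :=
  [set l *: z | l in [set l : C | l != 0]].

(* insert s at position k in the complex vector x_1 + i x_2, x = (x_1, x_2) *)
Definition homog n (s : C) (k : 'I_n.+1) (x : 'rV[R]_(n + n)) : 'rV[C]_n.+1 :=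
  \row_j (if unlift k j is Some i then lsubmx x 0 i +i* rsubmx x 0 i else s).

Definition cdot n (a b : 'rV[C]_n) : C := \sum_j a 0 j * (b 0 j)^*.

(* The Fubini-Study metric with constant holomorphic sectional curvature c, at
   z with tangent vectors represented by a, b in C^(n+1):
   4/c * Re (<a,b><z,z> - <a,z><z,b>) / <z,z>^2 *)
Definition fubini_study n (c : R) (z a b : 'rV[C]_n.+1) : R :=
  4 / c * complex.Re ((cdot a b * cdot z z - cdot a z * cdot z b)
                      / cdot z z ^+ 2).

Definition proj_mfd n : patches R (n + n) :=
  Patches (fun _ : 'I_n.+1 => [set: 'rV[R]_(n + n)])
          (fun k x => proj_pt (homog 1 k x)).

Definition proj_space n (c : R) : herm_mfd R (n + n) :=
  @Hermitian R (n + n) (proj_mfd n)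
    (fun k x v w => fubini_study c (homog 1 k x) (homog 0 k v) (homog 0 k w))
    (fun _ _ v => std_J v).

Definition cis (x : R) : C := cos x +i* sin x.

Definition torus_rot n (t : 'rV[R]_n) (z : 'rV[C]_n.+1) : 'rV[C]_n.+1 :=
  \row_j (if unlift ord_max j is Some i then cis (2 * pi * t 0 i) * z 0 j
          else z 0 j).

(* Phi_n([t], [z]) *)
Definition proj_action n (a : torus R n) (P : set 'rV[C]_n.+1) :
    set 'rV[C]_n.+1 :=
  [set w | exists t z,
     [/\ torus_class t = a, P z & proj_pt (torus_rot t z) w]].

Definition veronese_vec n (z : 'rV[C]_2) : 'rV[C]_n.+1 :=
  \row_k ((Num.sqrt ('C(n, k)%:R : R))%:C * z 0 0 ^+ (n - k) * z 0 1 ^+ k).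

Definition veronese n (P : set 'rV[C]_2) : set 'rV[C]_n.+1 :=
  [set w | exists2 z, P z & proj_pt (veronese_vec n z) w].

End ProjectiveSpace.

(* Main.v *)
Require Import Defs.
From HB Require Import structures.
From mathcomp Require Import all_boot all_order all_algebra.
From mathcomp Require Import all_classical all_reals all_analysis.
From mathcomp Require Import complex ring lra.

(** Both families carry a Fisher metric of one and the same form. The softmax of
    a vector [u] of length n is the probability on n + 1 points with weights
    [exp (u_i)] and 1; let [cov u] be its covariance form on the functions that
    vanish at the last point, which is the Hessian of [ln (1 + sum exp (u_i))].
    In natural parameters the Fisher metric is [s^2 / c * cov (s u)], with
    [s = c = 1] for the simplex ([simplex_fisher]) and, for the binomial family,
    one parameter, [s = -1] and [c = 1/n]; the latter is the variance
    [n q (1 - q)], which is symmetric in [q] and [1 - q] ([binomial_fisher]).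

    For every family with such a metric, the map
    [u + i xi |-> [exp (s (u + i xi) / 2), 1]] is holomorphic and pulls the
    Fubini-Study metric of curvature c back to the metric of Dombrowski on the
    tangent bundle ([fs_toric_exp]), since the squared moduli of its homogeneous
    coordinates are the weights of the softmax of [s u]. Translation by
    [(4 pi / s) t] in the fibers becomes the rotation by [t], so that the map is
    injective modulo the lattice of step [4 pi / s]. Its image consists of the
    points without zero coordinates, and these are exactly the points on which
    the torus acts freely ([free_pointsP]). This gives
    [family_torification]. The dual connection is the one for which the
    expectation parameters are affine ([mixture_conn]).

    The metric and the complex structure of projective space are always computed
    on homogeneous lifts of maps: in a chart, the differential of a map is that
    of a lift up to a factor and modulo the line of the lift ([lift_deriv]), and
    the Fubini-Study form is insensitive to both ([fs_herm_inv]).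

    In natural parameters the inclusion of the binomial family is affine,
    [u |-> (ln C(n, k) + (k - n) u)_k], and its tangent map acts on [u + i xi] by
    the same formula. Applying the exponential with [s = 1] turns it into
    [sqrt (C(n, k)) * (exp (- (u + i xi) / 2))^(n - k)], which is the Veronese
    embedding after the exponential with [s = -1] ([veronese_toric_exp]). The
    homomorphism of tori is read off from the degrees of the monomials, and it is
    unique because the embedding meets the set where the action is free
    ([veronese_hom_unique]). *)

Set Implicit Arguments.
Unset Strict Implicit.
Unset Printing Implicit Defensive.

Import Order.TTheory GRing.Theory Num.Theory.
Import numFieldNormedType.Exports.

Local Open Scope ring_scope.

(** * Functions of class C^k *)

Section CkCalculus.
Variables (R : realType) (V : normedModType R).

Lemma near_zero_is_diff (W : normedModType R) (f : V -> W) x :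
  (\forall y \near x, f y = 0) -> is_diff x f 0.
Proof.
move=> f0; have fx0 : f x = 0 by exact: nbhs_singleton f0.
have H : continuous (0 : V -> W) /\
    f \o shift x = cst (f x) + \0 +o_ 0 id.
  split; first exact: cst_continuous.
  apply/eqaddoE; rewrite fx0; apply/eqaddoP => _/posnumP[e].
  near=> h; rewrite /= !fctE /= addr0 subr0.
  suff -> : f (h + x) = 0 by rewrite normr0 mulr_ge0.
  near: h; move: f0; rewrite (near_shift 0 x) /= => f0.
  by near do rewrite -[x in _ + x]subr0; exact: f0.
case: H => H1 H2.
have E : 'd f x = 0 :> (V -> W).
  exact: (diff_unique H1 H2).
split=> //; apply/diff_locallyP; split; rewrite ?E //.
Unshelve. all: by end_near. Qed.

Lemma near_eq_is_diff (W : normedModType R) (f g : V -> W) x :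
  (\forall y \near x, f y = g y) -> differentiable f x ->
  is_diff x g ('d f x).
Proof.
move=> fg df.
have d0 : is_diff x (g - f) 0.
  apply: near_zero_is_diff; apply: filterS fg => y fgy.
  by rewrite -[LHS]/(g y - f y) fgy subrr.
have -> : g = f + (g - f) by rewrite addrC subrK.
have df' := differentiableP df.
by apply: is_diff_eq; rewrite addr0.
Qed.

Lemma Ck_cont (W : normedModType R) k U (f : V -> W) :
  Ck_on k U f -> forall x, U x -> {for x, continuous f}.
Proof.
case: k => [//|k] [df _] x Ux; exact: differentiable_continuous (df x Ux).
Qed.

Lemma Ck_le (W : normedModType R) k U (f : V -> W) :
  Ck_on k.+1 U f -> Ck_on k U f.
Proof.
elim: k f => [|k IH] f; first exact: Ck_cont.
by move=> [df Hf]; split => // v; exact: IH.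
Qed.

Lemma Ck_sub (W : normedModType R) k U U' (f : V -> W) :
  (U' `<=` U)%classic -> Ck_on k U f -> Ck_on k U' f.
Proof.
move=> UU; elim: k f => [|k IH] f /=; first by move=> H x /UU /H.
by move=> [H1 H2]; split=> [x /UU /H1|v] //; exact: IH.
Qed.

Lemma Ck_eq (W : normedModType R) k U (f g : V -> W) : open U ->
  (forall x, U x -> f x = g x) -> Ck_on k U f -> Ck_on k U g.
Proof.
move=> oU; elim: k f g => [|k IH] f g fg /=.
  move=> H x Ux; rewrite /prop_for /continuous_at -(fg _ Ux).
  apply: cvg_trans (H x Ux); apply: near_eq_cvg.
  by near do apply: fg; exact: open_nbhs_nbhs.
have nfg x : U x -> \forall y \near x, f y = g y.
  by move=> Ux; near do apply: fg; exact: open_nbhs_nbhs.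
move=> [H1 H2]; split=> [x Ux|v].
  by case: (near_eq_is_diff (nfg x Ux) (H1 x Ux)).
apply: (IH _ _ _ (H2 v)) => x Ux.
by case: (near_eq_is_diff (nfg x Ux) (H1 x Ux)) => _ ->.
Unshelve. all: by end_near. Qed.

Lemma Ck_cst (W : normedModType R) k U (c : W) : Ck_on k U (fun _ : V => c).
Proof.
elim: k c => [|k IH] c /=; first by move=> x _; exact: cst_continuous.
split=> [x _|v]; first exact: differentiable_cst.
under eq_fun do rewrite (diff_cst c).
exact: IH.
Qed.

Lemma CkD (W : normedModType R) k U (f g : V -> W) : open U ->
  Ck_on k U f -> Ck_on k U g -> Ck_on k U (fun x => f x + g x).
Proof.
move=> oU; elim: k f g => [|k IH] f g /=.
  by move=> H1 H2 x Ux; apply: continuousD; [exact: H1|exact: H2].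
move=> [f1 f2] [g1 g2]; split=> [x Ux|v].
  by apply: differentiableD; [exact: f1|exact: g1].
apply: (Ck_eq oU _ (IH _ _ (f2 v) (g2 v))) => x Ux.
exact: esym (congr1 (fun h : V -> W => h v) (diffD (f1 x Ux) (g1 x Ux))).
Qed.

Lemma Ck_sum (W : normedModType R) k U n (F : 'I_n -> V -> W) : open U ->
  (forall i, Ck_on k U (F i)) -> Ck_on k U (fun x => \sum_i F i x).
Proof.
move=> oU; elim: n F => [|n IH] F HF.
  by under eq_fun do rewrite big_ord0; exact: Ck_cst.
under eq_fun do rewrite big_ord_recl.
by apply: CkD => //; exact: IH.
Qed.

Lemma Ck_scale (W : normedModType R) k U (f : V -> R) (w : W) : open U ->
  Ck_on k U f -> Ck_on k U (fun x => f x *: w).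
Proof.
move=> oU; elim: k f => [|k IH] f /=.
  by move=> H1 x Ux; apply: continuousZr_tmp; exact: H1.
move=> [f1 f2]; split=> [x Ux|v].
  by apply: differentiableZl; exact: f1.
apply: (Ck_eq oU _ (IH _ (f2 v))) => x Ux.
exact: esym (congr1 (fun h : V -> W => h v) (diffZl w (f1 x Ux))).
Qed.

Lemma Ck_rV k U n (g : V -> 'rV[R]_n) : open U ->
  (forall j, Ck_on k U (fun x => g x 0 j)) -> Ck_on k U g.
Proof.
move=> oU H.
apply: (@Ck_eq _ k U (fun x => \sum_j g x 0 j *: (delta_mx 0 j : 'rV[R]_n))) => //.
  by move=> x _; rewrite [RHS]row_sum_delta.
by apply: Ck_sum => // j; exact: Ck_scale.
Qed.

Lemma Ck_lin (W : normedModType R) k U (f : {linear V -> W}) :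
  continuous f -> Ck_on k U f.
Proof.
move=> cf; case: k => [|k] /=; first by move=> x _; exact: cf.
split=> [x _|v]; first exact: linear_differentiable.
under eq_fun do rewrite diff_lin //.
exact: Ck_cst.
Qed.

Lemma CkM k U (f g : V -> R) : open U ->
  Ck_on k U f -> Ck_on k U g -> Ck_on k U (fun x => f x * g x).
Proof.
move=> oU; elim: k f g => [|k IH] f g.
  by move=> H1 H2 x Ux; apply: continuousM; [exact: H1|exact: H2].
move=> fk gk; have f0 := Ck_le fk; have g0 := Ck_le gk.
move: fk gk => /= [f1 f2] [g1 g2]; split=> [x Ux|v].
  by apply: differentiableM; [exact: f1|exact: g1].
apply: (Ck_eq oU _ (CkD oU (IH _ _ f0 (g2 v)) (IH _ _ g0 (f2 v)))) => x Ux.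
exact: esym (congr1 (fun h : V -> R => h v) (diffM (f1 x Ux) (g1 x Ux))).
Qed.

(** The outer function has one variable, and so has its derivative: the chain
    rule can be iterated by induction on [k]. *)
Lemma Ck_comp k (U : set V) (D : set R) (phi : R -> R) (f : V -> R) : open U ->
  (forall x, U x -> D (f x)) ->
  Ck_on k D phi -> Ck_on k U f -> Ck_on k U (fun x => phi (f x)).
Proof.
move=> oU Df; elim: k phi => [|k IH] phi.
  move=> H1 H2 x Ux; apply: continuous_comp; first exact: H2.
  by apply: H1; exact: Df.
move=> pk fk; have f0 := Ck_le fk.
move: pk fk => [p1 p2] [f1 f2]; split=> [x Ux|v].
  by apply: differentiable_comp; [exact: f1|exact/p1/Df].
apply: (Ck_eq oU _ (CkM oU (f2 v) (IH _ (p2 1) f0))) => x Ux.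
have := congr1 (fun h : V -> R => h v) (diff_comp (f1 x Ux) (p1 _ (Df _ Ux))).
rewrite /= => ->.
by rewrite -[X in _ = 'd phi _ X]mulr1 linearZ.
Qed.

End CkCalculus.

(** * Elementary functions and complex-valued functions *)

Section RealFunctions.
Local Open Scope complex_scope.
Variable R : realType.

(** The elementary functions below have derivatives that are polynomials in
    functions already known to be of class C^k or in themselves, so that their
    smoothness follows by induction on [k]. *)
Lemma Ck_primitive k (D : set R) (phi phi' : R -> R) : open D ->
  (forall x, D x -> is_derive x 1 phi (phi' x)) ->
  Ck_on k D phi' -> Ck_on k.+1 D phi.
Proof.
move=> oD dphi Cphi; have dd x : D x -> differentiable phi x.
  by move=> /dphi [H _]; exact/derivable1_diffP.
split=> // v; apply: (Ck_eq oD _ (CkM oD (Ck_cst k D v) Cphi)) => x Dx.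
have [H1 H2] := dphi x Dx.
have E : 'd phi x 1 = phi' x by rewrite -deriveE //; exact: dd.
by rewrite -[v in RHS]mulr1 linearZ E.
Qed.

Lemma smooth_expR : smooth_on [set: R] expR.
Proof.
elim=> [|k IH]; first by move=> x _; exact: continuous_expR.
by apply: (Ck_primitive openT _ IH) => x _; exact: is_derive_expR.
Qed.

Lemma smooth_cos_sin :
  smooth_on [set: R] (@cos R) /\ smooth_on [set: R] (@sin R).
Proof.
suff H k : Ck_on k [set: R] (@cos R) /\ Ck_on k [set: R] (@sin R).
  by split=> k; have [] := H k.
elim: k => [|k [IHc IHs]].
  by split=> x _; [exact: continuous_cos|exact: continuous_sin].
split.
  have C := CkM openT (Ck_cst k [set: R] (-1 : R)) IHs.
  by apply: (Ck_primitive openT _ C) => x _; rewrite mulN1r; exact: is_derive_cos.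
by apply: (Ck_primitive openT _ IHc) => x _; exact: is_derive_sin.
Qed.

Lemma smooth_inv : smooth_on [set x : R | x != 0] GRing.inv.
Proof.
have oD : open [set x : R | x != 0]%classic by exact: open_neq.
elim=> [|k IH]; first by move=> x x0; exact: inv_continuous.
have C := CkM oD (Ck_cst k [set x : R | x != 0]%classic (-1 : R)) (CkM oD IH IH).
apply: (Ck_primitive oD _ C) => x x0.
have dx := @derivable_id R R x 1.
split; first exact: derivableV.
by rewrite deriveV // derive_id -expr2 exprVn mulN1r [_ *: _]mulr1.
Qed.

Lemma smooth_ln : smooth_on [set x : R | 0 < x] (@ln R).
Proof.
have oD : open [set x : R | 0 < x]%classic by exact: open_gt.
case=> [|k].
  move=> x /= x0; apply: differentiable_continuous.
  by apply/derivable1_diffP; have [] := is_derive1_ln x0.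
apply: (Ck_primitive oD _ (Ck_sub _ (smooth_inv k))) => x /=.
by move=> /lt0r_neq0.
Qed.

Lemma smooth_atan : smooth_on [set: R] (@atan R).
Proof.
case=> [|k]; first by move=> x _; exact: continuous_atan.
have Cid : Ck_on k [set: R] (id : R -> R) 
  by apply: (@Ck_lin _ _ _ k [set: R] (@idfun R)); move=> x; exact: cvg_id.
have Csq := CkD openT (Ck_cst k [set: R] (1 : R)) (CkM openT Cid Cid).
apply: (Ck_primitive openT _ (Ck_comp openT _ (smooth_inv k) Csq)) => x _ /=.
  by rewrite gt_eqF // ltr_pwDl // -expr2 sqr_ge0.
Qed.

End RealFunctions.

Section ComplexRules.
Local Open Scope complex_scope.
Variable R : realType.
Implicit Types x y : R[i].
Local Notation Re := complex.Re.
Local Notation Im := complex.Im.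

Lemma cReD x y : Re (x + y) = Re x + Re y. Proof. by case: x; case: y. Qed.
Lemma cImD x y : Im (x + y) = Im x + Im y. Proof. by case: x; case: y. Qed.
Lemma cReN x : Re (- x) = - Re x. Proof. by case: x. Qed.
Lemma cImN x : Im (- x) = - Im x. Proof. by case: x. Qed.
Lemma cReM x y : Re (x * y) = Re x * Re y - Im x * Im y.
Proof. by case: x; case: y. Qed.
Lemma cImM x y : Im (x * y) = Re x * Im y + Im x * Re y.
Proof. by case: x; case: y. Qed.
Lemma cReJ x : Re (conjc x) = Re x. Proof. by case: x. Qed.
Lemma cImJ x : Im (conjc x) = - Im x. Proof. by case: x. Qed.

Lemma cReZ (c : R) x : Re (c%:C * x) = c * Re x.
Proof. by case: x => a b /=; rewrite mul0r subr0. Qed.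

Lemma complex_eq x y : Re x = Re y -> Im x = Im y -> x = y.
Proof. by case: x; case: y => a b c d /= -> ->. Qed.

Definition normsq x : R := Re x * Re x + Im x * Im x.

Lemma normsq_neq0 x : x != 0 -> normsq x != 0.
Proof.
apply: contra; rewrite /normsq -!expr2 paddr_eq0 ?sqr_ge0 // !sqrf_eq0.
by case/andP=> /eqP r0 /eqP i0; apply/eqP; apply: complex_eq.
Qed.

Lemma mulC_conj x : x * conjc x = (normsq x)%:C.
Proof. by case: x => a b; apply: complex_eq; rewrite /normsq /=; ring. Qed.

Lemma inv_normsq x : x^-1 = (conjc x) * ((normsq x)^-1)%:C.
Proof.
case: x => a b; apply: complex_eq; rewrite /normsq /= mulr0 ?subr0 ?add0r ?expr2 //.
by rewrite mulNr.
Qed.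

Definition expC x : R[i] := (expR (Re x) * cos (Im x)) +i* (expR (Re x) * sin (Im x)).

Lemma expCD x y : expC (x + y) = expC x * expC y.
Proof.
apply: complex_eq; rewrite ?cReM ?cImM ?cReD ?cImD /= cReD cImD expRD ?cosD ?sinD; ring.
Qed.

Lemma expC0 : expC 0 = 1.
Proof. by apply: complex_eq => /=; rewrite expR0 ?cos0 ?sin0 ?mulr1 ?mulr0. Qed.

Lemma expC_neq0 x : expC x != 0.
Proof.
apply/eqP => e; have := expCD x (- x); rewrite subrr expC0 e mul0r.
by move/eqP; rewrite oner_eq0.
Qed.

Lemma expC_nat x k : expC (k%:R * x) = expC x ^+ k.
Proof.
elim: k => [|k IH]; first by rewrite mul0r expC0 expr0.
by rewrite -addn1 natrD mulrDl mul1r expCD IH exprD expr1.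
Qed.

Lemma expC_cis (t : R) : expC (0 +i* t) = cis t.
Proof. by rewrite /expC /= expR0 !mul1r. Qed.

Lemma normsq_expC x : normsq (expC x) = expR (2 * Re x).
Proof.
rewrite /normsq /= mulr_natl mulr2n expRD.
have := cos2Dsin2 (Im x); rewrite !expr2 => e.
by rewrite -[RHS]mulr1 -e; ring.
Qed.

End ComplexRules.

Section ComplexCalculus.
Local Open Scope complex_scope.
Variables (R : realType) (V : normedModType R).
Implicit Types (f g : V -> R[i]) (U : set V).
Local Notation Re := complex.Re.
Local Notation Im := complex.Im.

Definition smoothC U f :=
  smooth_on U (fun x => Re (f x)) /\ smooth_on U (fun x => Im (f x)).

Lemma smoothC_cst U c : smoothC U (fun _ => c).
Proof. by split=> k; exact: Ck_cst. Qed.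

Lemma smoothC_D U f g : open U ->
  smoothC U f -> smoothC U g -> smoothC U (fun x => f x + g x).
Proof.
move=> oU [f1 f2] [g1 g2]; split=> k.
  by under eq_fun do rewrite cReD; exact: CkD.
by under eq_fun do rewrite cImD; exact: CkD.
Qed.

Lemma smooth_opp U (f : V -> R) : open U ->
  smooth_on U f -> smooth_on U (fun x => - f x).
Proof.
move=> oU Cf k; under eq_fun do rewrite -mulN1r.
by apply: CkM => //; exact: Ck_cst.
Qed.

Lemma smoothC_M U f g : open U ->
  smoothC U f -> smoothC U g -> smoothC U (fun x => f x * g x).
Proof.
move=> oU [f1 f2] [g1 g2]; split=> k.
  under eq_fun do rewrite cReM; apply: CkD => //; first exact: CkM.
  by apply: smooth_opp => // k'; exact: CkM.
by under eq_fun do rewrite cImM; apply: CkD => //; exact: CkM.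
Qed.

Lemma smoothC_conj U f : open U -> smoothC U f -> smoothC U (fun x => (conjc (f x))).
Proof.
move=> oU [f1 f2]; split=> k; first by under eq_fun do rewrite cReJ.
by under eq_fun do rewrite cImJ; exact: smooth_opp.
Qed.

Lemma smoothC_real U (f : V -> R) : smooth_on U f -> smoothC U (fun x => (f x)%:C).
Proof. by move=> Cf; split=> // k; exact: Ck_cst. Qed.

Lemma smooth_normsq U f : open U -> smoothC U f ->
  smooth_on U (fun x => normsq (f x)).
Proof.
by move=> oU [f1 f2] k; apply: CkD => //; exact: CkM.
Qed.

Lemma smoothC_V U f : open U -> (forall x, U x -> f x != 0) ->
  smoothC U f -> smoothC U (fun x => (f x)^-1).
Proof.
move=> oU f0 Cf; under eq_fun do rewrite inv_normsq.
apply: smoothC_M => //; first exact: smoothC_conj.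
apply: smoothC_real => k.
apply: (Ck_comp oU _ (@smooth_inv R k)) => [x Ux /=|].
  by apply: normsq_neq0; exact: f0.
exact: smooth_normsq.
Qed.

Lemma smoothC_sum U n (F : 'I_n -> V -> R[i]) : open U ->
  (forall i, smoothC U (F i)) -> smoothC U (fun x => \sum_i F i x).
Proof.
move=> oU; elim: n F => [|n IH] F HF.
  by under eq_fun do rewrite big_ord0; exact: smoothC_cst.
by under eq_fun do rewrite big_ord_recl; apply: smoothC_D => //; exact: IH.
Qed.

Lemma smoothC_X U f m : open U -> smoothC U f -> smoothC U (fun x => f x ^+ m).
Proof.
move=> oU Cf; elim: m => [|m IH]; first exact: smoothC_cst.
by under eq_fun do rewrite exprS; exact: smoothC_M.
Qed.

Lemma smoothC_exp U f : open U -> smoothC U f -> smoothC U (fun x => expC (f x)).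
Proof.
move=> oU [f1 f2]; have [Cc Cs] := smooth_cos_sin R.
by split=> k /=; apply: CkM => //; apply: (Ck_comp oU (D := [set: R])) => //;
  exact: smooth_expR.
Qed.

Lemma smoothC_sub U U' f : (U' `<=` U)%classic -> smoothC U f -> smoothC U' f.
Proof. by move=> UU [f1 f2]; split=> k; exact: Ck_sub UU _. Qed.

Definition is_deriveC (u v : V) f (d : R[i]) :=
  is_derive u v (fun x => Re (f x)) (Re d) /\
  is_derive u v (fun x => Im (f x)) (Im d).

Lemma is_deriveC_unique u v f d d' :
  is_deriveC u v f d -> is_deriveC u v f d' -> d = d'.
Proof.
move=> [[_ H1] [_ H2]] [[_ H3] [_ H4]].
by apply: complex_eq; [rewrite -H1 H3|rewrite -H2 H4].
Qed.

Lemma is_deriveC_near u v f g d : (\forall x \near u, f x = g x) ->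
  is_deriveC u v f d -> is_deriveC u v g d.
Proof.
move=> fg [H1 H2]; split.
  by apply: near_eq_is_derive H1; apply: filterS fg => x ->.
by apply: near_eq_is_derive H2; apply: filterS fg => x ->.
Qed.

Lemma is_deriveC_cst u v c : is_deriveC u v (fun _ => c) 0.
Proof. by split; exact: is_derive_cst. Qed.

Lemma is_deriveC_D u v f g df dg : is_deriveC u v f df -> is_deriveC u v g dg ->
  is_deriveC u v (fun x => f x + g x) (df + dg).
Proof.
move=> [f1 f2] [g1 g2]; rewrite /is_deriveC cReD cImD; split.
  by under eq_fun do rewrite cReD; exact: is_deriveD.
by under eq_fun do rewrite cImD; exact: is_deriveD.
Qed.

Lemma is_deriveC_N u v f df : is_deriveC u v f df ->
  is_deriveC u v (fun x => - f x) (- df).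
Proof.
move=> [f1 f2]; rewrite /is_deriveC cReN cImN; split.
  by under eq_fun do rewrite cReN; exact: is_deriveN.
by under eq_fun do rewrite cImN; exact: is_deriveN.
Qed.

Lemma is_derive_mul u v (f g : V -> R) (df dg : R) :
  is_derive u v f df -> is_derive u v g dg ->
  is_derive u v (fun x => f x * g x) (df * g u + f u * dg).
Proof.
move=> Hf Hg; have := is_deriveM Hf Hg.
by rewrite addrC [_ *: df]mulrC.
Qed.

Lemma is_deriveC_M u v f g df dg : is_deriveC u v f df -> is_deriveC u v g dg ->
  is_deriveC u v (fun x => f x * g x) (df * g u + f u * dg).
Proof.
move=> [f1 f2] [g1 g2]; rewrite /is_deriveC !cReD !cImD !cReM !cImM; split.
  under eq_fun do rewrite cReM.
  have := is_deriveB (is_derive_mul f1 g1) (is_derive_mul f2 g2).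
  by congr is_derive; ring.
under eq_fun do rewrite cImM.
have := is_deriveD (is_derive_mul f1 g2) (is_derive_mul f2 g1).
by congr is_derive; ring.
Qed.

Lemma is_deriveC_sum u v n (F : 'I_n -> V -> R[i]) dF :
  (forall i, is_deriveC u v (F i) (dF i)) ->
  is_deriveC u v (fun x => \sum_i F i x) (\sum_i dF i).
Proof.
elim: n F dF => [|n IH] F dF HF.
  by under eq_fun do rewrite big_ord0; rewrite big_ord0; exact: is_deriveC_cst.
under eq_fun do rewrite big_ord_recl; rewrite big_ord_recl.
by apply: is_deriveC_D => //; exact: IH.
Qed.

Lemma is_deriveC_conj u v f df : is_deriveC u v f df ->
  is_deriveC u v (fun x => (conjc (f x))) (conjc df).
Proof.
move=> [f1 f2]; rewrite /is_deriveC cReJ cImJ; split.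
  by under eq_fun do rewrite cReJ.
by under eq_fun do rewrite cImJ; exact: is_deriveN.
Qed.

Lemma is_derive_inv u v (f : V -> R) (df : R) : f u != 0 ->
  is_derive u v f df -> is_derive u v (fun x => (f x)^-1) (- df / (f u) ^+ 2).
Proof.
move=> f0 [H1 H2]; split; first exact: derivableV.
by rewrite deriveV // H2 [LHS]mulNr mulrC mulNr.
Qed.

Lemma is_deriveC_V u v f df : f u != 0 -> is_deriveC u v f df ->
  is_deriveC u v (fun x => (f x)^-1) (- df / (f u) ^+ 2).
Proof.
move=> f0 Hf; under eq_fun do rewrite inv_normsq.
have N0 := normsq_neq0 f0.
have Hn : is_derive u v (fun x => normsq (f x))
   (2 * (Re (f u) * Re df + Im (f u) * Im df)).
  have [f1 f2] := Hf.
  have := is_deriveD (is_derive_mul f1 f1) (is_derive_mul f2 f2).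
  by congr is_derive; ring.
have Hi : is_deriveC u v (fun x => ((normsq (f x))^-1)%:C)
    (- (2 * (Re (f u) * Re df + Im (f u) * Im df)) / normsq (f u) ^+ 2)%:C.
  by split; [exact: is_derive_inv|exact: is_derive_cst].
have := is_deriveC_M (is_deriveC_conj Hf) Hi.
congr is_deriveC; rewrite -[in RHS]exprVn inv_normsq.
move: N0; rewrite /normsq; case: (f u) => a b; case: df {Hf Hn Hi} => c d /= N0.
by apply: complex_eq; rewrite ?expr2 ?cReM ?cImM ?cReD ?cImD ?cReM ?cImM ?cReN ?cImN /=; field.
Qed.

Lemma is_derive_chain u v (phi : R -> R) (f : V -> R) (df dphi : R) :
  is_derive u v f df -> differentiable f u -> is_derive (f u) 1 phi dphi ->
  is_derive u v (fun x => phi (f x)) (dphi * df).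
Proof.
move=> [H1 H2] dfu [H3 H4].
have dp : differentiable phi (f u) by exact/derivable1_diffP.
have dd : differentiable (phi \o f) u by exact: differentiable_comp.
split; first exact: diff_derivable.
have E1 : 'd f u v = df by rewrite -deriveE.
have E2 : 'd phi (f u) 1 = dphi by rewrite -deriveE.
rewrite -[LHS]/('D_v (phi \o f) u) deriveE // diff_comp //= E1.
by rewrite -{1}[df]mulr1 linearZ E2 mulrC.
Qed.

Lemma is_deriveC_exp u v f df :
  differentiable (fun x => Re (f x)) u -> differentiable (fun x => Im (f x)) u ->
  is_deriveC u v f df -> is_deriveC u v (fun x => expC (f x)) (df * expC (f u)).
Proof.
move=> d1 d2 [f1 f2].
have He := is_derive_chain f1 d1 (is_derive_expR _).
have Hc := is_derive_chain f2 d2 (is_derive_cos _).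
have Hs := is_derive_chain f2 d2 (is_derive_sin _).
rewrite /is_deriveC !cReM !cImM /=; split.
  have := is_derive_mul He Hc; by congr is_derive; ring.
have := is_derive_mul He Hs; by congr is_derive; ring.
Qed.

End ComplexCalculus.

(** * Homogeneous coordinates and the Fubini-Study form *)

Section ProjectivePoints.
Local Open Scope complex_scope.
Variables (R : realType) (n : nat).
Implicit Types (z w : 'rV[R[i]]_n.+1) (x : 'rV[R]_(n + n)).
Local Notation Re := complex.Re.
Local Notation Im := complex.Im.

Lemma proj_pt_refl z : proj_pt z z.
Proof. by exists 1; rewrite /= ?oner_neq0 ?scale1r. Qed.

Lemma proj_pt_scale (l : R[i]) z : l != 0 -> proj_pt (l *: z) = proj_pt z.
Proof.
move=> l0; apply/seteqP; split=> w [k /= k0 <-].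
  by exists (k * l); rewrite /= ?mulf_neq0 // scalerA.
by exists (k / l); rewrite /= ?mulf_neq0 ?invr_eq0 // scalerA divfK.
Qed.

Lemma proj_ptP z w : proj_pt z w -> exists2 l : R[i], l != 0 & w = l *: z.
Proof. by move=> [l l0 <-]; exists l. Qed.

Lemma proj_pt_eqP z w : proj_pt z = proj_pt w -> exists2 l, l != 0 & w = l *: z.
Proof. by move=> e; apply: proj_ptP; rewrite e; exact: proj_pt_refl. Qed.

Lemma homog_at s (k : 'I_n.+1) x : homog s k x 0 k = s.
Proof. by rewrite mxE unlift_none. Qed.

Lemma homog_lift s (k : 'I_n.+1) x i :
  homog s k x 0 (lift k i) = x 0 (lshift n i) +i* x 0 (rshift n i).
Proof. by rewrite mxE liftK !mxE. Qed.

Lemma homog_lin (c : R) s s' (k : 'I_n.+1) x y :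
  homog (c%:C * s + s') k (c *: x + y) = c%:C *: homog s k x + homog s' k y.
Proof.
apply/rowP => j; rewrite !mxE; case: unliftP => [i _|//].
by rewrite !mxE; apply: complex_eq; rewrite ?cReD ?cImD ?cReM ?cImM /= mul0r ?subr0 ?addr0.
Qed.

Lemma homog0_lin (c : R) (k : 'I_n.+1) x y :
  homog 0 k (c *: x + y) = c%:C *: homog 0 k x + homog 0 k y.
Proof. by rewrite -homog_lin mulr0 addr0. Qed.

Lemma homog0_J (k : 'I_n.+1) x : homog 0 k (std_J x) = 'i%C *: homog 0 k x.
Proof.
apply/rowP => j; rewrite !mxE; case: unliftP => [i _|_]; last by rewrite mulr0.
by rewrite /std_J row_mxKl row_mxKr !mxE; apply: complex_eq;
  rewrite ?cReM ?cImM /= !mul0r !mul1r ?sub0r ?add0r.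
Qed.

Lemma homog_inj s (k : 'I_n.+1) x y : homog s k x = homog s k y -> x = y.
Proof.
move=> e; apply/rowP => j; rewrite -[j]splitK.
have H i : homog s k x 0 (lift k i) = homog s k y 0 (lift k i) by rewrite e.
by case: (fintype.split j) => i /=; have := H i; rewrite !homog_lift => -[].
Qed.

Definition unhomog (k : 'I_n.+1) z : 'rV[R]_(n + n) :=
  row_mx (\row_i Re (z 0 (lift k i) / z 0 k)) (\row_i Im (z 0 (lift k i) / z 0 k)).

Lemma unhomogK (k : 'I_n.+1) z : z 0 k != 0 ->
  homog 1 k (unhomog k z) = (z 0 k)^-1 *: z.
Proof.
move=> z0; apply/rowP => j; rewrite !mxE; case: unliftP => [i ->|->].
  by rewrite !row_mxKl !row_mxKr !mxE mulrC; case: (_ * _).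
by rewrite mulVf.
Qed.

Lemma proj_pt_unhomog (k : 'I_n.+1) z : z 0 k != 0 ->
  proj_pt (homog 1 k (unhomog k z)) = proj_pt z.
Proof. by move=> z0; rewrite unhomogK // proj_pt_scale // invr_eq0. Qed.

(** Normal form of the homogeneous vectors of a chart point; [lift_deriv]
    differentiates this equation. *)
Lemma homog_proj_eq (k : 'I_n.+1) x z : proj_pt (homog 1 k x) = proj_pt z ->
  z 0 k != 0 /\ z = z 0 k *: homog 1 k x.
Proof.
move=> /proj_pt_eqP [l l0 ->].
by rewrite [(l *: homog 1 k x) 0 k]mxE homog_at mulr1.
Qed.

Lemma homog_neq0 (k : 'I_n.+1) x : homog 1 k x 0 k != 0 :> R[i].
Proof. by rewrite homog_at oner_neq0. Qed.

Lemma homog_vec_neq0 (k : 'I_n.+1) x : homog 1 k x != 0 :> 'rV[R[i]]_n.+1.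
Proof. by apply/rV0Pn; exists k; exact: homog_neq0. Qed.

End ProjectivePoints.

Section HermitianProduct.
Local Open Scope complex_scope.
Variables (R : realType) (n : nat).
Implicit Types (a b z : 'rV[R[i]]_n).
Local Notation Re := complex.Re.

Lemma cdotDl a b z : cdot (a + b) z = cdot a z + cdot b z.
Proof. by rewrite /cdot -big_split; apply: eq_bigr => j _; rewrite mxE mulrDl. Qed.

Lemma cdotZl l a z : cdot (l *: a) z = l * cdot a z.
Proof. by rewrite /cdot mulr_sumr; apply: eq_bigr => j _; rewrite mxE mulrA. Qed.

Lemma cdotC a b : cdot a b = (conjc (cdot b a)).
Proof.
by rewrite /cdot rmorph_sum; apply: eq_bigr => j _ /=; rewrite rmorphM /= conjcK mulrC.
Qed.

Lemma cdotDr a b z : cdot z (a + b) = cdot z a + cdot z b.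
Proof. by rewrite cdotC cdotDl rmorphD /= -!cdotC. Qed.

Lemma cdotZr l a z : cdot z (l *: a) = (conjc l) * cdot z a.
Proof. by rewrite cdotC cdotZl rmorphM /= -cdotC. Qed.

Lemma cdot_ge0 z : 0 <= cdot z z.
Proof. by apply: sumr_ge0 => j _; exact: mulcJ_ge0. Qed.

Lemma cdot_eq0 z : (cdot z z == 0) = (z == 0).
Proof.
apply/eqP/eqP => [|->]; last by rewrite /cdot big1 // => j _; rewrite mxE mul0r.
move=> /eqP; rewrite psumr_eq0; last by move=> j _; exact: mulcJ_ge0.
move=> /allP H; apply/rowP => j; rewrite mxE; apply/eqP.
have := H j (mem_index_enum _) => /=.
by rewrite mulf_eq0 conjc_eq0 orbb.
Qed.

Lemma cdot_gt0 z : z != 0 -> 0 < cdot z z.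
Proof. by move=> z0; rewrite lt_def cdot_eq0 z0 cdot_ge0. Qed.

(** The component of [a] orthogonal to [z], scaled by [cdot z z], has a positive
    square norm, which is the expression below times [cdot z z]. *)
Lemma cauchy_schwarz a z : z != 0 -> (forall l : R[i], a != l *: z) ->
  0 < cdot a a * cdot z z - cdot a z * cdot z a.
Proof.
move=> z0 az; have S0 := cdot_gt0 z0.
have y0 : cdot z z *: a - cdot a z *: z != 0.
  apply/eqP => /subr0_eq e; have := az ((cdot z z)^-1 * cdot a z).
  by rewrite -scalerA -e scalerA mulVf ?scale1r ?eqxx // gt_eqF.
have := cdot_gt0 y0.
have -> : cdot (cdot z z *: a - cdot a z *: z) (cdot z z *: a - cdot a z *: z) =
   cdot z z * (cdot a a * cdot z z - cdot a z * cdot z a).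
  rewrite -scaleNr cdotDl !cdotDr !cdotZl !cdotZr !rmorphN /= -!cdotC; ring.
by rewrite pmulr_rgt0.
Qed.

End HermitianProduct.

Section FubiniStudy.
Local Open Scope complex_scope.
Variables (R : realType) (n : nat).
Implicit Types (z a b : 'rV[R[i]]_n.+1).
Local Notation Re := complex.Re.

Definition fs_herm z a b : R[i] :=
  (cdot a b * cdot z z - cdot a z * cdot z b) / cdot z z ^+ 2.

Lemma fs_hermE (c : R) z a b : fubini_study c z a b = 4 / c * Re (fs_herm z a b).
Proof. by []. Qed.

(** Another representative of a point of projective space scales the vectors
    that represent tangent vectors and moves them along the line of [z]. By this
    invariance the Fubini-Study form can be computed on any homogeneous lift. *)
Lemma fs_herm_inv z a b (l mu nu : R[i]) : l != 0 -> z != 0 ->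
  fs_herm (l *: z) (l *: a + mu *: z) (l *: b + nu *: z) = fs_herm z a b.
Proof.
move=> l0 z0; have S0 : cdot z z != 0 by rewrite cdot_eq0.
have lb0 : (conjc l) != 0 by rewrite conjc_eq0.
rewrite /fs_herm !(cdotDl, cdotDr, cdotZl, cdotZr).
by field; rewrite S0 l0 lb0.
Qed.

Lemma fs_herm_linl z a a' b (l : R[i]) :
  fs_herm z (l *: a + a') b = l * fs_herm z a b + fs_herm z a' b.
Proof. by rewrite /fs_herm !cdotDl !cdotZl; ring. Qed.

Lemma fs_hermZl z a b (l : R[i]) : fs_herm z (l *: a) b = l * fs_herm z a b.
Proof. by rewrite /fs_herm !cdotZl; ring. Qed.

Lemma fs_hermC z a b : fs_herm z a b = (conjc (fs_herm z b a)).
Proof.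
rewrite /fs_herm rmorphM rmorphB !rmorphM /= conjc_inv rmorphXn /= -!cdotC.
by rewrite [cdot z b * _]mulrC.
Qed.

Lemma fs_herm_gt0 z a : z != 0 -> (forall l : R[i], a != l *: z) ->
  0 < fs_herm z a a.
Proof.
move=> z0 az; apply: divr_gt0; first exact: cauchy_schwarz.
by rewrite exprn_gt0 // cdot_gt0.
Qed.

End FubiniStudy.

(** * Maps to projective space given by homogeneous lifts *)

Section HomogCalculus.
Local Open Scope complex_scope.
Variables (R : realType) (n : nat).
Local Notation Re := complex.Re.
Local Notation Im := complex.Im.

Lemma coord_smooth d (U : set 'rV[R]_d) i : smooth_on U (fun x : 'rV[R]_d => x 0 i).
Proof.
have lin : scalar (fun x : 'rV[R]_d => x 0 i) by move=> c x y; rewrite !mxE.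
pose fL := GRing.isLinear.Build _ _ _ _ _ lin.
pose f : {linear 'rV[R]_d -> R} := HB.pack (fun x : 'rV[R]_d => x 0 i) fL.
by move=> k; apply: (@Ck_lin _ _ _ k U f) => x; exact: coord_continuous.
Qed.

Lemma coord_is_derive d (V : normedModType R) (g : V -> 'rV[R]_d) u v i :
  differentiable g u -> is_derive u v (fun x => g x 0 i) ('d g u v 0 i).
Proof.
move=> dg; have Dg := diff_derivable (v := v) dg.
have H := (derivable_mxP g u v).1 Dg 0 i.
by split=> //; rewrite -deriveE // derive_mx // mxE.
Qed.

Lemma diff_idfun d (u v : 'rV[R]_d) : 'd (fun x : 'rV[R]_d => x) u v = v.
Proof. by rewrite diff_val. Qed.

Lemma homog_is_deriveC d (g : 'rV[R]_d -> 'rV[R]_(n + n)) k u v j :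
  differentiable g u ->
  is_deriveC u v (fun x => homog 1 k (g x) 0 j) (homog 0 k ('d g u v) 0 j).
Proof.
move=> dg; case: (unliftP k j) => [i ->|->].
  under eq_fun do rewrite homog_lift; rewrite homog_lift.
  by split => /=; exact: coord_is_derive.
under eq_fun do rewrite homog_at; rewrite homog_at; exact: is_deriveC_cst.
Qed.

Lemma homog_is_deriveC_id k (u v : 'rV[R]_(n + n)) j :
  is_deriveC u v (fun x => homog 1 k x 0 j) (homog 0 k v 0 j).
Proof.
by rewrite -{2}[v](diff_idfun u); apply: homog_is_deriveC.
Qed.

Lemma homog_smoothC (U : set 'rV[R]_(n + n)) k j :
  smoothC U (fun x => homog 1 k x 0 j).
Proof.
case: (unliftP k j) => [i ->|->].
  by under eq_fun do rewrite homog_lift; split=> /=; exact: coord_smooth.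
by under eq_fun do rewrite homog_at; exact: smoothC_cst.
Qed.

Lemma smooth_row_mx (V : normedModType R) (U : set V) d e
    (f : V -> 'rV[R]_d) (g : V -> 'rV[R]_e) : open U ->
  (forall i, smooth_on U (fun x => f x 0 i)) ->
  (forall i, smooth_on U (fun x => g x 0 i)) ->
  smooth_on U (fun x => row_mx (f x) (g x)).
Proof.
move=> oU Cf Cg k; apply: Ck_rV => // j; rewrite -[j]splitK.
case: (fintype.split j) => i /=.
  by under eq_fun do rewrite row_mxEl; exact: Cf.
by under eq_fun do rewrite row_mxEr; exact: Cg.
Qed.

Lemma unhomog_smooth (V : normedModType R) (U : set V) (Z : V -> 'rV[R[i]]_n.+1) k :
  open U -> (forall j, smoothC U (fun x => Z x 0 j)) ->
  (forall x, U x -> Z x 0 k != 0) ->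
  smooth_on U (fun x => unhomog k (Z x)).
Proof.
move=> oU CZ Z0.
have C i : smoothC U (fun x => Z x 0 (lift k i) / Z x 0 k).
  by apply: smoothC_M => //; exact: smoothC_V.
by apply: smooth_row_mx => // i; under eq_fun do rewrite mxE; have [] := C i.
Qed.

End HomogCalculus.

Section LiftCriterion.
Local Open Scope complex_scope.
Variables (R : realType) (d n : nat) (M : patches R d).
Local Notation P := (proj_mfd R n).
Implicit Types (a : chart_ix M) (Z : 'rV[R]_d -> 'rV[R[i]]_n.+1).
Variable f : carrier M -> carrier P.
Local Notation Re := complex.Re.

Lemma openC_neq0 (V : normedModType R) (U : set V) (z : V -> R[i]) : open U ->
  smoothC U z -> open (U `&` [set x | z x != 0])%classic.
Proof.
move=> oU [Cr Ci].
have Cn := smooth_normsq oU (conj Cr Ci) : smooth_on _ _.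
have -> : (U `&` [set x | z x != 0] = U `&` (fun x => normsq (z x)) @^-1` [set x | x != 0])%classic.
  apply/seteqP; split=> x [Ux H0]; split=> //=.
    exact: normsq_neq0.
  by apply: contra H0 => /eqP ->; rewrite /normsq /= !mul0r addr0.
rewrite openE => x [Ux Nx]; apply: filterI; first exact: open_nbhs_nbhs.
by apply: (Cn 0%N x Ux); apply: open_nbhs_nbhs; split=> //; exact: open_neq.
Qed.

(** Dividing a smooth homogeneous lift by its k-th coordinate expresses the map
    in the k-th chart. Every smooth map to projective space below is obtained
    from such a lift. *)
Lemma lift_locrep a u W Z k : open W -> W u -> (W `<=` chart_dom a)%classic ->
  (forall j, smoothC W (fun x => Z x 0 j)) ->
  (forall w, W w -> f (chart_par a w) = proj_pt (Z w)) ->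
  Z u 0 k != 0 ->
  @locrep R _ _ M P f a k u (fun x => unhomog k (Z x)).
Proof.
move=> oW Wu Wa CZ fZ Zu.
have oW' := openC_neq0 oW (CZ k).
exists (W `&` [set x | Z x 0 k != 0])%classic; split=> //.
  apply: unhomog_smooth => // [j|x []//].
  by apply: smoothC_sub (CZ j) => x [].
move=> w [Ww Zw]; split=> //=; first exact: Wa.
by rewrite proj_pt_unhomog // fZ.
Qed.

(** Quotient rule for [homog 1 k (g w) = Z w / (Z w)_k]: up to the factor
    [1 / Z_k], the differential of the map is that of the lift [Z] modulo the
    line of [Z]. The expression [g] is arbitrary, as the pullback conditions
    quantify over all local expressions of a map. *)
Lemma lift_deriv a u k g Z (dZ : 'rV[R[i]]_n.+1) (v : 'rV[R]_d) :
  @locrep R _ _ M P f a k u g ->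
  (\forall w \near u, f (chart_par a w) = proj_pt (Z w)) ->
  (forall j, is_deriveC u v (fun x => Z x 0 j) (dZ 0 j)) ->
  [/\ Z u 0 k != 0, homog 1 k (g u) = (Z u 0 k)^-1 *: Z u &
    homog 0 k ('d g u v) =
      (Z u 0 k)^-1 *: dZ + (- dZ 0 k / Z u 0 k ^+ 2) *: Z u].
Proof.
move=> [W [oW Wu Cg Hg]] fZ HZ.
have nE : \forall w \near u, Z w 0 k != 0 /\ Z w = Z w 0 k *: homog 1 k (g w).
  have nW : \forall w \near u, W w by exact: open_nbhs_nbhs.
  apply: filterS2 nW fZ => w Ww fw; apply: homog_proj_eq.
  by have [_ _] := Hg w Ww; rewrite fw.
have [Z0 EZ] := nbhs_singleton nE.
have EH : homog 1 k (g u) = (Z u 0 k)^-1 *: Z u.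
  by rewrite {2}EZ scalerA mulVf ?scale1r.
split=> //; apply/rowP => j.
have dg : differentiable g u by have [H _] := Cg 1%N; exact: H.
apply: (is_deriveC_unique (homog_is_deriveC k v j dg)).
have HV := is_deriveC_M (HZ j) (is_deriveC_V Z0 (HZ k)).
have -> : ((Z u 0 k)^-1 *: dZ + (- dZ 0 k / Z u 0 k ^+ 2) *: Z u) 0 j =
   dZ 0 j / Z u 0 k + Z u 0 j * (- dZ 0 k / Z u 0 k ^+ 2).
  by rewrite !mxE mulrC [X in _ + X]mulrC.
apply: is_deriveC_near HV; apply: filterS nE => w [w0 ->].
by rewrite !mxE unlift_none mulr1 mulrAC mulfV // mul1r.
Qed.

(** By [fs_herm_inv], the form does not see the difference between the
    differential of the map and that of a lift. *)
Lemma lift_pulls_back (c : R) (h : form2 M) :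
  (forall a u, chart_dom a u ->
    exists Z (dZ : 'rV[R]_d -> 'rV[R[i]]_n.+1),
    [/\ \forall w \near u, f (chart_par a w) = proj_pt (Z w),
        forall v j, is_deriveC u v (fun x => Z x 0 j) (dZ v 0 j) &
        forall v w, fubini_study c (Z u) (dZ v) (dZ w) = h a u v w]) ->
  @pulls_back R _ _ M P f h (@herm_g _ _ (proj_space n c)).
Proof.
move=> H a k u g lr v w.
have au : chart_dom a u by have [W [_ Wu _ /(_ u Wu) []]] := lr.
have [Z [dZ [fZ HZ <-]]] := H a u au.
have [Z0 EH Ev] := lift_deriv lr fZ (HZ v).
have [_ _ Ew] := lift_deriv lr fZ (HZ w).
rewrite /= EH Ev Ew !fs_hermE fs_herm_inv ?invr_eq0 //.
by apply/rV0Pn; exists k.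
Qed.

Lemma lift_intertwines (J : endo M) (c : R) :
  (forall a u, chart_dom a u ->
    exists Z (dZ : 'rV[R]_d -> 'rV[R[i]]_n.+1),
    [/\ \forall w \near u, f (chart_par a w) = proj_pt (Z w),
        forall v j, is_deriveC u v (fun x => Z x 0 j) (dZ v 0 j) &
        forall v, dZ (J a u v) = 'i%C *: dZ v]) ->
  @intertwines R _ _ M P f J (@herm_J _ _ (proj_space n c)).
Proof.
move=> H a k u g lr v.
have au : chart_dom a u by have [W [_ Wu _ /(_ u Wu) []]] := lr.
have [Z [dZ [fZ HZ HJ]]] := H a u au.
have [Z0 EH Ev] := lift_deriv lr fZ (HZ v).
have [_ _ EJ] := lift_deriv lr fZ (HZ (J a u v)).
apply: (@homog_inj R n 0 k); rewrite homog0_J Ev EJ HJ.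
apply/rowP => j; rewrite !mxE; ring.
Qed.

End LiftCriterion.

(** * Projective space as a Kaehler manifold *)

Section ClopenVectors.
Local Open Scope complex_scope.
Variables (R : realType) (d : nat).

(** Restriction to the segment from [x] to [y] reduces this to the connectedness
    of the real line. *)
Lemma clopen_rV (B : set 'rV[R]_d) x y : open B -> open (~` B)%classic ->
  B x -> B y.
Proof.
move=> oB oNB Bx.
pose phi (t : R) := x + t *: (y - x).
have cphi : continuous phi.
  by move=> t; apply: cvgD; [exact: cvg_cst|exact: cvgZr_tmp (@cvg_id _ _)].
have cT : connected [set: R].
  by apply/connected_intervalP => a b _ _ c _.
suff e : (phi @^-1` B = [set: R])%classic.
  have : (phi @^-1` B)%classic 1 by rewrite e.
  by rewrite /phi /= scale1r addrC subrK.
apply: cT.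
- by exists 0; rewrite /phi /= scale0r addr0.
- by exists (phi @^-1` B)%classic; rewrite ?setTI //; move/continuousP: cphi; apply.
- exists (phi @^-1` B)%classic; rewrite ?setTI //.
  apply: closed_comp => [t _|]; first exact: cphi.
  by rewrite -(setCK B); exact: open_closedC.
Qed.

End ClopenVectors.

Section ProjectiveKahler.
Local Open Scope complex_scope.
Variables (R : realType) (n : nat).
Local Notation P := (proj_mfd R n).
Local Notation Re := complex.Re.
Local Notation Im := complex.Im.

Lemma proj_points p : @mfd_points R _ P p ->
  exists2 z : 'rV[R[i]]_n.+1, z != 0 & p = proj_pt z.
Proof.
move=> [k [x [_ <-]]]; exists (homog 1 k x) => //.
exact: homog_vec_neq0.
Qed.

Lemma proj_points_pt (z : 'rV[R[i]]_n.+1) : z != 0 ->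
  @mfd_points R _ P (proj_pt z).
Proof.
move=> /rV0Pn [k zk]; exists k, (unhomog k z); split=> //=.
exact: proj_pt_unhomog.
Qed.

Lemma proj_chart_inj k x y :
  proj_pt (homog 1 k x) = proj_pt (homog 1 k y) :> set 'rV[R[i]]_n.+1 -> x = y.
Proof.
move=> /homog_proj_eq [_]; rewrite homog_at scale1r => e.
exact/esym/(homog_inj e).
Qed.

Lemma cdot_smoothC (V : normedModType R) (U : set V) m (a b : V -> 'rV[R[i]]_m) :
  open U -> (forall j, smoothC U (fun x => a x 0 j)) ->
  (forall j, smoothC U (fun x => b x 0 j)) ->
  smoothC U (fun x => cdot (a x) (b x)).
Proof.
move=> oU Ca Cb; apply: smoothC_sum => // j; apply: smoothC_M => //.
exact: (smoothC_conj oU (Cb j)).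
Qed.

Lemma cdot_is_deriveC (V : normedModType R) (u v : V) m (a b : V -> 'rV[R[i]]_m)
    (da db : 'rV[R[i]]_m) :
  (forall j, is_deriveC u v (fun x => a x 0 j) (da 0 j)) ->
  (forall j, is_deriveC u v (fun x => b x 0 j) (db 0 j)) ->
  is_deriveC u v (fun x => cdot (a x) (b x)) (cdot da (b u) + cdot (a u) db).
Proof.
move=> Ha Hb; rewrite /cdot -big_split /=; apply: is_deriveC_sum => j.
exact: is_deriveC_M (Ha j) (is_deriveC_conj (Hb j)).
Qed.

Lemma fs_herm_smoothC (V : normedModType R) (U : set V) (z : V -> 'rV[R[i]]_n.+1) a b :
  open U -> (forall x, U x -> z x != 0) ->
  (forall j, smoothC U (fun x => z x 0 j)) -> smoothC U (fun x => fs_herm (z x) a b).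
Proof.
move=> oU z0 Cz.
have Cc (w : 'rV[R[i]]_n.+1) j : smoothC U (fun=> w 0 j) by exact: smoothC_cst.
have CS := cdot_smoothC oU Cz Cz.
apply: smoothC_M => //; last first.
  apply: smoothC_V => // [x Ux|]; last exact: smoothC_X.
  by rewrite expf_eq0 /= cdot_eq0 z0.
apply: smoothC_D => //.
  by apply: smoothC_M => //; exact: smoothC_cst.
under eq_fun do rewrite -mulN1r.
apply: smoothC_M => //; first exact: smoothC_cst.
by apply: smoothC_M => //; exact: cdot_smoothC.
Qed.

(** The derivative of [fs_herm z a b] when [z] moves with velocity [e] and the
    vectors [a] and [b], constant in a chart, stay fixed. *)
Definition dfs_herm (z e a b : 'rV[R[i]]_n.+1) : R[i] :=
  ((cdot a b * (cdot e z + cdot z e)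
    - (cdot a e * cdot z b + cdot a z * cdot e b)) * cdot z z
   - (cdot a b * cdot z z - cdot a z * cdot z b) *+ 2 * (cdot e z + cdot z e))
  / cdot z z ^+ 3.

Lemma fs_herm_is_deriveC (V : normedModType R) (u v : V)
    (z : V -> 'rV[R[i]]_n.+1) (e a b : 'rV[R[i]]_n.+1) : z u != 0 ->
  (forall j, is_deriveC u v (fun x => z x 0 j) (e 0 j)) ->
  is_deriveC u v (fun x => fs_herm (z x) a b) (dfs_herm (z u) e a b).
Proof.
move=> z0 Hz.
have Hc (w : 'rV[R[i]]_n.+1) j : is_deriveC u v (fun=> w 0 j) ((0 : 'rV[R[i]]_n.+1) 0 j).
  by rewrite mxE; exact: is_deriveC_cst.
have HS := cdot_is_deriveC Hz Hz.
have HV := is_deriveC_V _ (is_deriveC_M HS HS).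
have S0 : cdot (z u) (z u) != 0 by rewrite cdot_eq0.
have c0 (m : nat) (w : 'rV[R[i]]_m) : cdot 0 w = 0.
  by rewrite /cdot big1 // => j _; rewrite mxE mul0r.
have c0' (m : nat) (w : 'rV[R[i]]_m) : cdot w 0 = 0.
  by rewrite cdotC c0 conjc0.
have := is_deriveC_M (is_deriveC_D
  (is_deriveC_M (is_deriveC_cst u v (cdot a b)) HS)
  (is_deriveC_N (is_deriveC_M (cdot_is_deriveC (Hc a) Hz) (cdot_is_deriveC Hz (Hc b)))))
  (HV (mulf_neq0 S0 S0)).
congr is_deriveC; rewrite /dfs_herm !c0 !c0'.
by field.
Qed.

(** This is the closedness of the Kaehler form, which is a multiple of the
    imaginary part of [fs_herm]. Conjugation exchanges the last two arguments of
    [dfs_herm], and the cyclic sum is symmetric in its three arguments, hence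
    real. *)
Lemma dfs_herm_cyclic (z e a b : 'rV[R[i]]_n.+1) :
  Re ('i%C * (dfs_herm z e a b + dfs_herm z a b e + dfs_herm z b e a)) = 0.
Proof.
suff cyc : conjc (dfs_herm z e a b + dfs_herm z a b e + dfs_herm z b e a) =
    dfs_herm z e a b + dfs_herm z a b e + dfs_herm z b e a.
  rewrite cReM /= mul0r mul1r sub0r; apply/eqP; rewrite oppr_eq0.
  have : Im (conjc (dfs_herm z e a b + dfs_herm z a b e + dfs_herm z b e a)) =
    Im (dfs_herm z e a b + dfs_herm z a b e + dfs_herm z b e a) by rewrite cyc.
  rewrite cImJ => h; have : Im (dfs_herm z e a b + dfs_herm z a b e + dfs_herm z b e a) *+ 2 = 0.
    by rewrite mulr2n -{1}h addNr.
  by move/eqP; rewrite mulrn_eq0.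
have cj (x y w t : 'rV[R[i]]_n.+1) : conjc (dfs_herm w t x y) = dfs_herm w t y x.
  rewrite /dfs_herm rmorphM /= conjc_inv rmorphXn /= -cdotC; congr (_ / _).
  rewrite !(rmorphM, rmorphB, rmorphD, rmorphMn) /= -!cdotC; ring.
rewrite !rmorphD /= !cj /dfs_herm -!mulrDl; congr (_ / _); ring.
Qed.

(** A point [z] is separated from the others by the continuous function
    [w |-> |<w, z>|^2 / |w|^2], which by Cauchy-Schwarz attains its maximum only
    at [z]. *)
Lemma proj_hausdorff (p q : carrier P) : mfd_points p -> mfd_points q -> p <> q ->
  exists A B : set (carrier P), [/\ mopen A, mopen B, A p, B q &
    A `&` B `&` @mfd_points R _ P = set0]%classic.
Proof.
move=> /proj_points [z z0 ->] /proj_points [y y0 ->] zy.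
pose r (w : 'rV[R[i]]_n.+1) := Re (cdot w z * cdot z w / cdot w w).
have rZ l w : l != 0 -> w != 0 -> r (l *: w) = r w.
  move=> l0 w0; rewrite /r !cdotZl !cdotZr; congr Re; field.
  by rewrite cdot_eq0 w0 l0 conjc_eq0 l0.
have Sz := cdot_gt0 z0; have Sy := cdot_gt0 y0.
have rlt : r y < r z.
  have cs : 0 < cdot z z * cdot y y - cdot z y * cdot y z.
    apply: cauchy_schwarz => // l; apply/eqP => e; apply: zy.
    rewrite e proj_pt_scale //.
    by apply: contraNneq z0 => l0; rewrite e l0 scale0r.
  have : 0 < (cdot z z * cdot y y - cdot z y * cdot y z) / cdot y y.
    by rewrite divr_gt0.
  rewrite mulrBl mulfK ?gt_eqF // ltcE => /andP [_].
  by rewrite cReD cReN subr_gt0 /r [cdot y z * _]mulrC mulfK ?gt_eqF.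
have Cr (k : 'I_n.+1) : continuous (fun x => r (homog 1 k x)).
  move=> x; have := homog_smoothC [set: 'rV[R]_(n + n)] k => Cz.
  have Cc (w : 'rV[R[i]]_n.+1) j : smoothC [set: 'rV[R]_(n + n)] (fun=> w 0 j).
    exact: smoothC_cst.
  have [+ _] : smoothC [set: 'rV[R]_(n + n)] (fun x => cdot (homog 1 k x) z *
     cdot z (homog 1 k x) / cdot (homog 1 k x) (homog 1 k x)).
    apply: smoothC_M openT _ _.
      by apply: smoothC_M openT _ _; apply: cdot_smoothC => //; exact: openT.
    apply: smoothC_V openT _ _ => [w _|]; last by apply: cdot_smoothC => //; exact: openT.
    by rewrite cdot_eq0 homog_vec_neq0.
  by move=> /(_ 0%N) /= /(_ x I).
(* the superlevel and sublevel sets at the middle value separate [z] and [y] *)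
pose s := (r y + r z) / 2.
exists [set p | forall w, p w -> s < r w]%classic, [set p | forall w, p w -> r w < s]%classic.
have h0 k x := @homog_vec_neq0 R n k x.
split.
- move=> k; rewrite setTI.
  rewrite [X in open X](_ : _ = (fun x => r (homog 1 k x)) @^-1` [set t | s < t])%classic.
    by apply: open_comp => [x _|]; [exact: Cr|exact: open_gt].
  apply/seteqP; split=> x /=; first by apply; exact: proj_pt_refl.
  by move=> sx w /proj_ptP [l l0 ->]; rewrite rZ.
- move=> k; rewrite setTI.
  rewrite [X in open X](_ : _ = (fun x => r (homog 1 k x)) @^-1` [set t | t < s])%classic.
    by apply: open_comp => [x _|]; [exact: Cr|exact: open_lt].
  apply/seteqP; split=> x /=; first by apply; exact: proj_pt_refl.
  by move=> sx w /proj_ptP [l l0 ->]; rewrite rZ.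
- by move=> w /proj_ptP [l l0 ->]; rewrite rZ // midf_lt.
- by move=> w /proj_ptP [l l0 ->]; rewrite rZ // midf_lt.
- apply/seteqP; split=> // p' [[H1 H2] /proj_points [w w0 e]].
  have pw : p' w by rewrite e; exact: proj_pt_refl.
  by have := lt_trans (H1 w pw) (H2 w pw); rewrite ltxx.
Qed.

Lemma proj_is_manifold : is_manifold P.
Proof.
split.
- move=> k; split; first exact: openT.
  by move=> x y _ _; exact: proj_chart_inj.
- move=> k l u u' _ _ e; exists (fun x => unhomog l (homog 1 k x)).
  apply: (@lift_locrep _ _ _ P idfun k u [set: _]%classic (homog 1 k) l) => //.
  + exact: openT.
  + by move=> j; exact: homog_smoothC.
  + by have [] := homog_proj_eq (esym e).
- exact: proj_hausdorff.
- exists [set: 'I_n.+1]%classic; first exact: countableP.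
  by move=> p [k [u [_ <-]]]; exists k, u.
Qed.

(** The charts are connected and all of them contain the point [1 : ... : 1]. *)
Lemma proj_connected : connected_mfd P.
Proof.
split.
  by exists (proj_pt (homog 1 ord0 0)), ord0, 0.
move=> A oA oNA.
have chart k x y : A (proj_pt (homog 1 k x)) -> A (proj_pt (homog 1 k y)).
  apply: (@clopen_rV _ _ [set x | A (proj_pt (homog 1 k x))]%classic).
    by have := oA k; rewrite setTI.
  by have := oNA k; rewrite setTI.
pose one : 'rV[R[i]]_n.+1 := const_mx 1.
have A1 k x : A (proj_pt (homog 1 k x)) <-> A (proj_pt one).
  have o0 : one 0 k != 0 by rewrite mxE oner_neq0.
  by rewrite -(proj_pt_unhomog o0); split; exact: chart.
have [Ao|nAo] := pselect (A (proj_pt one)).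
  by left=> p [k [x [_ <-]]]; exact/A1.
by right=> p [k [x [_ <-]]] /A1.
Qed.

Lemma proj_is_riemannian (c : R) : 0 < c ->
  is_riemannian (@herm_g _ _ (proj_space n c)).
Proof.
move=> c0.
have h0 k x := @homog_vec_neq0 R n k x.
split.
- move=> k u _ l v v' w /=; rewrite !fs_hermE homog0_lin fs_herm_linl cReD cReM /= mul0r subr0.
  by rewrite mulrDr mulrCA.
- by move=> k u _ v w /=; rewrite !fs_hermE fs_hermC cReJ.
- move=> k u _ v v0 /=; rewrite fs_hermE mulr_gt0 ?divr_gt0 //.
  have : 0 < fs_herm (homog 1 k u) (homog 0 k v) (homog 0 k v).
    apply: fs_herm_gt0 => // l; apply/eqP => e.
    have l0 : l = 0.
      have := congr1 (fun z : 'rV[R[i]]_n.+1 => z 0 k) e.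
      by rewrite [RHS]mxE !homog_at mulr1.
    case/eqP: v0; apply: (@homog_inj R n 0 k); rewrite e l0 scale0r.
    apply/rowP => j; rewrite !mxE; case: unliftP => // i _.
    by rewrite !mxE.
  by rewrite ltcE => /andP [].
- move=> k v w m /=; apply: CkM; [exact: openT|exact: Ck_cst|].
  have [H _] := fs_herm_smoothC (homog 0 k v) (homog 0 k w) openT
    (fun x _ => h0 k x) (homog_smoothC _ k).
  exact: H.
- apply: lift_pulls_back => k u _; exists (homog 1 k), (homog 0 k); split=> //.
    by apply: (nearW (nbhs_filter u)).
  by move=> v j; exact: homog_is_deriveC_id.
Qed.

Lemma std_JEl (v : 'rV[R]_(n + n)) i : std_J v 0 (lshift n i) = - v 0 (rshift n i).
Proof. by rewrite row_mxEl !mxE. Qed.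

Lemma std_JEr (v : 'rV[R]_(n + n)) i : std_J v 0 (rshift n i) = v 0 (lshift n i).
Proof. by rewrite row_mxEr !mxE. Qed.

Lemma std_J_lin (c : R) (v v' : 'rV[R]_(n + n)) :
  std_J (c *: v + v') = c *: std_J v + std_J v'.
Proof.
apply/rowP => j; rewrite [RHS]mxE [X in _ = X + _]mxE -[j]splitK.
case: (fintype.split j) => i /=; rewrite ?std_JEl ?std_JEr !mxE //.
by rewrite opprD mulrN.
Qed.

Lemma std_JK (v : 'rV[R]_(n + n)) : std_J (std_J v) = - v.
Proof.
apply/rowP => j; rewrite [RHS]mxE -[j]splitK.
by case: (fintype.split j) => i /=; rewrite !(std_JEl, std_JEr).
Qed.

Lemma proj_is_kahler (c : R) : 0 < c -> is_kahler (proj_space n c).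
Proof.
move=> c0; split; [exact: proj_is_manifold|exact: proj_is_riemannian|split].
- split.
  + by move=> k u _ l v v'; exact: std_J_lin.
  + by move=> k v m; exact: Ck_cst.
  + apply: lift_intertwines => k u _; exists (homog 1 k), (homog 0 k); split.
    * by apply: (nearW (nbhs_filter u)).
    * by move=> v j; exact: homog_is_deriveC_id.
    * by move=> v; exact: homog0_J.
  + move=> k u _ v w; split; first exact: std_JK.
    rewrite /= !fs_hermE !homog0_J; congr (_ * Re _).
    rewrite /fs_herm !cdotZl !cdotZr.
    have i2 : 'i%C * conjc 'i%C = 1 :> R[i] by apply: complex_eq; rewrite /= ; ring.
    transitivity ('i%C * conjc 'i%C * fs_herm (homog 1 k u) (homog 0 k v) (homog 0 k w)).
      by rewrite /fs_herm; ring.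
    by rewrite i2 mul1r.
  + move=> k u _; exists [set: 'rV[R]_(n + n)]%classic, id, u; split=> //.
    * exact: openT.
    * by move=> m; apply: Ck_rV; [exact: openT|move=> j; exact: coord_smooth].
    * move=> y _; split=> // [x x'|v]; first by rewrite !diff_idfun.
      by rewrite !diff_idfun.
move=> k u _ v w x.
have D e a b : 'D_e (fun y => @kahler_form _ _ (proj_space n c) k y a b) u =
    4 / c * Re ('i%C * dfs_herm (homog 1 k u) (homog 0 k e) (homog 0 k a) (homog 0 k b)).
  have h0 : homog 1 k u != 0 :> 'rV[R[i]]_n.+1.
    exact: homog_vec_neq0.
  have H := fs_herm_is_deriveC (homog 0 k a) (homog 0 k b) h0
    (homog_is_deriveC_id k u e).
  have [[_ H1] _] := is_deriveC_M (is_deriveC_cst u e ((4 / c)%:C))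
    (is_deriveC_M (is_deriveC_cst u e 'i%C) H).
  have E y : @kahler_form _ _ (proj_space n c) k y a b =
      Re ((4 / c)%:C * ('i%C * fs_herm (homog 1 k y) (homog 0 k a) (homog 0 k b))).
    rewrite /kahler_form /= fs_hermE homog0_J cReZ.
    by rewrite fs_hermZl.
  under eq_fun do rewrite E.
  by rewrite H1 !mul0r !add0r cReZ.
by rewrite !D -!mulrDr -!cReD -!mulrDr dfs_herm_cyclic mulr0.
Qed.

End ProjectiveKahler.

(** * Tori and their action on projective space *)

Section Torus.
Local Open Scope complex_scope.
Variables (R : realType) (n : nat).
Implicit Types (t s : 'rV[R]_n).

Lemma int_vecP t : reflect (forall i, t 0 i \is a Num.int) (t \in @int_vec R n).
Proof.
rewrite unfold_in /=; apply: (iffP mxOverP) => [H i|H i j]; first exact: H.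
by rewrite (ord1 i); exact: H.
Qed.

Lemma torus_class_eq t s : torus_class t = torus_class s <-> t - s \in @int_vec R n.
Proof. by rewrite (Quotient.idealrBE (@int_vec R n)); split=> [/eqP|/eqP]. Qed.

Lemma torus_classD t s : torus_class (t + s) = torus_class t + torus_class s.
Proof. exact: (@Quotient.pi_add _ (@int_vec R n)). Qed.

Lemma torus_class0 : torus_class (0 : 'rV[R]_n) = 0.
Proof. by apply: (addrI (torus_class 0)); rewrite -torus_classD !addr0. Qed.

Lemma torus_classP (a : torus R n) : exists t, torus_class t = a.
Proof. by exists (repr a); rewrite /torus_class reprK. Qed.

Lemma torus_class_eq0 t : torus_class t = 0 <-> t \in @int_vec R n.
Proof. by rewrite -torus_class0 torus_class_eq subr0. Qed.

(** Two points of an open cube of side 1 cannot differ by a nonzero integer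
    vector, so that such cubes are chart domains of the torus. *)
Lemma torus_class_inj_cube (c : 'rV[R]_n) :
  set_inj [set t : 'rV[R]_n | forall i, `|t 0 i - c 0 i| < 2^-1]%classic (@torus_class R n).
Proof.
move=> t s /set_mem Ht /set_mem Hs /torus_class_eq /int_vecP H.
apply/rowP => i; apply/eqP; rewrite -subr_eq0; apply: contraTT (H i) => ts.
apply/negP => /norm_intr_ge1; rewrite !mxE => /(_ ts).
rewrite leNgt => /negP; apply.
rewrite -(subrKA (c 0 i)) (le_lt_trans (ler_normD _ _)) //.
by rewrite [ltRHS](splitr 1) div1r ltrD // distrC.
Qed.

End Torus.

Section UnitCircle.
Local Open Scope complex_scope.
Variable R : realType.
Implicit Types t : R.

Definition circ t : R[i] := expC (0 +i* (2 * pi * t)).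

Lemma circE t : circ t = cis (2 * pi * t).
Proof. exact: expC_cis. Qed.

Lemma circD t s : circ (t + s) = circ t * circ s.
Proof. by rewrite /circ -expCD mulrDr; congr expC; apply: complex_eq; rewrite /= ?addr0. Qed.

Lemma circ_neq0 t : circ t != 0. Proof. exact: expC_neq0. Qed.

Lemma circ0 : circ 0 = 1.
Proof. by rewrite /circ mulr0 -[RHS]expC0. Qed.

Lemma circ_conj t : circ t * conjc (circ t) = 1.
Proof.
have := cos2Dsin2 (2 * pi * t); rewrite circE !expr2 => e.
apply: complex_eq; rewrite ?cReM ?cImM ?cReJ ?cImJ /=; last by ring.
by rewrite mulrN opprK.
Qed.

Lemma circ_int t : t \is a Num.int -> circ t = 1.
Proof.
have cn (k : nat) : circ k%:R = 1.
  elim: k => [|k IH]; first exact: circ0.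
  rewrite -addn1 natrD circD IH mul1r circE mulr1 /cis mulr_natl cos2pi sin2pi.
  exact: complex_eq.
rewrite intrE => /orP [] /natrP [k e]; first by rewrite e.
have := circD t (- t); rewrite subrr circ0 e cn mulr1 => <-; exact: complex_eq.
Qed.

Lemma circ_eq1 t : circ t = 1 -> t \is a Num.int.
Proof.
pose f := t - (Num.floor t)%:~R.
have -> : t = f + (Num.floor t)%:~R by rewrite subrK.
rewrite circD (circ_int (intr_int _ _)) mulr1 circE => H.
have f0 : 0 <= f by rewrite subr_ge0 floor_le_tmp.
have f1 : f < 1 by rewrite ltrBlDl -intrD1 floorD1_gt.
suff -> : f = 0 by rewrite add0r intr_int.
apply/eqP/negPn/negP => fn0.
have fp : 0 < f by rewrite lt_def fn0.
(* for [0 < f < 1] the half angle has a positive sine, and [1 - cos] is twice the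
   square of that sine *)
have : 0 < sin (pi * f).
  apply: sin_gt0_pi; rewrite mulr_gt0 ?pi_gt0 //=.
  by rewrite -[ltRHS]mulr1 ltr_pM2l ?pi_gt0.
have hc : cos (2 * pi * f) = 1 by have [] := H.
have := hc; rewrite -mulrA mulr_natl mulr2n cosD -!expr2 cos2sin2 => h.
have : sin (pi * f) ^+ 2 = 0 by lra.
by move/eqP; rewrite sqrf_eq0 => /eqP ->; rewrite ltxx.
Qed.

Lemma circ_smoothC (V : normedModType R) (U : set V) (f : V -> R) : open U ->
  smooth_on U f -> smoothC U (fun x => circ (f x)).
Proof.
move=> oU Cf; apply: smoothC_exp => //; split=> k /=; first exact: Ck_cst.
by apply: CkM => //; exact: Ck_cst.
Qed.

End UnitCircle.

Section ProjectiveAction.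
Local Open Scope complex_scope.
Variables (R : realType) (n : nat) (c : R).
Local Notation P := (proj_space n c).
Implicit Types (t s : 'rV[R]_n) (z : 'rV[R[i]]_n.+1).

(** The turns of the homogeneous coordinates under [t]; the last one is fixed. *)
Definition phase t (j : 'I_n.+1) : R :=
  if unlift ord_max j is Some i then t 0 i else 0.

Lemma phase_max t : phase t ord_max = 0.
Proof. by rewrite /phase unlift_none. Qed.

Lemma phase_lift t i : phase t (lift ord_max i) = t 0 i.
Proof. by rewrite /phase liftK. Qed.

Lemma phaseD t s j : phase (t + s) j = phase t j + phase s j.
Proof. by rewrite /phase; case: unlift => [i|]; rewrite ?mxE ?addr0. Qed.

Lemma torus_rotE t z j : torus_rot t z 0 j = circ (phase t j) * z 0 j.
Proof.
rewrite mxE /phase; case: unlift => [i|]; first by rewrite circE.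
by rewrite circ0 mul1r.
Qed.

Lemma torus_rotD t s z : torus_rot (t + s) z = torus_rot t (torus_rot s z).
Proof. by apply/rowP => j; rewrite !torus_rotE phaseD circD mulrA. Qed.

Lemma torus_rot_int t z : t \in @int_vec R n -> torus_rot t z = z.
Proof.
move=> /int_vecP H; apply/rowP => j; rewrite torus_rotE circ_int ?mul1r //.
by rewrite /phase; case: unlift => [i|]; rewrite ?rpred0.
Qed.

Lemma torus_rot_class t s z : torus_class t = torus_class s ->
  torus_rot t z = torus_rot s z.
Proof.
by move=> /torus_class_eq H; rewrite -[t](subrK s) torus_rotD torus_rot_int.
Qed.

Lemma torus_rotZ t (l : R[i]) z : torus_rot t (l *: z) = l *: torus_rot t z.
Proof.
by apply/rowP => j; rewrite [RHS]mxE !torus_rotE mxE mulrCA.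
Qed.

Lemma torus_rot_eq0 t z j : (torus_rot t z 0 j == 0) = (z 0 j == 0).
Proof. by rewrite torus_rotE mulf_eq0 (negPf (circ_neq0 _)). Qed.

Lemma proj_actionE t z : proj_action (torus_class t) (proj_pt z) =
  proj_pt (torus_rot t z).
Proof.
apply/seteqP; split=> w.
  move=> [s [y [/(torus_rot_class y) -> /proj_ptP [l l0 ->]]]].
  by rewrite torus_rotZ proj_pt_scale.
by move=> H; exists t, z; split=> //; exact: proj_pt_refl.
Qed.

Lemma cdot_torus_rot t z y : cdot (torus_rot t z) (torus_rot t y) = cdot z y.
Proof.
apply: eq_bigr => j _; rewrite !torus_rotE; set e := circ _.
transitivity (e * conjc e * (z 0 j * conjc (y 0 j))); last by rewrite circ_conj mul1r.
by rewrite -[Num.conj _]/(conjc _) rmorphM /=; ring.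
Qed.

(** A point with a zero coordinate is fixed by a half turn: of that coordinate,
    or, when it is the last one, of all the others, which multiplies the
    homogeneous vector by -1. *)
Lemma free_pointsP (Phi : torus R n -> carrier (herm_space P) -> carrier (herm_space P)) z :
  (forall a p, Phi a p = proj_action a p) -> (0 < n)%N -> z != 0 ->
  (@free_points R n P Phi (proj_pt z) <-> forall j, z 0 j != 0).
Proof.
move=> PhiE n0 z0; split=> [[_ H] j|H].
  apply/negP => /eqP zj.
  have half i (t : 'rV[R]_n) : t 0 i = 2^-1 -> torus_rot t z = z \/ torus_rot t z = (-1) *: z -> False.
    move=> ti e.
    have : torus_class t = 0.
      apply: H; rewrite PhiE proj_actionE; case: e => -> //.
      by rewrite proj_pt_scale // oppr_eq0 oner_neq0.
    move=> /torus_class_eq0 /int_vecP /(_ i); rewrite ti => /norm_intr_ge1.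
    rewrite invr_eq0 pnatr_eq0 => /(_ isT); rewrite ger0_norm ?invr_ge0 //.
    by rewrite invf_ge1 // leNgt ltr1n.
  have chalf : circ (2^-1 : R) = -1.
    rewrite circE mulrAC mulfV ?pnatr_eq0 // mul1r /cis cospi sinpi.
    by apply: complex_eq; rewrite /= ?oppr0.
  case: (unliftP ord_max j) zj => [i ->|->] zj.
    apply: (half i (2^-1 *: delta_mx 0 i)); first by rewrite !mxE !eqxx mulr1.
    left; apply/rowP => k; rewrite torus_rotE; case: (unliftP ord_max k) => [i' ->|->].
      rewrite phase_lift !mxE eqxx /=; case: eqP => [->|_]; first by rewrite zj mulr0.
      by rewrite mulr0 circ0 mul1r.
    by rewrite phase_max circ0 mul1r.
  apply: (half (Ordinal n0) (const_mx 2^-1)); first by rewrite mxE.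
  right; apply/rowP => k; rewrite torus_rotE mxE; case: (unliftP ord_max k) => [i' ->|->].
    by rewrite phase_lift mxE chalf.
  by rewrite zj !mulr0.
split; first exact: proj_points_pt.
move=> a; have [t <-] := torus_classP a; rewrite PhiE proj_actionE.
move=> /esym /proj_pt_eqP [l l0 e].
have El j : circ (phase t j) = l.
  apply: (mulIf (H j)); have := congr1 (fun y : 'rV_n.+1 => y 0 j) e.
  by rewrite torus_rotE mxE.
have l1 : l = 1 by rewrite -(El ord_max) phase_max circ0.
apply/torus_class_eq0/int_vecP => i; apply: circ_eq1.
by rewrite -phase_lift El.
Qed.

Variable Phi : torus R n -> carrier (herm_space P) -> carrier (herm_space P).
Hypothesis PhiE : forall a p, Phi a p = proj_action a p.

Lemma proj_torus_action : torus_action Phi.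
Proof.
have rot0 t z : z != 0 -> torus_rot t z != 0.
  by move=> /rV0Pn [k zk]; apply/rV0Pn; exists k; rewrite torus_rot_eq0.
split.
- move=> a p /proj_points [z z0 ->]; have [t <-] := torus_classP a.
  by rewrite PhiE proj_actionE; apply: proj_points_pt; exact: rot0.
- move=> p /proj_points [z z0 ->].
  by rewrite PhiE -torus_class0 proj_actionE torus_rot_int // rpred0.
- move=> a b p /proj_points [z z0 ->].
  have [t <-] := torus_classP a; have [s <-] := torus_classP b.
  by rewrite !PhiE -torus_classD !proj_actionE torus_rotD.
move=> [W k] u [[oW iW Wu] _] /=.
pose Z (x : 'rV[R]_(n + (n + n))) := torus_rot (lsubmx x) (homog 1 k (rsubmx x)).
exists k, (fun x => unhomog k (Z x)).
pose U := (@lsubmx R 1 n (n + n) @^-1` W)%classic.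
have oU : open U.
  apply: (@open_comp _ _ (@lsubmx R 1 n (n + n)) W) => // x _.
  by apply: differentiable_continuous; exact: differentiable_lsubmx.
apply: (lift_locrep (W := U) (Z := Z)) => //.
- move=> j.
  have EZ x : Z x 0 j = circ (phase (lsubmx x) j) * homog 1 k (rsubmx x) 0 j.
    exact: torus_rotE.
  under eq_fun do rewrite EZ.
  have CX i : smooth_on U
     (fun x => x 0 i) by exact: coord_smooth.
  apply: smoothC_M => //.
    apply: circ_smoothC => // m; rewrite /phase; case: unlift => [i|]; last exact: Ck_cst.
    by under eq_fun do rewrite mxE; exact: CX.
  case: (unliftP k j) => [i ->|->].
    under eq_fun do rewrite homog_lift; split=> m /=; under eq_fun do rewrite mxE; exact: CX.
  by under eq_fun do rewrite homog_at; exact: smoothC_cst.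
- by move=> w _; rewrite PhiE /= proj_actionE.
- by rewrite ?/Z torus_rot_eq0 homog_neq0.
Qed.

Lemma proj_effective_action : (0 < n)%N -> effective_action Phi.
Proof.
move=> n0 a H; have one0 : (const_mx 1 : 'rV[R[i]]_n.+1) != 0.
  by apply/rV0Pn; exists ord0; rewrite mxE oner_neq0.
have [|_ +] := (free_pointsP PhiE n0 one0).2; first by move=> j; rewrite mxE oner_neq0.
by apply; apply: H; exact: proj_points_pt.
Qed.

Lemma proj_action_hol_isometric a : @hol_isometric R _ _ P P (Phi a).
Proof.
have [t ta] := torus_classP a.
have E k x : Phi a (chart_par k x) = proj_pt (torus_rot t (homog 1 k x)).
  by rewrite PhiE -ta /= proj_actionE.
have D k u v j : is_deriveC u v (fun x => torus_rot t (homog 1 k x) 0 j)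
     (torus_rot t (homog 0 k v) 0 j).
  under eq_fun do rewrite torus_rotE; rewrite torus_rotE.
  have := is_deriveC_M (is_deriveC_cst u v (circ (phase t j))) (homog_is_deriveC_id k u v j).
  by rewrite mul0r add0r.
split.
- move=> k u _; exists k, (fun x => unhomog k (torus_rot t (homog 1 k x))).
  apply: (lift_locrep (W := [set: 'rV[R]_(n + n)]%classic)
     (Z := fun x => torus_rot t (homog 1 k x))) => //.
  + exact: openT.
  + move=> j; under eq_fun do rewrite torus_rotE.
    apply: smoothC_M openT _ _; [exact: smoothC_cst|exact: homog_smoothC].
  + by rewrite ?/Z torus_rot_eq0 homog_neq0.
- apply: lift_pulls_back => k u _.
  exists (fun x => torus_rot t (homog 1 k x)), (fun v => torus_rot t (homog 0 k v)); split.
  + by apply: (nearW (nbhs_filter u)) => w; exact: E.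
  + by move=> v j; exact: D.
  + by move=> v w; rewrite /= !fs_hermE /fs_herm !cdot_torus_rot.
- apply: lift_intertwines => k u _.
  exists (fun x => torus_rot t (homog 1 k x)), (fun v => torus_rot t (homog 0 k v)); split.
  + by apply: (nearW (nbhs_filter u)) => w; exact: E.
  + by move=> v j; exact: D.
  + by move=> v; rewrite homog0_J torus_rotZ.
Qed.

End ProjectiveAction.

(** * Dually flat families with a covariance metric *)

Section Softmax.
Variables (R : realType) (n : nat).
Implicit Types (u v w x : 'rV[R]_n).

(** Softmax probabilities on n + 1 points, the last of which has the exponent 0;
    vectors of length n are the functions on these points that vanish there. *)
Definition partfun u : R := 1 + \sum_i expR (u 0 i).
Definition softmax u (i : 'I_n) : R := expR (u 0 i) / partfun u.
Definition mean u v : R := \sum_i softmax u i * v 0 i.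
Definition had v w : 'rV[R]_n := \row_i (v 0 i * w 0 i).
Definition cov u v w : R := mean u (had v w) - mean u v * mean u w.

Lemma partfun_gt0 u : 0 < partfun u.
Proof. by rewrite ltr_pwDl // sumr_ge0 // => i _; exact: expR_ge0. Qed.

Lemma softmax_gt0 u i : 0 < softmax u i.
Proof. by rewrite divr_gt0 ?expR_gt0 ?partfun_gt0. Qed.

Lemma sum_softmax u : \sum_i softmax u i = 1 - (partfun u)^-1.
Proof.
rewrite -mulr_suml /partfun -[X in X / _](addKr 1) mulrDl mulN1r mulfV ?gt_eqF //.
  by rewrite addrC.
exact: partfun_gt0.
Qed.

Lemma meanD u v w : mean u (v + w) = mean u v + mean u w.
Proof. by rewrite /mean -big_split; apply: eq_bigr => i _; rewrite mxE mulrDr. Qed.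

Lemma meanZ u (k : R) v : mean u (k *: v) = k * mean u v.
Proof. by rewrite /mean mulr_sumr; apply: eq_bigr => i _; rewrite mxE mulrCA. Qed.

Lemma meanN u v : mean u (- v) = - mean u v.
Proof. by rewrite -scaleN1r meanZ mulN1r. Qed.

Lemma hadC v w : had v w = had w v.
Proof. by apply/rowP => i; rewrite !mxE mulrC. Qed.

Lemma hadA v w x : had v (had w x) = had (had v w) x.
Proof. by apply/rowP => i; rewrite !mxE mulrA. Qed.

Lemma hadDr v w x : had v (w + x) = had v w + had v x.
Proof. by apply/rowP => i; rewrite !mxE mulrDr. Qed.

Lemma hadZr (k : R) v w : had v (k *: w) = k *: had v w.
Proof. by apply/rowP => i; rewrite !mxE mulrCA. Qed.

Lemma hadNr v w : had v (- w) = - had v w.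
Proof. by rewrite -(scaleN1r w) hadZr scaleN1r. Qed.

Lemma covC u v w : cov u v w = cov u w v.
Proof. by rewrite /cov hadC mulrC. Qed.

Lemma cov_linr u (k : R) v w w' : cov u v (k *: w + w') = k * cov u v w + cov u v w'.
Proof. by rewrite /cov hadDr hadZr !meanD !meanZ; ring. Qed.

Lemma cov0l u w : cov u 0 w = 0.
Proof. by rewrite covC -(scale0r 0) -[_ *: _]addr0 cov_linr mul0r add0r /cov -(scale0r 0) hadZr !meanZ !mul0r mulr0 subr0. Qed.

(** A variance on n + 1 points, that of the function [v] extended by 0 to the
    last point, which carries the remaining mass [(partfun u)^-1]; it is written
    below as a sum of squares with positive weights. *)
Lemma cov_gt0 u v : v != 0 -> 0 < cov u v v.
Proof.
move=> v0; set m := mean u v.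
have -> : cov u v v =
    \sum_i softmax u i * (v 0 i - m) ^+ 2 + (partfun u)^-1 * m ^+ 2.
  have -> : \sum_i softmax u i * (v 0 i - m) ^+ 2 =
      mean u (had v v + ((- 2 * m) *: v + m ^+ 2 *: const_mx 1)).
    by apply: eq_bigr => i _; rewrite !mxE; ring.
  have mean1 : mean u (const_mx 1) = 1 - (partfun u)^-1.
    by rewrite -sum_softmax; apply: eq_bigr => i _; rewrite mxE mulr1.
  by rewrite !meanD !meanZ mean1 /cov -/m; ring.
have Z0 := partfun_gt0 u.
have s0 : 0 <= \sum_i softmax u i * (v 0 i - m) ^+ 2.
  by apply: sumr_ge0 => i _; rewrite mulr_ge0 ?sqr_ge0 // ltW // softmax_gt0.
have [m0|m0] := eqVneq m 0; last first.
  by rewrite ltr_wpDl // mulr_gt0 ?invr_gt0 // lt_def sqrf_eq0 m0 sqr_ge0.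
have /rV0Pn [i vi] := v0; rewrite m0 expr0n mulr0 addr0 (bigD1 i) //=.
rewrite ltr_pwDl //; first by rewrite subr0 mulr_gt0 ?softmax_gt0 // lt_def sqrf_eq0 vi sqr_ge0.
by apply: sumr_ge0 => j _; rewrite mulr_ge0 ?sqr_ge0 // ltW // softmax_gt0.
Qed.

Variable s : R.

Lemma scaled_coord_is_derive u v i :
  is_derive u v (fun x : 'rV[R]_n => (s *: x) 0 i) (s * v 0 i) /\
  differentiable (fun x : 'rV[R]_n => (s *: x) 0 i) u.
Proof.
have C : smooth_on [set: 'rV[R]_n] (fun x : 'rV[R]_n => (s *: x) 0 i).
  move=> k; under eq_fun do rewrite mxE.
  by apply: CkM openT (Ck_cst _ _ _) _; exact: coord_smooth.
split; last by have [+ _] := C 1%N; apply.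
under eq_fun do rewrite mxE.
rewrite -[in v 0 i](diff_idfun u v).
have := is_derive_mul (is_derive_cst s u v) (coord_is_derive v i (@ex_diff _ _ _ _ _ id id (is_diff_id u))).
by rewrite mul0r add0r.
Qed.

Lemma expR_coord_smooth j :
  smooth_on [set: 'rV[R]_n] (fun x => expR ((s *: x) 0 j)).
Proof.
move=> k; apply: (Ck_comp openT (D := [set: R])) => //; first exact: smooth_expR.
under eq_fun do rewrite mxE.
by apply: CkM openT (Ck_cst _ _ _) _; exact: coord_smooth.
Qed.

Lemma partfun_smooth : smooth_on [set: 'rV[R]_n] (fun x => partfun (s *: x)).
Proof.
move=> k; apply: CkD openT (Ck_cst _ _ _) _.
by apply: Ck_sum openT _ => j; exact: expR_coord_smooth.
Qed.

Lemma expR_coord_is_derive u v j : is_derive u v (fun x => expR ((s *: x) 0 j))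
  (expR ((s *: u) 0 j) * (s * v 0 j)).
Proof.
have [H1 H2] := scaled_coord_is_derive u v j.
exact: is_derive_chain H1 H2 (is_derive_expR _).
Qed.

Lemma partfun_is_derive u v : is_derive u v (fun x => partfun (s *: x))
  (s * partfun (s *: u) * mean (s *: u) v).
Proof.
have HS : is_derive u v (fun x => \sum_j expR ((s *: x) 0 j))
    (\sum_j expR ((s *: u) 0 j) * (s * v 0 j)).
  have := @is_derive_sum _ _ _ n (fun j x => expR ((s *: x) 0 j)) u v
    (fun j => expR ((s *: u) 0 j) * (s * v 0 j)) (expR_coord_is_derive u v).
  by congr is_derive; apply/funext => x; rewrite fct_sumE.
have Z0 : partfun (s *: u) != 0 by rewrite gt_eqF // partfun_gt0.
have := is_deriveD (is_derive_cst (1 : R) u v) HS; congr is_derive.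
rewrite add0r /mean mulr_sumr; apply: eq_bigr => j _.
by rewrite /softmax; field.
Qed.

Lemma softmax_is_derive u v i :
  is_derive u v (fun x => softmax (s *: x) i)
    (s * softmax (s *: u) i * (v 0 i - mean (s *: u) v)).
Proof.
have Z0 : partfun (s *: u) != 0 by rewrite gt_eqF // partfun_gt0.
have := is_derive_mul (expR_coord_is_derive u v i)
  (is_derive_inv (f := fun x => partfun (s *: x)) Z0 (partfun_is_derive u v)).
congr is_derive; rewrite /softmax; move: Z0.
by set Z := partfun _; move=> Z0; field.
Qed.

Lemma mean_is_derive u v w :
  is_derive u v (fun x => mean (s *: x) w) (s * cov (s *: u) w v).
Proof.
have H i := is_derive_mul (softmax_is_derive u v i) (is_derive_cst (w 0 i) u v).
have := @is_derive_sum _ _ _ n (fun i x => softmax (s *: x) i * w 0 i) u v _ H.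
congr is_derive; first by apply/funext => x; rewrite fct_sumE.
transitivity (\sum_i (s * (softmax (s *: u) i * had w v 0 i) -
   s * mean (s *: u) v * (softmax (s *: u) i * w 0 i))).
  by apply: eq_bigr => i _; rewrite mxE /cst; ring.
by rewrite sumrB -!mulr_sumr /cov -!/(mean _ _); ring.
Qed.

Lemma cov_is_derive u x v w :
  is_derive u x (fun y => cov (s *: y) v w)
   (s * (cov (s *: u) (had v w) x - cov (s *: u) v x * mean (s *: u) w
      - mean (s *: u) v * cov (s *: u) w x)).
Proof.
have := is_deriveB (mean_is_derive u x (had v w))
  (is_derive_mul (mean_is_derive u x v) (mean_is_derive u x w)).
by congr is_derive; ring.
Qed.

Lemma softmax_smooth i : smooth_on [set: 'rV[R]_n] (fun x => softmax (s *: x) i).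
Proof.
move=> k; apply: CkM openT (expR_coord_smooth i k) _.
apply: (Ck_comp openT _ (@smooth_inv R k)) => [x _ /=|]; last exact: partfun_smooth.
by rewrite gt_eqF // (partfun_gt0 (s *: x)).
Qed.

Lemma mean_smooth v : smooth_on [set: 'rV[R]_n] (fun x => mean (s *: x) v).
Proof.
move=> k; apply: Ck_sum openT _ => i.
by apply: CkM openT _ (Ck_cst _ _ _); exact: softmax_smooth.
Qed.

Lemma cov_smooth v w : smooth_on [set: 'rV[R]_n] (fun x => cov (s *: x) v w).
Proof.
move=> k; apply: CkD openT (mean_smooth _ k) _.
apply: smooth_opp openT _ k => k'.
by apply: CkM openT _ _; exact: mean_smooth.
Qed.

(** The flat connection of the expectation parameters, in natural parameters. It
    is dual to the exponential one: the derivative of a covariance is a third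
    cumulant, and the third cumulant of [v], [x], [w] is the covariance of [v]
    with [(x - mean x) (w - mean w)], which this vector represents up to a
    constant when [s = 1]. *)
Definition mixture_conn u v w : 'rV[R]_n :=
  s *: (had v w - mean (s *: u) w *: v - mean (s *: u) v *: w).

Lemma mixture_connE u v w i : mixture_conn u v w 0 i =
  s * (v 0 i * w 0 i - mean (s *: u) w * v 0 i - mean (s *: u) v * w 0 i).
Proof. by rewrite !mxE. Qed.

Lemma mixture_connC u v w : mixture_conn u v w = mixture_conn u w v.
Proof. by rewrite /mixture_conn hadC addrAC. Qed.

Lemma mixture_conn_linr u (k : R) v w w' :
  mixture_conn u v (k *: w + w') = k *: mixture_conn u v w + mixture_conn u v w'.
Proof.
apply/rowP => i; rewrite [RHS]mxE [X in _ = X + _]mxE !mixture_connE meanD meanZ !mxE.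
ring.
Qed.

Lemma mean_mixture_conn u v w : mean (s *: u) (mixture_conn u v w) =
  s * (mean (s *: u) (had v w) - 2 * mean (s *: u) v * mean (s *: u) w).
Proof. rewrite /mixture_conn meanZ !meanD !meanN !meanZ; ring. Qed.

Lemma cov_mixture_conn u v w x : cov (s *: u) v (mixture_conn u x w) =
  s * (cov (s *: u) (had v w) x - cov (s *: u) v x * mean (s *: u) w
    - mean (s *: u) v * cov (s *: u) w x).
Proof.
rewrite /cov mean_mixture_conn /mixture_conn hadZr !(hadDr, hadNr, hadZr).
rewrite !(meanZ, meanD, meanN) [had x w]hadC hadA; ring.
Qed.

Lemma mixture_conn_is_derive u v w x :
  'D_v (fun y => mixture_conn y w x) u =
  s ^+ 2 *: (- cov (s *: u) x v *: w - cov (s *: u) w v *: x).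
Proof.
have H i : is_derive u v (fun y => mixture_conn y w x 0 i)
   (s ^+ 2 * (- cov (s *: u) x v * w 0 i - cov (s *: u) w v * x 0 i)).
  under eq_fun do rewrite mixture_connE.
  have := is_derive_mul (is_derive_cst s u v) (is_deriveB (is_deriveB
    (is_derive_cst (w 0 i * x 0 i) u v)
    (is_derive_mul (mean_is_derive u v x) (is_derive_cst (w 0 i) u v)))
    (is_derive_mul (mean_is_derive u v w) (is_derive_cst (x 0 i) u v))).
  by congr is_derive; rewrite /cst; ring.
rewrite derive_mx; last first.
  by apply/derivable_mxP => i j; rewrite (ord1 i); have [] := H j.
by apply/rowP => i; rewrite [LHS]mxE; have [_ ->] := H i; rewrite !mxE; ring.
Qed.

End Softmax.

Section FamilyManifold.
Variables (R : realType) (I : finType) (n : nat) (p : 'rV[R]_n -> I -> R).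
Hypothesis p_inj : injective p.
Local Notation M := (family_mfd p).

Lemma family_locrep a b u g : @locrep R _ _ M M idfun a b u g ->
  exists W : set 'rV[R]_n, [/\ open W, W u, smooth_on W g &
    forall w, W w -> g w = w].
Proof.
move=> [W [oW Wu Cg Hg]]; exists W; split=> // w Ww.
by have [_ _ /p_inj] := Hg w Ww.
Qed.

Lemma id_near_diff (W : set 'rV[R]_n) (g : 'rV[R]_n -> 'rV[R]_n) x v :
  open W -> W x -> (forall w, W w -> g w = w) -> 'd g x v = v.
Proof.
move=> oW Wx gE.
have E : \forall y \near x, id y = g y.
  by apply: filterS (open_nbhs_nbhs (conj oW Wx)) => y /gE.
have [_ ->] := near_eq_is_diff E (@ex_diff _ _ _ _ _ id id (is_diff_id x)).
exact: diff_idfun.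
Qed.

(** An injective parametrization has no other coordinate change than the
    identity, so that the compatibility conditions on tensors and connections
    become trivial. *)
Lemma family_locrep_diff a b u g : @locrep R _ _ M M idfun a b u g ->
  [/\ g u = u, forall v, 'd g u v = v &
      forall v w, 'D_v (fun x => 'd g x w) u = 0].
Proof.
move=> /family_locrep [W [oW Wu Cg gE]]; split; first exact: gE.
  by move=> v; exact: (id_near_diff v oW Wu gE).
move=> v w; rewrite -[RHS](derive_cst w u v); apply: near_eq_derive.
apply: filterS (open_nbhs_nbhs (conj oW Wu)) => y Wy.
exact: id_near_diff w oW Wy gE.
Qed.

Lemma family_mopen (A : set 'rV[R]_n) : open A -> @mopen R _ M (p @` A)%classic.
Proof.
move=> oA a; rewrite setTI [X in open X](_ : _ = A) //.
apply/seteqP; split=> x /=; last by move=> Ax; exists x.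
by move=> [y Ay /p_inj <-].
Qed.

Lemma family_is_manifold : is_manifold M.
Proof.
split.
- by move=> a; split; [exact: openT|move=> x y _ _ /p_inj].
- move=> a b u u' _ _ /= e; exists idfun; exists [set: 'rV[R]_n]%classic; split=> //.
    exact: openT.
  by move=> k; apply: (@Ck_rV _ _ _ _ _ idfun) => [|j]; [exact: openT|exact: coord_smooth].
- move=> _ _ [a [x [_ <-]]] [b [y [_ <-]]] /= xy.
  have xny : x != y by apply/eqP => e; apply: xy; rewrite e.
  have := @norm_hausdorff R 'rV[R]_n; rewrite open_hausdorff.
  move=> /(_ x y xny) [[A B] /= [Ax By] [oA oB /eqP AB]].
  exists (p @` A)%classic, (p @` B)%classic; split.
  + exact: family_mopen.
  + exact: family_mopen.
  + by exists x => //; move/set_mem: Ax.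
  + by exists y => //; move/set_mem: By.
  + apply/seteqP; split=> // _ [[[z Az <-] [z' Bz' /p_inj e]] _].
    by rewrite e in Bz'; have : (A `&` B)%classic z by []; rewrite AB.
- exists [set: unit]%classic; first exact: countableP.
  by move=> _ [a [u [_ <-]]]; exists a, u.
Qed.

Lemma family_connected : connected_mfd M.
Proof.
split; first by exists (p 0), tt, 0.
move=> A oA oNA.
have H x y : A (p x) -> A (p y).
  apply: (@clopen_rV _ _ (p @^-1` A)%classic).
    by have := oA tt; rewrite setTI.
  by have := oNA tt; rewrite setTI.
have [A0|nA0] := pselect (A (p 0)).
  by left=> _ [a [x [_ <-]]]; exact: H A0.
by right=> _ [a [x [_ <-]]] Ax; apply: nA0; exact: H Ax.
Qed.

Variables (c s : R).
Hypotheses (c0 : 0 < c) (s0 : s != 0).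
Local Notation D := (exp_family p).
Hypothesis fisher : forall a u v w, @stat_metric R n D a u v w =
  s ^+ 2 / c * cov (s *: u) v w.

Lemma family_dually_flat : dually_flat D.
Proof.
have k0 : 0 < s ^+ 2 / c by rewrite divr_gt0 // lt_def sqrf_eq0 s0 sqr_ge0.
split.
- exact: family_is_manifold.
- split.
  + move=> a u _ k v v' w; rewrite !fisher covC cov_linr [cov _ w v]covC [cov _ w v']covC; ring.
  + by move=> a u _ v w; rewrite !fisher covC.
  + by move=> a u _ v v0; rewrite fisher mulr_gt0 // cov_gt0.
  + move=> a v w k; under eq_fun do rewrite fisher.
    by apply: CkM openT (Ck_cst _ _ _) _; exact: cov_smooth.
  + move=> a b u g lr v w; have [-> dg _] := family_locrep_diff lr.
    by rewrite !dg !fisher.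
- split.
  + by move=> a u _ k v v' w; rewrite /= scaler0 addr0.
  + by move=> a u _ k v v' w; rewrite /= scaler0 addr0.
  + by move=> a v w k; exact: Ck_cst.
  + move=> a b u g lr v w; have [_ _ d2] := family_locrep_diff lr.
    by rewrite /= d2 linear0 subr0.
- move=> a u _; split=> [v w|v w x]; first by rewrite subr0.
  by rewrite /= !derive_cst !subr0 addr0.
exists (fun _ => @mixture_conn R n s).
  split.
  + by move=> a u _ k v v' w; rewrite !(mixture_connC _ _ _ w) mixture_conn_linr.
  + by move=> a u _ k v v' w; rewrite mixture_conn_linr.
  + move=> a v w k; apply: Ck_rV openT _ => i.
    under eq_fun do rewrite mixture_connE.
    apply: CkM openT (Ck_cst _ _ _) _.
    apply: CkD openT _ _; last first.
      apply: smooth_opp openT _ k => k'.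
      by apply: CkM openT _ (Ck_cst _ _ _); exact: mean_smooth.
    apply: CkD openT (Ck_cst _ _ _) _.
    apply: smooth_opp openT _ k => k'.
    by apply: CkM openT _ (Ck_cst _ _ _); exact: mean_smooth.
  + move=> a b u g lr v w; have [-> dg d2] := family_locrep_diff lr.
    by rewrite d2 !dg subr0.
split.
  move=> a u _ x v w; rewrite !fisher; under eq_fun do rewrite fisher.
  have [_ ->] := is_derive_mul (is_derive_cst (s ^+ 2 / c) u x) (cov_is_derive s u x v w).
  rewrite [_ a u x v]/= cov0l.
  by rewrite cov_mixture_conn /cst; ring.
move=> a u _; split=> [v w|v w x]; first by rewrite mixture_connC subrr.
rewrite !mixture_conn_is_derive; apply/rowP => i.
rewrite !mxE !mean_mixture_conn /cov [had x v]hadC [had w v]hadC [had x w]hadC; ring.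
Qed.

End FamilyManifold.

(** * The complex exponential in homogeneous coordinates *)

Section ComplexLog.
Local Open Scope complex_scope.
Variable R : realType.
Local Notation Re := complex.Re.
Local Notation Im := complex.Im.
Implicit Types z w : R[i].

(** The principal logarithm, restricted to the right half-plane. *)
Definition logC z : R[i] := (ln (normsq z) / 2) +i* atan (Im z / Re z).

Lemma normsq_gt0 z : 0 < Re z -> 0 < normsq z.
Proof. by move=> z0; rewrite ltr_pwDl ?mulr_gt0 // -expr2 sqr_ge0. Qed.

Lemma logCK z : 0 < Re z -> expC (logC z) = z.
Proof.
case: z => a b /= a0; have an0 : a != 0 by rewrite gt_eqF.
have N0 : 0 < normsq (a +i* b) by exact: normsq_gt0.
have q0 : 0 < 1 + (b / a) ^+ 2 by rewrite ltr_pwDl // sqr_ge0.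
have eE : expR (ln (normsq (a +i* b)) / 2) = a * Num.sqrt (1 + (b / a) ^+ 2).
  have e0 := expR_ge0 (ln (normsq (a +i* b)) / 2).
  apply/eqP; rewrite -(eqrXn2 (n := 2)) // ?mulr_ge0 ?sqrtr_ge0 ?(ltW a0) //.
  rewrite exprMn sqr_sqrtr ?(ltW q0) // expr2 -expRD -splitr lnK ?posrE //.
  by apply/eqP; rewrite /normsq /=; field.
have s0 : Num.sqrt (1 + (b / a) ^+ 2) != 0 by rewrite gt_eqF // sqrtr_gt0.
have ca : cos (atan (b / a)) != 0.
  by rewrite cos_atan invr_eq0.
have sE : sin (atan (b / a)) = b / a * cos (atan (b / a)).
  by rewrite -{2}(atanK (b / a)) /tan divfK.
by apply: complex_eq; rewrite /expC /= eE ?sE cos_atan; field; rewrite s0.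
Qed.

Lemma logC_smooth (V : normedModType R) (U : set V) (f : V -> R[i]) : open U ->
  smoothC U f -> (forall x, U x -> 0 < Re (f x)) -> smoothC U (fun x => logC (f x)).
Proof.
move=> oU Cf f0; have [f1 f2] := Cf; split=> k /=.
  apply: CkM => //; last exact: Ck_cst.
  apply: (Ck_comp oU _ (@smooth_ln R k)) => [x Ux /=|]; last exact: smooth_normsq.
  exact/normsq_gt0/f0.
apply: (Ck_comp oU (D := [set: R])) => //; first exact: smooth_atan.
apply: CkM => //; apply: (Ck_comp oU _ (@smooth_inv R k)) => // x Ux /=.
by rewrite gt_eqF // f0.
Qed.

(** Quarter turns bring every nonzero number into the right half-plane, where
    [logC] is a logarithm. *)
Lemma expC_surj z : z != 0 -> exists w, expC w = z.
Proof.
pose q : R[i] := 0 +i* (pi / 2).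
have qE : expC q = 0 +i* 1 by rewrite expC_cis /cis cos_pihalf sin_pihalf.
have pos y : 0 < Re y -> exists w, expC w = y.
  by move=> y0; exists (logC y); rewrite logCK.
have turn y : (exists w, expC w = expC q * y) -> exists w, expC w = y.
  move=> [w e]; exists (w - q); apply: (mulfI (expC_neq0 q)).
  by rewrite -expCD addrC subrK.
have [a0|a0|a0] := ltrgt0P (Re z) => z0; first exact: pos.
  apply/turn/turn/pos; rewrite mulrA qE.
  by case: z a0 z0 => a b /= a0 _; lra.
have [b0|b0|b0] := ltrgt0P (Im z).
- apply/turn/turn/turn/pos; rewrite !mulrA qE.
  by case: z a0 z0 b0 => a b /= a0 _ b0; lra.
- apply/turn/pos; rewrite qE.
  by case: z a0 z0 b0 => a b /= a0 _ b0; lra.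
- by case/eqP: z0; apply: complex_eq.
Qed.

Lemma expC_eq z w : expC z = expC w -> Re z = Re w /\
  exists2 k, k \is a Num.int & Im z = Im w + 2 * pi * k.
Proof.
move=> e; have e1 : expC (z - w) = 1.
  apply: (mulIf (expC_neq0 w)); rewrite mul1r -expCD subrK //.
have r0 : Re (z - w) = 0.
  have := normsq_expC (z - w); rewrite e1 /normsq /= !mulr0 addr0 mulr1 => /esym h.
  have := expRK (2 * Re (z - w)); rewrite h ln1 => /esym /eqP.
  by rewrite mulf_eq0 pnatr_eq0 /= => /eqP.
split; first by apply/eqP; rewrite -subr_eq0 -cReN -cReD r0.
pose k := (Im z - Im w) / (2 * pi).
have p0 : 2 * pi != 0 :> R by rewrite mulf_neq0 // gt_eqF // pi_gt0.
have kE : 2 * pi * k = Im z - Im w by rewrite /k mulrC divfK.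
exists k; last by rewrite kE addrC subrK.
apply: circ_eq1; rewrite /circ kE -e1; congr expC.
by apply: complex_eq => /=; rewrite ?r0 // cImD cImN.
Qed.

End ComplexLog.

Section ToricExponential.
Local Open Scope complex_scope.
Variables (R : realType) (n : nat) (s : R).
Hypothesis s0 : s != 0.
Implicit Types (x y v w : 'rV[R]_(n + n)) (t k : 'rV[R]_n).
Local Notation Re := complex.Re.
Local Notation Im := complex.Im.

Definition ccoord v (i : 'I_n) : R[i] := v 0 (lshift n i) +i* v 0 (rshift n i).

(** With [x] standing for [u + i xi], the point [[exp (s (u + i xi) / 2), 1]]. *)
Definition toric_exp x : 'rV[R[i]]_n.+1 :=
  \row_j (if unlift ord_max j is Some i then expC ((s / 2)%:C * ccoord x i) else 1).

Definition dtoric_exp x v : 'rV[R[i]]_n.+1 :=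
  \row_j (if unlift ord_max j is Some i
    then (s / 2)%:C * ccoord v i * toric_exp x 0 j else 0).

(** The step for which [toric_exp] turns the translation of a fiber into the
    rotation [torus_rot]: [s / 2 * (4 * pi / s) = 2 * pi]. *)
Definition shift_fiber t : 'rV[R]_(n + n) := row_mx 0 ((4 * pi / s) *: t).

Lemma ccoordD x y i : ccoord (x + y) i = ccoord x i + ccoord y i.
Proof. by apply: complex_eq; rewrite ?cReD ?cImD /= mxE. Qed.

Lemma ccoord_J v i : ccoord (std_J v) i = 'i%C * ccoord v i.
Proof.
by apply: complex_eq; rewrite ?cReM ?cImM /= ?std_JEl ?std_JEr; ring.
Qed.

Lemma toric_exp_max x : toric_exp x 0 ord_max = 1.
Proof. by rewrite mxE unlift_none. Qed.

Lemma toric_exp_lift x i :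
  toric_exp x 0 (lift ord_max i) = expC ((s / 2)%:C * ccoord x i).
Proof. by rewrite mxE liftK. Qed.

Lemma toric_exp_neq0 x j : toric_exp x 0 j != 0.
Proof.
by case: (unliftP ord_max j) => [i ->|->]; rewrite ?toric_exp_lift ?expC_neq0 //
  toric_exp_max oner_neq0.
Qed.

Lemma toric_exp_vec_neq0 x : toric_exp x != 0.
Proof. by apply/rV0Pn; exists ord_max; exact: toric_exp_neq0. Qed.

Lemma toric_exp_shift x t : toric_exp (x + shift_fiber t) = torus_rot t (toric_exp x).
Proof.
apply/rowP => j; rewrite torus_rotE; case: (unliftP ord_max j) => [i ->|->]; last first.
  by rewrite !toric_exp_max phase_max circ0 mul1r.
rewrite !toric_exp_lift phase_lift /circ -expCD.
suff -> : (s / 2)%:C * ccoord (x + shift_fiber t) i =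
    0 +i* (2 * pi * t 0 i) + (s / 2)%:C * ccoord x i by [].
rewrite ccoordD mulrDr [LHS]addrC; congr (_ + _).
rewrite /ccoord row_mxEl row_mxEr !mxE.
by apply: complex_eq; rewrite ?cReM ?cImM /=; [ring|field].
Qed.

Lemma toric_exp_eq x y : proj_pt (toric_exp x) = proj_pt (toric_exp y) ->
  exists2 k, k \in @int_vec R n & x = y + shift_fiber k.
Proof.
move=> /proj_pt_eqP [l l0 e].
have l1 : l = 1.
  have := congr1 (fun z : 'rV[R[i]]_n.+1 => z 0 ord_max) e.
  by rewrite [RHS]mxE !toric_exp_max mulr1.
rewrite l1 scale1r in e.
have H i : Re (ccoord x i) = Re (ccoord y i) /\
    exists2 k, k \is a Num.int & Im (ccoord x i) = Im (ccoord y i) + 4 * pi / s * k.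
  have := congr1 (fun z : 'rV[R[i]]_n.+1 => z 0 (lift ord_max i)) e.
  rewrite !toric_exp_lift => /esym /expC_eq []; rewrite !cReZ => er [k ki ei]; split.
    by apply: (mulfI _ er); rewrite mulf_neq0 // invr_eq0 pnatr_eq0.
  exists k => //; move: ei; rewrite !cImM /= !mul0r !addr0 => ei.
  apply: (mulfI (x := s / 2)); first by rewrite mulf_neq0 // invr_eq0 pnatr_eq0.
  by rewrite ei; field.
pose K i := projT1 (cid2 (H i).2).
have KP i : K i \is a Num.int /\ Im (ccoord x i) = Im (ccoord y i) + 4 * pi / s * K i.
  by rewrite /K; case: cid2.
exists (\row_i K i); first by apply/int_vecP => i; rewrite mxE; have [] := KP i.
apply/rowP => j; rewrite mxE /shift_fiber -[j]splitK.
case: (fintype.split j) => i /=.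
  by rewrite row_mxEl mxE addr0; have [] := H i.
by rewrite row_mxEr !mxE; have [_] := KP i.
Qed.

Lemma toric_exp_surj (z : 'rV[R[i]]_n.+1) : (forall j, z 0 j != 0) ->
  exists x, toric_exp x = (z 0 ord_max)^-1 *: z.
Proof.
move=> z0.
have H i : exists a, expC a = z 0 (lift ord_max i) / z 0 ord_max.
  by apply: expC_surj; rewrite mulf_neq0 // invr_eq0.
pose w i := projT1 (cid (H i)).
have wP i : expC (w i) = z 0 (lift ord_max i) / z 0 ord_max by rewrite /w; case: cid.
exists (row_mx (\row_i (2 / s * Re (w i))) (\row_i (2 / s * Im (w i)))).
apply/rowP => j; rewrite [RHS]mxE; case: (unliftP ord_max j) => [i ->|->]; last first.
  by rewrite toric_exp_max mulVf.
transitivity (expC (w i)); last by rewrite wP mulrC.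
rewrite (@toric_exp_lift _ i); congr expC.
rewrite /ccoord row_mxEl row_mxEr !mxE.
by apply: complex_eq; rewrite ?cReM ?cImM /=; field.
Qed.

Lemma coord_complex_smooth (V : normedModType R) (U : set V)
  (f : V -> 'rV[R]_(n + n)) i :
  (forall j, smooth_on U (fun a : V => f a 0 j)) ->
  smoothC U (fun a : V => ccoord (f a) i).
Proof. by move=> Cf; split=> k /=; exact: Cf. Qed.

Lemma toric_exp_smooth (U : set 'rV[R]_(n + n)) j : open U ->
  smoothC U (fun x => toric_exp x 0 j).
Proof.
move=> oU; case: (unliftP ord_max j) => [i ->|->]; last first.
  by under eq_fun do rewrite toric_exp_max; exact: smoothC_cst.
under eq_fun do rewrite toric_exp_lift.
apply: smoothC_exp => //; apply: smoothC_M => //; first exact: smoothC_cst.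
by apply: coord_complex_smooth => j'; exact: coord_smooth.
Qed.

Lemma toric_exp_is_deriveC x v j :
  is_deriveC x v (fun y => toric_exp y 0 j) (dtoric_exp x v 0 j).
Proof.
case: (unliftP ord_max j) => [i ->|->]; last first.
  under eq_fun do rewrite toric_exp_max; rewrite mxE unlift_none.
  exact: is_deriveC_cst.
under eq_fun do rewrite toric_exp_lift.
rewrite mxE liftK toric_exp_lift.
pose f (y : 'rV[R]_(n + n)) := (s / 2)%:C * ccoord y i.
have Cf : smoothC [set: 'rV[R]_(n + n)] f.
  apply: smoothC_M openT _ _; first exact: smoothC_cst.
  by apply: coord_complex_smooth => j'; exact: coord_smooth.
have [C1 C2] := Cf.
have [d1 _] := C1 1%N; have [d2 _] := C2 1%N.
apply: (@is_deriveC_exp _ _ _ _ f _ (d1 x I) (d2 x I)).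
have Hc j' := coord_is_derive v j' (@ex_diff _ _ _ _ _ id id (is_diff_id x)).
have H : is_deriveC x v (fun y => ccoord y i) (ccoord v i).
  by split=> /=; rewrite -[in X in is_derive _ _ _ X](diff_idfun x v); exact: Hc.
have := is_deriveC_M (is_deriveC_cst x v (s / 2)%:C) H.
by rewrite mul0r add0r.
Qed.

Lemma dtoric_exp_J x v : dtoric_exp x (std_J v) = 'i%C *: dtoric_exp x v.
Proof.
apply/rowP => j; rewrite !mxE; case: unlift => [i|]; last by rewrite mulr0.
by rewrite ccoord_J; ring.
Qed.

Definition meanC (u : 'rV[R]_n) (f : 'I_n -> R[i]) : R[i] :=
  \sum_i (softmax u i)%:C * f i.

Lemma Re_meanC u f : Re (meanC u f) = mean u (\row_i Re (f i)).
Proof.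
rewrite /meanC (big_morph (@complex.Re R) (@cReD R) (erefl _)).
by apply: eq_bigr => i _; rewrite cReZ mxE.
Qed.

Lemma Im_meanC u f : Im (meanC u f) = mean u (\row_i Im (f i)).
Proof.
rewrite /meanC (big_morph (@complex.Im R) (@cImD R) (erefl _)).
by apply: eq_bigr => i _; rewrite cImM mxE /= mul0r addr0.
Qed.

(** The squared moduli of the coordinates of [toric_exp x] are the weights
    [expR (s * u_i)] and 1, so that after division by their sum the Hermitian
    products in [fs_herm] become expectations under the softmax. *)
Lemma fs_toric_exp x v w :
  Re (fs_herm (toric_exp x) (dtoric_exp x v) (dtoric_exp x w)) =
  s ^+ 2 / 4 * (cov (s *: lsubmx x) (lsubmx v) (lsubmx w) +
                cov (s *: lsubmx x) (rsubmx v) (rsubmx w)).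
Proof.
set u := s *: lsubmx x; set Z := partfun u.
have Z0 : Z%:C != 0 :> R[i] by rewrite eq_complex /= negb_and gt_eqF // partfun_gt0.
have ZE i : Z * softmax u i = expR (u 0 i).
  by rewrite mulrC /softmax divfK // gt_eqF // partfun_gt0.
have E2 (i : 'I_n) : toric_exp x 0 (lift ord_max i) * conjc (toric_exp x 0 (lift ord_max i)) =
    Z%:C * (softmax u i)%:C.
  rewrite -rmorphM /= ZE toric_exp_lift.
  rewrite mulC_conj.
  rewrite normsq_expC cReZ /= /u !mxE; congr (expR _)%:C; by field.
have SE : cdot (toric_exp x) (toric_exp x) = Z%:C.
  rewrite /cdot (bigD1_ord ord_max) //= toric_exp_max.
  rewrite (eq_bigr (fun i => (expR (u 0 i))%:C)).
    rewrite -[Num.conj 1]/(conjc 1) mulC_conj -rmorph_sum -rmorphD /normsq /=.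
    by rewrite mulr1 mulr0 addr0.
  by move=> i _; rewrite -[Num.conj _]/(conjc _) E2 -rmorphM /= ZE.
have cR (r : R) (y z : R[i]) : conjc (r%:C * y * z) = r%:C * conjc y * conjc z.
  by rewrite !rmorphM; congr (_ * _ * _); apply: complex_eq; rewrite /= ?oppr0.
have DD a b : cdot (dtoric_exp x a) (dtoric_exp x b) =
    (s / 2)%:C ^+ 2 * Z%:C * meanC u (fun i => ccoord a i * conjc (ccoord b i)).
  rewrite /cdot (bigD1_ord ord_max) //= !mxE unlift_none mul0r add0r /meanC mulr_sumr.
  apply: eq_bigr => i _; rewrite -[Num.conj _]/(conjc _) ![dtoric_exp _ _ _ _]mxE !liftK.
  transitivity ((s / 2)%:C ^+ 2 * (ccoord a i * conjc (ccoord b i)) *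
    (toric_exp x 0 (lift ord_max i) * conjc (toric_exp x 0 (lift ord_max i)))).
    by rewrite cR; ring.
  by rewrite E2 -[(b 0 _ -i* _)]/(conjc (ccoord b i)); ring.
have DE a : cdot (dtoric_exp x a) (toric_exp x) =
    (s / 2)%:C * Z%:C * meanC u (ccoord a).
  rewrite /cdot (bigD1_ord ord_max) //= !mxE unlift_none mul0r add0r /meanC mulr_sumr.
  apply: eq_bigr => i _; rewrite -[Num.conj _]/(conjc _) ![dtoric_exp _ _ _ _]mxE !liftK.
  by rewrite -mulrA E2; ring.
have ED a : cdot (toric_exp x) (dtoric_exp x a) =
    (s / 2)%:C * Z%:C * conjc (meanC u (ccoord a)).
  by rewrite cdotC DE -rmorphM -[_ * meanC _ _]mulr1 cR !rmorph1 !mulr1.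
have -> : fs_herm (toric_exp x) (dtoric_exp x v) (dtoric_exp x w) =
    (s ^+ 2 / 4)%:C * (meanC u (fun i => ccoord v i * conjc (ccoord w i)) -
      meanC u (ccoord v) * conjc (meanC u (ccoord w))).
  have -> : (s ^+ 2 / 4)%:C = (s / 2)%:C ^+ 2 by rewrite -rmorphXn; congr (_%:C); field.
  by rewrite /fs_herm DD DE ED SE; field.
rewrite cReZ cReD cReN cReM cReJ cImJ !Re_meanC !Im_meanC /cov.
have -> : (\row_i Re (ccoord v i * conjc (ccoord w i))) =
    had (lsubmx v) (lsubmx w) + had (rsubmx v) (rsubmx w).
  by apply/rowP => i; rewrite !mxE cReM cReJ cImJ /=; ring.
have rl a : \row_i Re (ccoord a i) = lsubmx a by apply/rowP => i; rewrite !mxE.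
have rr a : \row_i Im (ccoord a i) = rsubmx a by apply/rowP => i; rewrite !mxE.
by rewrite !rl !rr meanD; ring.
Qed.

End ToricExponential.

(** * The toric parametrization *)

Section ToricParametrization.
Local Open Scope complex_scope.
Local Open Scope classical_set_scope.
Variables (R : realType) (I : finType) (n : nat) (p : 'rV[R]_n -> I -> R).
Variables (c s : R).
Hypotheses (p_inj : injective p) (n0 : (0 < n)%N) (c0 : 0 < c) (s0 : s != 0).
Local Notation D := (exp_family p).
Local Notation M := (family_mfd p).
Local Notation TM := (tangent_bundle M).
Local Notation N := (proj_space n c).
Hypothesis fisher : forall a u v w, @stat_metric R n D a u v w =
  s ^+ 2 / c * cov (s *: u) v w.
Variable Phi : torus R n -> carrier (herm_space N) -> carrier (herm_space N).
Hypothesis PhiE : forall a P, Phi a P = proj_action a P.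
Local Notation Re := complex.Re.
Local Notation Im := complex.Im.
Implicit Types (x y : 'rV[R]_(n + n)) (t k : 'rV[R]_n).

(** As the parametrization is global, a tangent vector has a single coordinate
    expression. *)
Definition tpoint x : carrier TM := [set ((tt, lsubmx x, rsubmx x) : tcoord M)].

Lemma family_locrep_id a u : @locrep R _ _ M M idfun a a u idfun.
Proof.
exists [set: 'rV[R]_n]; split=> //; first exact: openT.
by move=> k; apply: (@Ck_rV _ _ _ _ _ idfun) => [|j]; [exact: openT|exact: coord_smooth].
Qed.

Lemma tvec_family x : @tvec R n M tt (lsubmx x) (rsubmx x) = tpoint x.
Proof.
apply/seteqP; split=> [[[[] u] v] [_ [g [/= -> /= lr -> ->]]]|_ /= ->].
  have [e1 e2 _] := @family_locrep_diff R I n p p_inj tt tt (lsubmx x) g lr.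
  by rewrite e1 e2.
exists (tt, lsubmx x, rsubmx x), idfun; split.
- by [].
- exact: family_locrep_id.
- by [].
- by rewrite [RHS](diff_idfun (lsubmx x)).
Qed.

Lemma tangent_points A : @mfd_points R _ TM A -> exists x, A = tpoint x.
Proof. by move=> [[] [x [_ <-]]]; exists x; rewrite -tvec_family. Qed.

Definition toric_frame (i : 'I_n) : vfield (stat_base D) := fun _ _ => (4 * pi / s) *: delta_mx 0 i.
Local Notation X := toric_frame.

Lemma comb_frame t a u : comb X t a u = (4 * pi / s) *: t.
Proof.
rewrite /comb [in RHS](row_sum_delta t) scaler_sumr; apply: eq_bigr => i _.
by rewrite /toric_frame !scalerA mulrC.
Qed.

Lemma toric_frame_parallel : @parallel_frame R n D X.
Proof.
split.
- move=> i; split; first by move=> a k; exact: Ck_cst.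
  move=> a b u g lr.
  have [_ dg _] := @family_locrep_diff R I n p p_inj a b u g lr.
  by rewrite [RHS]dg.
- by move=> i a u _ v; rewrite /= addr0 (diff_cst _ u).
- move=> a u _.
  have -> : \matrix_i X i a u = (4 * pi / s) *: 1%:M.
    by apply/matrixP => i j; rewrite !mxE eqxx /= eq_sym.
  rewrite unitmxZ ?unitmx1 // unitfE mulf_neq0 ?invr_eq0 //.
  by rewrite mulf_neq0 // gt_eqF // pi_gt0.
Qed.

Lemma fiber_translate_tpoint t x :
  fiber_translate X t (tpoint x) = tpoint (x + shift_fiber s t).
Proof.
have l : lsubmx (x + shift_fiber s t) = lsubmx x.
  by rewrite linearD /shift_fiber /= row_mxKl addr0.
have r : rsubmx (x + shift_fiber s t) = rsubmx x + (4 * pi / s) *: t.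
  by rewrite linearD /shift_fiber /= row_mxKr.
rewrite /fiber_translate /tpoint l r.
by rewrite image_set1 /= comb_frame.
Qed.

Lemma shift_fiberD t k : shift_fiber s (t + k) = shift_fiber s t + shift_fiber s k.
Proof. by rewrite /shift_fiber scalerDr add_row_mx addr0. Qed.

Lemma shift_fiber0 : shift_fiber s (0 : 'rV[R]_n) = 0.
Proof. by rewrite /shift_fiber scaler0 row_mx0. Qed.

Lemma quot_proj_tpoint x :
  quot_proj X (tpoint x) = [set tpoint (x + shift_fiber s k) | k in [set k | k \in @int_vec R n]].
Proof. by apply: eq_imagel => k _; rewrite fiber_translate_tpoint. Qed.

Lemma quot_proj_shift x k : k \in @int_vec R n ->
  quot_proj X (tpoint (x + shift_fiber s k)) = quot_proj X (tpoint x).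
Proof.
move=> ki; rewrite !quot_proj_tpoint; apply/seteqP; split=> _ [l li <-].
  by exists (k + l); rewrite /= ?rpredD // shift_fiberD addrA.
exists (l - k); rewrite /= ?rpredB //.
by rewrite -addrA -shift_fiberD (addrC k) subrK.
Qed.

Lemma tpoint_inj x y : tpoint x = tpoint y -> x = y.
Proof.
move=> e; have : tpoint y (tt, lsubmx x, rsubmx x) by rewrite -e.
by move=> [l r]; rewrite -(hsubmxK x) l r hsubmxK.
Qed.

Lemma quot_proj_eq x y : quot_proj X (tpoint x) = quot_proj X (tpoint y) ->
  exists2 k, k \in @int_vec R n & x = y + shift_fiber s k.
Proof.
move=> e; have : quot_proj X (tpoint y) (tpoint x).
  by rewrite -e quot_proj_tpoint; exists 0; rewrite /= ?rpred0 ?shift_fiber0 ?addr0.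
by rewrite quot_proj_tpoint => -[k ki /tpoint_inj <-]; exists k.
Qed.

(** The map that [toric_exp] induces on the quotient by the lattice. *)
Definition toric_map (Q : set (carrier TM)) : carrier (herm_space N) :=
  [set z | exists A (e : tcoord M),
    [/\ Q A, A e & proj_pt (toric_exp s (row_mx e.1.2 e.2)) z]].

Lemma toric_mapE Q P : Q !=set0 ->
  (forall A, Q A -> exists2 y, A = tpoint y & proj_pt (toric_exp s y) = P) ->
  toric_map Q = P.
Proof.
move=> [A0 QA0] H; apply/seteqP; split=> z.
  move=> [A [e [QA Ae ez]]]; have [y Ay <-] := H A QA.
  by move: Ae ez; rewrite Ay => -> /=; rewrite hsubmxK.
move=> Pz; have [y Ay yP] := H A0 QA0.
exists A0, (tt, lsubmx y, rsubmx y); split=> //; first by rewrite Ay.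
by rewrite /= hsubmxK yP.
Qed.

Lemma toric_map_quot x : toric_map (quot_proj X (tpoint x)) = proj_pt (toric_exp s x).
Proof.
rewrite quot_proj_tpoint; apply: toric_mapE.
  by exists (tpoint (x + shift_fiber s 0)), 0; rewrite /= ?rpred0.
move=> _ [k ki <-]; exists (x + shift_fiber s k) => //.
by rewrite toric_exp_shift // torus_rot_int.
Qed.

(** A lattice translate of a logarithm is another one, so that the choice of [x]
    does not matter. *)
Definition toric_map_inv (P : carrier (herm_space N)) : set (carrier TM) :=
  quot_proj X (tpoint (xget 0 [set x | proj_pt (toric_exp s x) = P])).

Lemma toric_map_inv_quot x :
  toric_map_inv (proj_pt (toric_exp s x)) = quot_proj X (tpoint x).
Proof.
rewrite /toric_map_inv; case: xgetP => [y _ /toric_exp_eq e|/(_ x) []//].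
have [k ki ->] := e s0; exact: quot_proj_shift.
Qed.

Lemma toric_exp_free x : free_points Phi (proj_pt (toric_exp s x)).
Proof.
apply/(free_pointsP PhiE n0 (toric_exp_vec_neq0 s x)) => j.
exact: toric_exp_neq0.
Qed.

Lemma locrep_open_sub d e (M1 : patches R d) (N1 : patches R e) (A : set (carrier N1))
    f a b u g :
  (forall w, chart_dom a w -> A (f (chart_par a w))) ->
  @locrep R d e M1 N1 f a b u g -> @locrep R d e M1 (open_sub A) f a b u g.
Proof.
move=> H [W [oW Wu Cg Hg]]; exists W; split=> // w Ww.
have [aw bg eg] := Hg w Ww; split=> //; split=> //=.
by rewrite /= eg; exact: H.
Qed.

Lemma locrep_sub_open d e (M1 : patches R d) (N1 : patches R e) (A : set (carrier N1))
    f a b u g :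
  @locrep R d e M1 (open_sub A) f a b u g -> @locrep R d e M1 N1 f a b u g.
Proof.
move=> [W [oW Wu Cg Hg]]; exists W; split=> // w Ww.
by have [aw [bg _] eg] := Hg w Ww.
Qed.

Lemma quot_parE (aW : chart_ix (quot_mfd X)) x :
  chart_par aW x = quot_proj X (tpoint x).
Proof. by case: aW => [[] W]; rewrite /= tvec_family. Qed.

Lemma toric_map_hol_isometric :
  @hol_isometric R _ _ (quot_kahler X) (herm_sub (free_points Phi)) toric_map.
Proof.
have fE (aW : chart_ix (quot_mfd X)) x :
    toric_map (chart_par aW x) = proj_pt (toric_exp s x).
  by rewrite quot_parE toric_map_quot.
split.
- move=> [a W] u [oW Wdom inj Wu]; exists ord_max, (fun x => unhomog ord_max (toric_exp s x)).
  apply: locrep_open_sub => [w _|]; first by rewrite fE; exact: toric_exp_free.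
  apply: (@lift_locrep R _ n (quot_mfd X) toric_map (a, W) u W (toric_exp s)) => //.
  + by move=> j; exact: toric_exp_smooth.
  + exact: toric_exp_neq0.
- move=> a b u g /locrep_sub_open lr.
  apply: (@lift_pulls_back R _ n (quot_mfd X) toric_map c
    (@herm_g R _ (quot_kahler X))) lr => {}a {}u _.
  exists (toric_exp s), (dtoric_exp s u); split.
  + by apply: (nearW (nbhs_filter u)) => w; exact: fE.
  + by move=> v j; exact: toric_exp_is_deriveC.
  + move=> v w; rewrite fs_hermE fs_toric_exp //.
    rewrite -[RHS]/(stat_metric _ _ _ _ + stat_metric _ _ _ _) !fisher.
    by rewrite /dom_K /dom_hor /= !addr0; field; rewrite gt_eqF.
- move=> a b u g /locrep_sub_open lr.
  apply: (@lift_intertwines R _ n (quot_mfd X) toric_map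
    (@herm_J R _ (quot_kahler X)) c) lr => {}a {}u _.
  exists (toric_exp s), (dtoric_exp s u); split.
  + by apply: (nearW (nbhs_filter u)) => w; exact: fE.
  + by move=> v j; exact: toric_exp_is_deriveC.
  + by move=> v; rewrite -dtoric_exp_J /= /dom_vec /dom_K /dom_hor /= addr0 subr0.
Qed.

End ToricParametrization.

(** * The inverse of the toric parametrization *)

Section OpenBox.
Local Open Scope complex_scope.
Local Open Scope classical_set_scope.

Lemma nbhs_forall (T : topologicalType) (J : finType) (x : T) (P : J -> set T) :
  (forall j, nbhs x (P j)) -> nbhs x [set y | forall j, P j y].
Proof. by move=> H; apply: filter_forall. Qed.

Lemma open_coord_box (R : realType) d m (f : 'I_m -> 'I_d) (a : 'I_m -> R) (e : R) :
  open [set y : 'rV[R]_d | forall i, `|y 0 (f i) - a i| < e].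
Proof.
rewrite openE => y Hy.
apply: (@nbhs_forall _ _ y (fun i => [set z : 'rV[R]_d | `|z 0 (f i) - a i| < e])) => i.
have cy : {for y, continuous (fun y : 'rV[R]_d => `|y 0 (f i) - a i|)}.
  have cy : {for y, continuous (fun z : 'rV[R]_d => z 0 (f i))}.
    exact: coord_continuous.
  exact: cvg_norm (cvgB cy (cvg_cst _)).
have Ho : nbhs `|y 0 (f i) - a i| [set r : R | r < e].
  by apply: open_nbhs_nbhs; split; [exact: open_lt|exact: Hy].
exact: cy Ho.
Qed.

End OpenBox.

Section Torification.
Local Open Scope complex_scope.
Local Open Scope classical_set_scope.
Variables (R : realType) (I : finType) (n : nat) (p : 'rV[R]_n -> I -> R).
Variables (c s : R).
Hypotheses (p_inj : injective p) (n0 : (0 < n)%N) (c0 : 0 < c) (s0 : s != 0).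
Local Notation D := (exp_family p).
Local Notation M := (family_mfd p).
Local Notation TM := (tangent_bundle M).
Local Notation N := (proj_space n c).
Hypothesis fisher : forall a u v w, @stat_metric R n D a u v w =
  s ^+ 2 / c * cov (s *: u) v w.
Variable Phi : torus R n -> carrier (herm_space N) -> carrier (herm_space N).
Hypothesis PhiE : forall a P, Phi a P = proj_action a P.
Local Notation Re := complex.Re.
Local Notation Im := complex.Im.
Local Notation X := (@toric_frame R I n p s).
Local Notation tpoint := (@tpoint R I n p).

(** The lattice has step [4 * pi / |s|], while two points of the box are less
    than [2 * pi / |s|] apart along the fiber. *)
Lemma quot_box_inj (x0 : 'rV[R]_(n + n)) :
  set_inj [set y : 'rV[R]_(n + n) | forall i : 'I_n,
      `|y 0 (rshift n i) - x0 0 (rshift n i)| < pi / `|s|]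
    (fun y => quot_proj X (@chart_par _ _ TM tt y)).
Proof.
move=> y y' /set_mem Hy /set_mem Hy'; rewrite /= !tvec_family //.
move=> /quot_proj_eq [k /int_vecP ki e].
suff k0 : k = 0 by rewrite e k0 shift_fiber0 addr0.
apply/rowP => i; rewrite [RHS]mxE; apply/eqP/negPn/negP => kn0.
have k1 := norm_intr_ge1 (ki i) kn0.
have es : y 0 (rshift n i) - y' 0 (rshift n i) = 4 * pi / s * k 0 i.
  by rewrite e mxE /shift_fiber row_mxEr [(_ *: k) 0 i]mxE addrAC subrr add0r.
have ns : 0 < `|s| by rewrite normr_gt0.
have : `|y 0 (rshift n i) - y' 0 (rshift n i)| < 2 * (pi / `|s|).
  rewrite -(subrKA (x0 0 (rshift n i))) (le_lt_trans (ler_normD _ _)) //.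
  by rewrite mulr_natl mulr2n ltrD // distrC.
rewrite es !normrM normfV (ger0_norm (pi_ge0 R)) ger0_norm //.
apply/negP; rewrite -leNgt.
have q0 : 0 < pi / `|s| :> R by rewrite divr_gt0 // pi_gt0.
have -> : 4 * pi * `|s|^-1 * `|k 0 i| = 4 * (pi / `|s|) * `|k 0 i| by rewrite mulrA.
nra.
Qed.

(** Near a given point, the ratios of the homogeneous coordinates divided by
    their values at this point stay in the right half-plane, where [logC] is
    smooth; adding it to one logarithm [x0] of the point gives a local branch. Its
    imaginary part lies in ]-pi/2, pi/2[, which keeps the branch in the box of
    [quot_box_inj]. *)
Lemma toric_map_inv_smooth :
  @smooth_map R _ _ (open_sub (free_points Phi)) (quot_mfd X)
    (@toric_map_inv R I n p c s).
Proof.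
move=> k u [_ fu].
have z0 j : homog 1 k u 0 j != 0 :> R[i].
  exact: (free_pointsP PhiE n0 (homog_vec_neq0 k u)).1 fu j.
have [x0 x0E] := toric_exp_surj s0 z0.
pose h (w : 'rV[R]_(n + n)) := homog (1 : R[i]) k w.
pose zeta (i : 'I_n) w := h w 0 (lift ord_max i) / h w 0 ord_max /
  toric_exp s x0 0 (lift ord_max i).
pose U1 := [set w : 'rV[R]_(n + n) | forall j, h w 0 j != 0].
have oU1 : open U1.
  rewrite openE => w Hw; apply: (@nbhs_forall _ _ w (fun j => [set w | h w 0 j != 0])) => j.
  have := openC_neq0 openT (homog_smoothC [set: 'rV[R]_(n + n)] k j).
  by rewrite setTI => oj; apply: open_nbhs_nbhs; split=> //; exact: Hw.
have Cz i : smoothC U1 (zeta i).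
  apply: smoothC_M => //; last exact: smoothC_cst.
  apply: smoothC_M => //; first exact: homog_smoothC.
  by apply: smoothC_V => //; exact: homog_smoothC.
pose U := [set w | U1 w /\ forall i, 0 < Re (zeta i w)].
have oU : open U.
  rewrite openE => w [Hw Pw]; apply: filterI; first exact: open_nbhs_nbhs.
  apply: (@nbhs_forall _ _ w (fun i => [set w | 0 < Re (zeta i w)])) => i; have [/(_ 0%N w Hw) cw _] := Cz i.
  have Ho : nbhs (Re (zeta i w)) [set r : R | 0 < r].
    by apply: open_nbhs_nbhs; split; [exact: open_gt|exact: Pw].
  exact: cw Ho.
have zu i : zeta i u = 1.
  rewrite /zeta.
  have -> : toric_exp s x0 0 (lift ord_max i) = h u 0 (lift ord_max i) / h u 0 ord_max.
    by rewrite x0E [LHS]mxE mulrC.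
  rewrite divff //.
  by rewrite mulf_neq0 // ?invr_eq0; exact: z0.
have Uu : U u by split=> [j|i]; [exact: z0|rewrite zu ltr01].
pose g w := row_mx (\row_i (x0 0 (lshift n i) + 2 / s * Re (logC (zeta i w))))
                   (\row_i (x0 0 (rshift n i) + 2 / s * Im (logC (zeta i w)))).
have Cg : smooth_on U g.
  have Cl i : smoothC U (fun w => logC (zeta i w)).
    apply: logC_smooth => // [|w [_ Hw]]; last exact: Hw.
    by apply: smoothC_sub (Cz i) => w [].
  have [Cl1 Cl2] := (fun i => (Cl i).1, fun i => (Cl i).2).
  apply: smooth_row_mx => // i m; under eq_fun do rewrite mxE.
    by apply: CkD => //; [exact: Ck_cst|apply: CkM => //; [exact: Ck_cst|exact: Cl1]].
  by apply: CkD => //; [exact: Ck_cst|apply: CkM => //; [exact: Ck_cst|exact: Cl2]].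
have gE w : U w -> toric_exp s (g w) = (h w 0 ord_max)^-1 *: h w.
  move=> [Hw Pw]; apply/rowP => j; rewrite [RHS]mxE.
  case: (unliftP ord_max j) => [i ->|->]; last by rewrite toric_exp_max mulVf.
  rewrite toric_exp_lift.
  have -> : (s / 2)%:C * ccoord (g w) i = (s / 2)%:C * ccoord x0 i + logC (zeta i w).
    rewrite /ccoord /g row_mxEl row_mxEr ![(\row__ _) _ _]mxE.
    by apply: complex_eq; rewrite ?(cReD, cImD, cReM, cImM) /=; field.
  rewrite expCD logCK; last exact: Pw.
  rewrite -toric_exp_lift /zeta mulrC divfK; last exact: toric_exp_neq0.
  by rewrite mulrC.
pose B := [set y : 'rV[R]_(n + n) | forall i : 'I_n,
      `|y 0 (rshift n i) - x0 0 (rshift n i)| < pi / `|s|].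
exists (tt, B), g, U; split=> // w Uw; have [Hw Pw] := Uw; split.
- split=> //=; apply/(free_pointsP PhiE n0 (homog_vec_neq0 k w)).
  exact: Hw.
- split=> //; [exact: open_coord_box|exact: quot_box_inj|move=> i].
  rewrite /g row_mxEr mxE addrAC subrr add0r normrM normrM normfV ger0_norm //.
  rewrite -mulrA mulrCA [ltRHS]mulrC ltr_pM2l ?invr_gt0 ?normr_gt0 //.
  rewrite -ltr_pdivlMl // mulrC ltr_norml /logC /=.
  by rewrite atan_gtNpi2 atan_ltpi2.
- rewrite quot_parE // -(toric_map_inv_quot p c s0); congr toric_map_inv.
  by rewrite gE // proj_pt_scale // invr_eq0.
Qed.

Lemma family_toric_parametrization :
  @toric_parametrization R n D N Phi (@lattice_of R n D X) X
    (@toric_map R I n p c s).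
Proof.
split=> //.
- exact: toric_frame_parallel.
- split; first exact: toric_map_hol_isometric.
  exists (@toric_map_inv R I n p c s); first exact: toric_map_inv_smooth.
  split=> [Q [aW [x [_ <-]]]|_ [k [x [[_ fx] <-]]]].
    by rewrite quot_parE // toric_map_quot // toric_map_inv_quot.
  have z0 j : homog 1 k x 0 j != 0 :> R[i].
    exact: (free_pointsP PhiE n0 (homog_vec_neq0 k x)).1 fx j.
  have [x0 x0E] := toric_exp_surj s0 z0.
  have -> : chart_par k x = proj_pt (toric_exp s x0).
    by rewrite x0E proj_pt_scale // invr_eq0.
  by rewrite toric_map_inv_quot // toric_map_quot.
- move=> a Q [aW [x [_ <-]]]; rewrite quot_parE // toric_map_quot // PhiE.
  have [t <-] := torus_classP a; rewrite proj_actionE.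
  apply: toric_mapE.
    exists (tpoint (x + shift_fiber s 0 + shift_fiber s t)), t, (tpoint (x + shift_fiber s 0)).
    split=> //; last by rewrite fiber_translate_tpoint.
    by rewrite quot_proj_tpoint; exists 0; rewrite /= ?rpred0.
  move=> _ [t' [A [et + ->]]]; rewrite quot_proj_tpoint => -[k ki <-].
  exists (x + shift_fiber s k + shift_fiber s t'); first by rewrite fiber_translate_tpoint.
  rewrite !toric_exp_shift // (torus_rot_int _ ki).
  by rewrite (torus_rot_class _ et).
Qed.

Lemma family_torification : torification D Phi.
Proof.
split.
- by split; [exact: (family_dually_flat p_inj c0 s0 fisher)|exact: family_connected].
- by split; [exact: proj_is_kahler|exact: proj_connected].
- by split; [exact: proj_torus_action|exact: proj_effective_action].
- exact: proj_action_hol_isometric.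
- by exists (@lattice_of R n D X), X, (@toric_map R I n p c s);
    exact: family_toric_parametrization.
Qed.

Lemma family_compatible_covering :
  @compatible_covering R n D N Phi
    (fun A => toric_map c s (@quot_proj R n D X A)).
Proof.
exists (@lattice_of R n D X), X, (@toric_map R I n p c s).
by split=> //; exact: family_toric_parametrization.
Qed.

End Torification.

(** * The simplex and the binomial family *)

Section Simplex.
Local Open Scope complex_scope.
Variables (R : realType) (n : nat).
Implicit Types (u v w : 'rV[R]_n) (k : 'I_n.+1).

Lemma simplex_parE u k : simplex_par u k = expR (phase u k) / partfun u.
Proof.
rewrite /simplex_par /phase -/(partfun u); case: unlift => [i|].
  by rewrite expRD expRN lnK // posrE partfun_gt0.
by rewrite expR0 div1r expRN lnK // posrE partfun_gt0.
Qed.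

Lemma ln_simplex_par u k : ln (simplex_par u k) = phase u k - ln (partfun u).
Proof.
by rewrite simplex_parE ln_div ?posrE ?expR_gt0 ?partfun_gt0 // expRK.
Qed.

Lemma simplex_par_inj : injective (@simplex_par R n).
Proof.
move=> u v e; have H k : phase u k - ln (partfun u) = phase v k - ln (partfun v).
  by rewrite -!ln_simplex_par e.
have eZ : ln (partfun u) = ln (partfun v).
  by apply: oppr_inj; have := H ord_max; rewrite !phase_max !sub0r.
apply/rowP => i; have := H (lift ord_max i).
by rewrite eZ !phase_lift => /addIr.
Qed.

Lemma ln_partfun_is_derive u v :
  is_derive u v (fun x => ln (partfun x)) (mean u v).
Proof.
have E : (fun x : 'rV[R]_n => partfun (1 *: x)) = @partfun R n.
  by apply/funext => x; rewrite scale1r.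
have H := partfun_is_derive 1 u v; rewrite !scale1r mul1r E in H.
have [C _] := @partfun_smooth R n 1 1%N; rewrite E in C.
have := is_derive_chain H (C u I) (is_derive1_ln (partfun_gt0 u)).
by congr is_derive; rewrite mulrA mulVf ?mul1r // gt_eqF // partfun_gt0.
Qed.

Lemma phase_is_derive u v k : is_derive u v (fun x => phase x k) (phase v k).
Proof.
case: (unliftP ord_max k) => [i ->|->].
  under eq_fun do rewrite phase_lift; rewrite phase_lift.
  have := coord_is_derive v i (@ex_diff _ _ _ _ _ id id (is_diff_id u)).
  by rewrite (diff_idfun u).
by under eq_fun do rewrite phase_max; rewrite phase_max; exact: is_derive_cst.
Qed.

(** The scores [D_v (ln p)] are the statistics [phase v] minus their means. *)
Lemma simplex_fisher a u v w : @stat_metric R n (simplex R n) a u v w =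
  1 ^+ 2 / 1 * cov (1 *: u) v w.
Proof.
rewrite expr1n divr1 mul1r scale1r.
have D k x : 'D_x (fun y => ln (simplex_par y k)) u = phase x k - mean u x.
  under eq_fun do rewrite ln_simplex_par.
  by have [_ ->] := is_deriveB (phase_is_derive u x k) (ln_partfun_is_derive u x).
transitivity (\sum_k simplex_par u k * ((phase v k - mean u v) * (phase w k - mean u w))).
  by apply: eq_bigr => k _; rewrite !D.
rewrite (bigD1_ord ord_max) //= simplex_parE !phase_max expR0.
rewrite (eq_bigr (fun i => softmax u i *
  (had v w + (- mean u w) *: v + (- mean u v) *: w + (mean u v * mean u w) *: const_mx 1) 0 i)).
  rewrite -/(mean u _) !meanD !meanZ.
  have -> : mean u (const_mx 1) = 1 - (partfun u)^-1.
    by rewrite -sum_softmax; apply: eq_bigr => i _; rewrite mxE mulr1.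
  by rewrite /cov; ring.
by move=> i _; rewrite simplex_parE !phase_lift !mxE /softmax; ring.
Qed.

End Simplex.

Section Binomial.
Local Open Scope complex_scope.
Variables (R : realType).

Definition binomial_expectation n (q : R) (f : nat -> R) : R :=
  \sum_(k < n.+1) 'C(n, k)%:R * q ^+ k * (1 - q) ^+ (n - k) * f k.

Lemma binomial_expectation1 n q : binomial_expectation n q (fun=> 1) = 1.
Proof.
rewrite -[RHS](expr1n _ n) -[in RHS](subrK q 1) exprDn.
by apply: eq_bigr => k _; rewrite mulr1 -mulr_natl; ring.
Qed.

(** The absorption identity [k * C(n, k) = n * C(n - 1, k - 1)], from which the
    moments follow. *)
Lemma binomial_expectation_shift n q (f : nat -> R) :
  binomial_expectation n.+1 q (fun k => k%:R * f k) =
  n.+1%:R * q * binomial_expectation n q (fun k => f k.+1).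
Proof.
rewrite /binomial_expectation big_ord_recl mul0r mulr0 add0r mulr_sumr.
apply: eq_bigr => k _; rewrite lift0 subSS exprS.
have e : k.+1%:R * 'C(n.+1, k.+1)%:R = n.+1%:R * 'C(n, k)%:R :> R.
  by rewrite -!natrM -mul_bin_diag.
transitivity ((k.+1%:R * 'C(n.+1, k.+1)%:R) * (q * q ^+ k) * (1 - q) ^+ (n - k) * f k.+1).
  by ring.
by rewrite e; ring.
Qed.

Lemma binomial_expectationD n q f g :
  binomial_expectation n q (fun k => f k + g k) = binomial_expectation n q f + binomial_expectation n q g.
Proof. by rewrite /binomial_expectation -big_split; apply: eq_bigr => k _ /=; rewrite mulrDr. Qed.

Lemma binomial_expectationZ n q a f :
  binomial_expectation n q (fun k => a * f k) = a * binomial_expectation n q f.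
Proof. by rewrite /binomial_expectation mulr_sumr; apply: eq_bigr => k _; rewrite mulrCA. Qed.

Lemma binomial_mean n q : binomial_expectation n q (fun k => k%:R) = n%:R * q.
Proof.
case: n => [|n]; first by rewrite /binomial_expectation big_ord1 mulr0 mul0r.
have := binomial_expectation_shift n q (fun=> 1); rewrite binomial_expectation1 mulr1 => <-.
by apply: eq_bigr => k _; rewrite mulr1.
Qed.

Lemma binomial_variance n q :
  binomial_expectation n q (fun k => (k%:R - n%:R * q) ^+ 2) = n%:R * (q * (1 - q)).
Proof.
case: n => [|n]; first by rewrite /binomial_expectation big_ord1 !mul0r subr0 expr0n mulr0.
set m := n.+1%:R * q.
(* the square is expanded around its factor [k], for [binomial_expectation_shift] *)
transitivity (binomial_expectation n.+1 q (fun k => k%:R * (k%:R + (- 2 * m)) + m ^+ 2 * 1)).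
  by apply: eq_bigr => k _; congr (_ * _); ring.
rewrite binomial_expectationD binomial_expectationZ binomial_expectation1 binomial_expectation_shift.
have -> : binomial_expectation n q (fun k => k.+1%:R + -2 * m) =
    binomial_expectation n q (fun k => k%:R) + (1 - 2 * m) * binomial_expectation n q (fun=> 1).
  rewrite -binomial_expectationZ -binomial_expectationD.
  by apply: eq_bigr => k _; congr (_ * _); rewrite -addn1 natrD; ring.
by rewrite binomial_mean binomial_expectation1 /m -addn1 natrD; ring.
Qed.

Variable n : nat.
Implicit Types (u v w : 'rV[R]_1) (k : 'I_n.+1).

Lemma partfun1 u : partfun u = 1 + expR (u 0 0).
Proof. by rewrite /partfun big_ord1. Qed.

Lemma mean1 u v : mean u v = softmax u 0 * v 0 0.
Proof. by rewrite /mean big_ord1. Qed.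

Lemma binomial_parE u k : binomial_par u k =
  'C(n, k)%:R * expR (k%:R * u 0 0) / partfun u ^+ n.
Proof.
have Z0 : 1 + expR (u 0 0) != 0 by rewrite -partfun1 gt_eqF // partfun_gt0.
have -> : partfun u ^+ n = partfun u ^+ k * partfun u ^+ (n - k).
  by rewrite -exprD subnKC // -ltnS.
rewrite /binomial_par /binomial_pf expRM_natl -partfun1.
have -> : 1 - expR (u 0 0) / partfun u = (partfun u)^-1.
  by rewrite partfun1; field.
rewrite exprMn exprVn invfM exprVn; ring.
Qed.

Lemma bin_gt0R k : 0 < 'C(n, k)%:R :> R.
Proof. by rewrite ltr0n bin_gt0 -ltnS. Qed.

Lemma ln_binomial_par u k : ln (binomial_par u k) =
  ln 'C(n, k)%:R + k%:R * u 0 0 - n%:R * ln (partfun u).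
Proof.
rewrite binomial_parE ln_div ?posrE ?mulr_gt0 ?expR_gt0 ?exprn_gt0 ?partfun_gt0 ?bin_gt0R //.
rewrite lnM ?posrE ?expR_gt0 ?bin_gt0R // expRK lnXn ?partfun_gt0 //.
by rewrite (mulr_natl (ln (partfun u)) n).
Qed.

Lemma binomial_par_inj : (0 < n)%N -> injective (@binomial_par R n).
Proof.
move=> n0 u v e; have H k : k%:R * u 0 0 - n%:R * ln (partfun u) =
    k%:R * v 0 0 - n%:R * ln (partfun v).
  have := ln_binomial_par u k; rewrite e ln_binomial_par -!addrA.
  by move=> /addrI ->.
have e0 := H ord0; rewrite !mul0r !sub0r in e0.
have := H ord_max; rewrite e0 => /addIr /=.
move=> /mulfI e1; apply/rowP => i; rewrite (ord1 i); apply: e1.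
by rewrite pnatr_eq0 -lt0n.
Qed.

(** The variance of the binomial distribution does not change when [q] and
    [1 - q] are exchanged, that is when the natural parameter changes sign. *)
Lemma binomial_fisher a u v w : (0 < n)%N ->
  @stat_metric R 1 (binomials R n) a u v w =
  (-1) ^+ 2 / n%:R^-1 * cov (-1 *: u) v w.
Proof.
move=> n0; set q := softmax u 0.
have D k x : 'D_x (fun y => ln (binomial_par y k)) u = (k%:R - n%:R * q) * x 0 0.
  under eq_fun do rewrite ln_binomial_par.
  have Hc := coord_is_derive x 0 (@ex_diff _ _ _ _ _ id id (is_diff_id u)).
  rewrite (diff_idfun u) in Hc.
  have [_ ->] := is_deriveB (is_deriveD (is_derive_cst (ln 'C(n, k)%:R : R) u x)
    (is_derive_mul (is_derive_cst (k%:R : R) u x) Hc))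
    (is_derive_mul (is_derive_cst (n%:R : R) u x) (ln_partfun_is_derive u x)).
  by rewrite mean1 -/q /cst; ring.
transitivity (binomial_expectation n q (fun k : nat => v 0 0 * w 0 0 * (k%:R - n%:R * q) ^+ 2)).
  apply: eq_bigr => k _; rewrite !D /binomial_par /binomial_pf -partfun1 -/(softmax u 0) -/q.
  by ring.
rewrite binomial_expectationZ binomial_variance invrK sqrrN expr1n mul1r.
have -> : cov (-1 *: u) v w = softmax (-1 *: u) 0 * (1 - softmax (-1 *: u) 0) * (v 0 0 * w 0 0).
  by rewrite /cov !mean1 mxE; ring.
have -> : softmax (-1 *: u) 0 = 1 - q.
  rewrite /q /softmax !partfun1 mxE mulN1r expRN.
  have e0 := expR_gt0 (u 0 0); field.
  by rewrite !gt_eqF // ?addr_gt0 // ?ltr_wpDl.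
by ring.
Qed.

End Binomial.

(** * The Veronese embedding *)

Section Inclusion.
Local Open Scope complex_scope.
Variables (R : realType) (n : nat).
Hypothesis n0 : (0 < n)%N.
Implicit Types (u v : 'rV[R]_1) (k : 'I_n.+1).

(** The logarithms [ln (p i / p n)], which are the natural parameters of the
    binomial distribution [p] as a point of the simplex. *)
Definition inclusion_coord u : 'rV[R]_n :=
  \row_i (ln 'C(n, i)%:R + (i%:R - n%:R) * u 0 0).

Definition inclusion_diff v : 'rV[R]_n := \row_i ((i%:R - n%:R) * v 0 0).

Lemma phase_inclusion u k :
  phase (inclusion_coord u) k = ln 'C(n, k)%:R + (k%:R - n%:R) * u 0 0.
Proof.
case: (unliftP ord_max k) => [i ->|->]; last first.
  by rewrite phase_max /= binn ln1 subrr mul0r addr0.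
by rewrite phase_lift mxE lift_max.
Qed.

Lemma inclusion_coordE u : simplex_par (inclusion_coord u) = binomial_par u.
Proof.
pose A := partfun u ^+ n * expR (- (n%:R * u 0 0)).
have A0 : A != 0 by rewrite mulf_neq0 ?expf_neq0 // gt_eqF ?expR_gt0 ?partfun_gt0.
have E k : expR (phase (inclusion_coord u) k) = binomial_par u k * A.
  rewrite phase_inclusion binomial_parE expRD lnK ?posrE ?bin_gt0R //.
  rewrite mulrBl expRD /A; field.
  by rewrite expf_neq0 // gt_eqF // partfun_gt0.
have Z : partfun (inclusion_coord u) = A.
  transitivity (\sum_k expR (phase (inclusion_coord u) k)).
    rewrite (bigD1_ord ord_max) //= phase_max expR0 /partfun; congr (_ + _).
    by apply: eq_bigr => i _; rewrite phase_lift.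
  rewrite (eq_bigr _ (fun k _ => E k)) -mulr_suml.
  have -> : \sum_(k < n.+1) binomial_par u k = 1.
    rewrite -[RHS](binomial_expectation1 n (expR (u 0 0) / (1 + expR (u 0 0)))).
    by apply: eq_bigr => k _; rewrite mulr1.
  by rewrite mul1r.
by apply/funext => k; rewrite simplex_parE E Z mulfK.
Qed.

Lemma inclusion_coord_smooth (U : set 'rV[R]_1) : open U -> smooth_on U inclusion_coord.
Proof.
move=> oU k; apply: Ck_rV => // i; rewrite /inclusion_coord.
under eq_fun do rewrite mxE.
apply: CkD => //; first exact: Ck_cst.
by apply: CkM => //; [exact: Ck_cst|exact: coord_smooth].
Qed.

Lemma inclusion_coord_diff u v : 'd inclusion_coord u v = inclusion_diff v.
Proof.
have [dg _] := @inclusion_coord_smooth [set: 'rV[R]_1] openT 1%N.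
apply/rowP => i; have [_ <-] := coord_is_derive v i (dg u I).
have Hc := coord_is_derive v 0 (@ex_diff _ _ _ _ _ id id (is_diff_id u)).
rewrite (diff_idfun u) in Hc.
have [_ H] := is_deriveD (is_derive_cst (ln 'C(n, i)%:R : R) u v)
  (is_derive_mul (is_derive_cst (i%:R - n%:R : R) u v) Hc).
rewrite mxE -[RHS]add0r -[X in 0 + X]add0r -[X in 0 + (X + _)](mul0r (u 0 0)) -[RHS]H.
by congr ('D_v _ u); apply/funext => x; rewrite mxE.
Qed.

Local Notation B := (family_mfd (@binomial_par R n)).
Local Notation S := (family_mfd (@simplex_par R n)).
Local Notation incl := (fun p : 'I_n.+1 -> R => p).

Lemma inclusion_locrep a b u : @locrep R 1 n B S incl a b u inclusion_coord.
Proof.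
exists [set: 'rV[R]_1]%classic; split=> //; first exact: openT.
  by apply: inclusion_coord_smooth; exact: openT.
by move=> w _; split=> //; exact: inclusion_coordE.
Qed.

Lemma inclusion_smooth_map : @smooth_map R 1 n B S incl.
Proof. by move=> a u _; exists tt, inclusion_coord; exact: inclusion_locrep. Qed.

(** The parametrization of the simplex is injective, so that [inclusion_coord] is
    the only local expression of the inclusion. *)
Lemma inclusion_tmap (x : 'rV[R]_(1 + 1)) :
  @tmap R 1 n B S incl (@tpoint R _ 1 (@binomial_par R n) x) =
  @tpoint R _ n (@simplex_par R n)
    (row_mx (inclusion_coord (lsubmx x)) (inclusion_diff (rsubmx x))).
Proof.
rewrite /tpoint row_mxKl row_mxKr.
apply/seteqP; split=> [[[[] u'] v'] [t [g [-> /= lr -> ->]]]|_ ->].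
  have [W [oW Wu Cg Hg]] := lr.
  have gE w : W w -> inclusion_coord w = g w.
    move=> Ww; apply: simplex_par_inj; rewrite inclusion_coordE.
    by have [_ _ /esym] := Hg w Ww.
  have nE : \forall w \near lsubmx x, inclusion_coord w = g w.
    by apply: filterS (open_nbhs_nbhs (conj oW Wu)) => w /gE.
  have [dg _] := @inclusion_coord_smooth [set: 'rV[R]_1] openT 1%N.
  have [_ ->] := near_eq_is_diff nE (dg _ I).
  by rewrite inclusion_coord_diff -gE.
exists (tt, lsubmx x, rsubmx x), inclusion_coord; split.
- by [].
- exact: inclusion_locrep.
- by [].
- by rewrite [RHS]inclusion_coord_diff.
Qed.

End Inclusion.

Section Veronese.
Local Open Scope complex_scope.
Variables (R : realType) (n : nat).
Implicit Types (z : 'rV[R[i]]_2) (k : 'I_n.+1).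

Lemma veronese_vecE z k : veronese_vec n z 0 k =
  (Num.sqrt ('C(n, k)%:R : R))%:C * z 0 0 ^+ (n - k) * z 0 1 ^+ k.
Proof. by rewrite mxE. Qed.

Lemma veronese_vecZ (l : R[i]) z : veronese_vec n (l *: z) = l ^+ n *: veronese_vec n z.
Proof.
apply/rowP => k; rewrite [RHS]mxE !veronese_vecE !mxE !exprMn.
have -> : l ^+ n = l ^+ (n - k) * l ^+ k by rewrite -exprD subnK // -ltnS.
by ring.
Qed.

Lemma veroneseE z : @veronese R n (proj_pt z) = proj_pt (veronese_vec n z).
Proof.
apply/seteqP; split=> w.
  move=> [_ /proj_ptP [l l0 ->]].
  by rewrite veronese_vecZ proj_pt_scale // expf_neq0.
by move=> H; exists z => //; exact: proj_pt_refl.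
Qed.

Lemma sqrt_bin_neq0 k : (Num.sqrt ('C(n, k)%:R : R))%:C != 0.
Proof. by rewrite eq_complex /= negb_and gt_eqF // sqrtr_gt0 bin_gt0R. Qed.

Lemma veronese_vec_neq0 z : z != 0 -> exists k, veronese_vec n z 0 k != 0.
Proof.
move=> /rV0Pn [j zj]; have [z0|z0] := eqVneq (z 0 0) 0; last first.
  by exists ord0; rewrite veronese_vecE subn0 expr0 mulr1; apply: mulf_neq0;
    [exact: sqrt_bin_neq0|exact: expf_neq0].
have z1 : z 0 1 != 0.
  case: (unliftP 0 j) zj => [i ->|-> /eqP //].
  by rewrite (ord1 i); congr (z 0 _ != 0); apply: val_inj.
by exists ord_max; rewrite veronese_vecE subnn expr0 mulr1; apply: mulf_neq0;
  [exact: sqrt_bin_neq0|exact: expf_neq0].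
Qed.

Lemma veronese_smooth : @smooth_map R _ _ (proj_mfd R 1) (proj_mfd R n) (@veronese R n).
Proof.
move=> a u _.
have [k zk] := veronese_vec_neq0 (homog_vec_neq0 a u).
exists k, (fun x => unhomog k (veronese_vec n (homog 1 a x))).
apply: (lift_locrep (W := [set: 'rV[R]_(1 + 1)]%classic)
  (Z := fun x => veronese_vec n (homog 1 a x))) => //.
- exact: openT.
- move=> j; under eq_fun do rewrite veronese_vecE.
  apply: smoothC_M openT _ _; last by apply: smoothC_X openT _; exact: homog_smoothC.
  apply: smoothC_M openT (smoothC_cst _ _) _.
  by apply: smoothC_X openT _; exact: homog_smoothC.
- by move=> w _; rewrite /= veroneseE.
Qed.

Definition veronese_weights (t : 'rV[R]_1) : 'rV[R]_n :=
  \row_(k < n) ((n - k)%:R * t 0 0).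

Lemma phase_weights t k : phase (veronese_weights t) k = (n - k)%:R * t 0 0.
Proof.
case: (unliftP ord_max k) => [i ->|->]; first by rewrite phase_lift mxE lift_max.
by rewrite phase_max /= subnn mul0r.
Qed.

Lemma circ_natM m (a : R) : circ (m%:R * a) = circ a ^+ m.
Proof.
elim: m => [|m IH]; first by rewrite mul0r circ0 expr0.
by rewrite -addn1 natrD mulrDl mul1r circD IH exprD expr1.
Qed.

Lemma veronese_rot t z : veronese_vec n (torus_rot t z) =
  torus_rot (veronese_weights t) (veronese_vec n z).
Proof.
apply/rowP => k; rewrite torus_rotE phase_weights circ_natM !veronese_vecE !torus_rotE.
have -> : phase t (0 : 'I_2) = t 0 0.
  by rewrite -(phase_lift t 0); congr phase; apply: val_inj.
have -> : phase t (1 : 'I_2) = 0.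
  by rewrite -(phase_max t); congr phase; apply: val_inj.
rewrite circ0 !mul1r exprMn; ring.
Qed.

Definition veronese_hom (a : torus R 1) : torus R n :=
  torus_class (veronese_weights (repr a)).

Lemma veronese_weightsD t t' :
  veronese_weights (t + t') = veronese_weights t + veronese_weights t'.
Proof. by apply/rowP => i; rewrite !mxE mulrDr. Qed.

Lemma veronese_homE t : veronese_hom (torus_class t) = torus_class (veronese_weights t).
Proof.
apply/torus_class_eq.
have /torus_class_eq/int_vecP H : torus_class (repr (torus_class t)) = torus_class t.
  by rewrite /torus_class reprK.
apply/int_vecP => i; rewrite !mxE -mulrBr.
have H0 := H 0; rewrite !mxE in H0.
by apply: rpredM => //; exact: rpred_nat.
Qed.

Lemma veronese_hom_lie : lie_hom veronese_hom.
Proof.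
split.
  move=> a b; have [t <-] := torus_classP a; have [t' <-] := torus_classP b.
  by rewrite -torus_classD !veronese_homE veronese_weightsD torus_classD.
move=> W u [oW iW Wu].
have Cw (U : set 'rV[R]_1) : open U -> smooth_on U veronese_weights.
  move=> oU k; apply: Ck_rV => // i; rewrite /veronese_weights.
  under eq_fun do rewrite mxE.
  by apply: CkM => //; [exact: Ck_cst|exact: coord_smooth].
pose B := [set t : 'rV[R]_n | forall i,
  `|t 0 i - veronese_weights u 0 i| < 2^-1]%classic.
have oB : open B by exact: (@open_coord_box R n n id).
have oU : open (veronese_weights @^-1` B)%classic.
  by apply: open_comp => // x _; exact: (Cw _ openT 0%N x I).
exists B, veronese_weights, (W `&` veronese_weights @^-1` B)%classic; split.
- exact: openI.
- by split=> // i; rewrite subrr normr0.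
- by apply: Cw; exact: openI.
- move=> w [Ww Bw]; split=> //; last by rewrite /= veronese_homE.
  by split=> //; exact: torus_class_inj_cube.
Qed.

End Veronese.

Section Lift.
Local Open Scope complex_scope.
Variables (R : realType) (n : nat).

(** Both sides are the exponential of [ln 'C(n, k) / 2] plus (k - n) / 2 times
    [u + i xi]. The exponent -1 of [toric_exp] is forced by the order of the
    coordinates of the Veronese embedding, in which the second homogeneous
    coordinate carries the probability of success. *)
Lemma veronese_toric_exp (x : 'rV[R]_(1 + 1)) :
  veronese_vec n (toric_exp (-1) x) =
  toric_exp 1 (row_mx (inclusion_coord n (lsubmx x)) (inclusion_diff n (rsubmx x))).
Proof.
have e0 : toric_exp (-1) x 0 (0 : 'I_2) = expC ((-1 / 2)%:C * ccoord x 0).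
  by rewrite -toric_exp_lift; congr (toric_exp _ _ _ _); apply: val_inj.
have e1 : toric_exp (-1) x 0 (1 : 'I_2) = 1.
  by rewrite -(toric_exp_max (-1) x); congr (toric_exp _ _ _ _); apply: val_inj.
apply/rowP => k; rewrite veronese_vecE e0 e1 expr1n mulr1 -expC_nat.
case: (unliftP ord_max k) => [i ->|->]; last first.
  by rewrite toric_exp_max /= binn sqrtr1 mul1r subnn mul0r expC0.
have b0 : 0 < 'C(n, i)%:R :> R by have := @bin_gt0R R n (lift ord_max i); rewrite lift_max.
have -> : (Num.sqrt 'C(n, lift ord_max i)%:R)%:C = expC ((ln ('C(n, i)%:R : R) / 2)%:C).
  rewrite lift_max; apply: complex_eq; rewrite /expC /= ?sin0 ?cos0 ?mulr0 ?mulr1 //.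
  rewrite -[in LHS](@lnK R 'C(n, i)%:R) ?posrE // [in LHS](splitr (ln _)) expRD -expr2.
  by rewrite sqrtr_sqr ger0_norm // expR_ge0.
rewrite toric_exp_lift -expCD lift_max; congr expC.
have -> : ((n - i)%:R : R[i]) = (n%:R - i%:R : R)%:C.
  by rewrite rmorphB /= !rmorph_nat natrB // ltnW.
rewrite /ccoord row_mxEl row_mxEr !mxE.
by apply: complex_eq; rewrite ?cReD ?cImD ?cReM ?cImM ?cReM ?cImM /=; field.
Qed.

End Lift.

Section Equivariance.
Local Open Scope complex_scope.
Variables (R : realType) (n : nat).
Hypothesis n_ge1 : (0 < n)%N.
Local Notation P1 := (proj_mfd R 1).
Local Notation Pn := (proj_mfd R n).

Lemma veronese_equivariant (a : torus R 1) (p : carrier P1) : mfd_points p ->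
  @veronese R n (proj_action a p) = proj_action (veronese_hom n a) (@veronese R n p).
Proof.
move=> /proj_points [z z0 ->]; have [t <-] := torus_classP a.
by rewrite proj_actionE !veroneseE veronese_rot veronese_homE proj_actionE.
Qed.

(** The embedding sends [1 : 1] to a point without zero coordinates, on which the
    torus acts freely. *)
Lemma veronese_hom_unique (r : torus R 1 -> torus R n) :
  (forall a (p : carrier P1), mfd_points p ->
    @veronese R n (proj_action a p) = proj_action (r a) (@veronese R n p)) ->
  veronese_hom n = r.
Proof.
move=> Hr; apply/funext => a.
pose one : 'rV[R[i]]_2 := const_mx 1.
have one0 : one != 0 by apply/rV0Pn; exists 0; rewrite mxE oner_neq0.
have p1 := @proj_points_pt R 1 one one0.
have e := Hr a _ p1; rewrite (veronese_equivariant a p1) in e.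
have v0 j : veronese_vec n one 0 j != 0.
  by rewrite veronese_vecE !mxE !expr1n !mulr1 sqrt_bin_neq0.
have vn0 : veronese_vec n one != 0 by apply/rV0Pn; exists ord0.
have En (b : torus R n) P : proj_action b P = proj_action b P by [].
have [_ free] := (@free_pointsP R n 1 _ (veronese_vec n one) En n_ge1 vn0).2 v0.
have [_ act0 actD _] := @proj_torus_action R n 1 _ En.
have pn := proj_points_pt vn0.
apply/eqP; rewrite eq_sym -subr_eq0 addrC; apply/eqP; apply: free.
rewrite actD //; move: e; rewrite veroneseE => <-.
by rewrite -actD // addNr act0.
Qed.

End Equivariance.

Theorem proposition11p3 (R : realType) (n : nat) (n_ge1 : (1 <= n)%N) :
  let P1 := proj_space 1 (n%:R^-1 : R) in
  let Pn := proj_space n (1 : R) in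
  let Phi1 : torus R 1 -> carrier (herm_space P1) -> carrier (herm_space P1) :=
    @proj_action R 1 in
  let Phin : torus R n -> carrier (herm_space Pn) -> carrier (herm_space Pn) :=
    @proj_action R n in
  let m : carrier (herm_space P1) -> carrier (herm_space Pn) := @veronese R n in
  [/\ torification (binomials R n) Phi1,
      torification (simplex R n) Phin,
      @is_lift R 1 n (binomials R n) P1 Phi1 (simplex R n) Pn Phin m
        (fun p : 'I_n.+1 -> R => p) &
      exists rho : torus R 1 -> torus R n,
        unique (fun r : torus R 1 -> torus R n =>
                  lie_hom r /\
                  forall a p, @mfd_points R _ (herm_space P1) p ->
                    m (Phi1 a p) = Phin (r a) (m p)) rho /\
        forall t : 'rV[R]_1,
          rho (torus_class t) =
          torus_class (\row_(k < n) ((n - k)%:R * t 0 0))].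
Proof.
move=> P1 Pn Phi1 Phin m.
have ic0 : 0 < n%:R^-1 :> R by rewrite invr_gt0 ltr0n.
have s1 : (-1 : R) != 0 by rewrite oppr_eq0 oner_neq0.
have fb a u v w := @binomial_fisher R n a u v w n_ge1.
have fs a u v w := @simplex_fisher R n a u v w.
have ib := @binomial_par_inj R n n_ge1.
have isx := @simplex_par_inj R n.
have E1 a P : Phi1 a P = proj_action a P by [].
have En a P : Phin a P = proj_action a P by [].
split.
- exact: (@family_torification R _ 1 _ n%:R^-1 (-1) ib _ ic0 s1 fb Phi1 E1).
- exact: (@family_torification R _ n _ 1 1 isx n_ge1 ltr01 (oner_neq0 _) fs Phin En).
- split; [exact: veronese_smooth|exact: inclusion_smooth_map|].
  exists (fun A => toric_map n%:R^-1 (-1) (@quot_proj R 1 (binomials R n)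
    (toric_frame (-1)) A)),
    (fun A => toric_map 1 1 (@quot_proj R n (simplex R n) (toric_frame 1) A)).
  split.
  + exact: (@family_compatible_covering R _ 1 _ n%:R^-1 (-1) ib _ ic0 s1 fb Phi1 E1).
  + exact: (@family_compatible_covering R _ n _ 1 1 isx n_ge1 ltr01 (oner_neq0 _) fs Phin En).
  + move=> A /(tangent_points ib) [x ->].
    rewrite inclusion_tmap // !toric_map_quot // ?oner_neq0 //.
    by rewrite /m veroneseE veronese_toric_exp.
exists (@veronese_hom R n); split; last by move=> t; rewrite veronese_homE.
split; first by split; [exact: veronese_hom_lie|exact: veronese_equivariant].
by move=> r [_ Hr]; exact: veronese_hom_unique.
Qed.
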